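(* Let $p\in\mathbb{N}=\{0,1,2,\dots\}$, $\alpha>0$, and let $\Omega=\{\boldsymbol{x}_1,\dots,\boldsymbol{x}_n\}$ be a set of $n$ distinct points in $\mathbb{R}^d$. Let $\boldsymbol{L}_\varepsilon=[\kappa_\varepsilon(\boldsymbol{x}_i,\boldsymbol{x}_j)]_{i,j=1}^n$ with $\kappa$ a stationary kernel of smoothness order $r\in\mathbb{N}^*=\{1,2,\dots\}$, and let $\mathcal{X}_\varepsilon\sim DPP(\alpha\varepsilon^{-p}\boldsymbol{L}_\varepsilon)$. Let $l$ be whichever of $\frac p2,\frac{p+1}2$ is an integer. Then, as $\varepsilon\to0$ ($\varepsilon>0$), $\mathcal{X}_\varepsilon$ converges to a limit $\mathcal{X}_\star$ given as follows. If $\mathscr{P}_{l-1,d}\ge n$ then, for any value of $r$, $\mathcal{X}_\star=\Omega$ with probability one. Otherwise: 1. if $r<\frac{p+1}2$, then $\mathcal{X}_\star=\Omega$ with probability one; 2. if $r>\frac{p+1}2$, the limit depends on the parity of $p$: (a) if $p$ is odd ($l=\frac{p+1}2$), $\mathcal{X}_\star\sim|DPP|_{\mathscr{P}_{l-1,d}}(\boldsymbol{V}_{\le l-1}\boldsymbol{V}_{\le l-1}^\top)$; (b) if $p$ is even ($l=\frac p2$), $\mathcal{X}_\star\sim DPP\big(\alpha\boldsymbol{V}_l\bar{\boldsymbol{W}}\boldsymbol{V}_l^\top;\boldsymbol{V}_{\le l-1}\big)$, where $\bar{\boldsymbol{W}}=\boldsymbol{W}_{\lrcorner}-\boldsymbol{W}_{\llcorner}(\boldsymbol{W}_{\le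 l-1})^{-1}\boldsymbol{W}_{\urcorner}$ is the Schur complement in the partition $\boldsymbol{W}_{\le l}=\begin{bmatrix}\boldsymbol{W}_{\le l-1}&\boldsymbol{W}_{\urcorner}\\\boldsymbol{W}_{\llcorner}&\boldsymbol{W}_{\lrcorner}\end{bmatrix}$ of the Wronskian matrix; 3. if $r=\frac{p+1}2$, then $\mathcal{X}_\star\sim DPP\big(\alpha f_{2r-1}\boldsymbol{D}^{(2r-1)};\boldsymbol{V}_{\le r-1}\big)$.
   Context: Kernel: a positive definite function $\kappa:\mathbb{R}^d\times\mathbb{R}^d\to\mathbb{R}$ (the matrix $[\kappa(\boldsymbol{y}_i,\boldsymbol{y}_j)]_{i,j}$ is positive definite for any finitely many distinct points). It is stationary if $\kappa(\boldsymbol{x},\boldsymbol{y})=f(\|\boldsymbol{x}-\boldsymbol{y}\|_2)$ for a function $f$; $f$ is assumed analytic in a neighbourhood of $0$, $f(t)=\sum_{i\ge0}f_it^i$, and $\kappa_\varepsilon(\boldsymbol{x},\boldsymbol{y})=f(\varepsilon\|\boldsymbol{x}-\boldsymbol{y}\|_2)$. Smoothness order: $r=\min\{r\ge1:f_{2r-1}\neq0\}$. Polynomials: $\mathscr{H}_{k,d}=\binom{k+d-1}{d-1}$, $\mathscr{P}_{k,d}=\binom{k+d}{d}$ and $\mathscr{P}_{-1,d}=0$. The multivariate Vandermonde matrix is $\boldsymbol{V}_{\le k}=[\boldsymbol{V}_0\cdots\boldsymbol{V}_k]\in\mathbb{R}^{n\times\mathscr{P}_{k,d}}$, where $\boldsymbol{V}_i\in\mathbb{R}^{n\times\mathscr{H}_{i,d}}$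 contains the monomials of degree $i$ in $d$ variables evaluated at the points of $\Omega$ (fixed arbitrary order within a degree). $\boldsymbol{D}^{(s)}=[\|\boldsymbol{x}_i-\boldsymbol{x}_j\|_2^s]_{i,j}$. Wronskian: $\boldsymbol{W}_{\le k}=\left[\frac{\kappa^{(\boldsymbol\alpha,\boldsymbol\beta)}(\boldsymbol{0},\boldsymbol{0})}{\boldsymbol\alpha!\,\boldsymbol\beta!}\right]_{|\boldsymbol\alpha|\le k,|\boldsymbol\beta|\le k}$, multi-indices ordered as the columns of $\boldsymbol{V}_{\le k}$, with $\kappa^{(\boldsymbol\alpha,\boldsymbol\beta)}$ the partial derivative of order $\boldsymbol\alpha$ in the first and $\boldsymbol\beta$ in the second argument. (For $l=0$, $\boldsymbol{V}_{\le-1}$, $\boldsymbol{W}_{\le-1}$ are empty and $\bar{\boldsymbol{W}}=\boldsymbol{W}_{\le0}$.) For $\boldsymbol{L}$ positive semi-definite: $\mathcal{X}\sim DPP(\boldsymbol{L})$ means $\mathbf{P}(\mathcal{X}=X)\propto\det\boldsymbol{L}_X$ for all $X\subseteq\Omega$ (with $\det\boldsymbol{L}_\varnothing=1$); $\mathcal{X}\sim|DPP|_m(\boldsymbol{L})$ means $\mathbf{P}(\mathcal{X}=X)\propto\det\boldsymbol{L}_X$ if $|X|=m$, and $0$ otherwise. Extended L-ensemble: for $\boldsymbol{L}$ symmetric and $\boldsymbol{V}\in\mathbb{R}^{n\times q}$ of full column rank such that $\boldsymbol{x}^\top\boldsymbol{L}\boldsymbol{x}\ge0$ whenever $\boldsymbol{V}^\top\boldsymbol{x}=0$,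 $\mathcal{X}\sim DPP(\boldsymbol{L};\boldsymbol{V})$ means $\mathbf{P}(\mathcal{X}=X)\propto(-1)^q\det\begin{pmatrix}\boldsymbol{L}_X&\boldsymbol{V}_{X,:}\\(\boldsymbol{V}_{X,:})^\top&\boldsymbol{0}\end{pmatrix}$ for all $X\subseteq\Omega$ (for $q=0$ this is $DPP(\boldsymbol{L})$). $\boldsymbol{L}_X$ is the principal submatrix indexed by $X$ and $\boldsymbol{V}_{X,:}$ the submatrix of rows in $X$. Convergence: $\mathbf{P}(\mathcal{X}_\varepsilon=X)\to\mathbf{P}(\mathcal{X}_\star=X)$ for every $X\subseteq\Omega$.
   Formalization: When r ≥ (p+1)/2, the formal statement also assumes that V_{≤l-1} has maximal rank min(n, P_{l-1,d}); without it X_⋆=Ω fails (e.g. d=2, three collinear points, p=3, r=3) or the limit processes in 2 and 3 are undefined. *)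

(* Defs.v *)
From HB Require Import structures.
From mathcomp Require Import all_boot all_order all_algebra.
From mathcomp Require Import all_classical all_reals all_analysis.
Set Implicit Arguments.
Unset Strict Implicit.
Unset Printing Implicit Defensive.
Import Order.TTheory GRing.Theory Num.Theory.
Import numFieldNormedType.Exports.
Local Open Scope classical_set_scope.
Local Open Scope ring_scope.

(* H_{k,d} = binom(k+d-1, d-1); meant for 0 < d. *)
Definition dimH (k d : nat) : nat := 'C((k + d).-1, d.-1).

(* The index is shifted by one: dimP l d is P_{l-1,d} = binom(l-1+d, d), so that
   dimP 0 d is P_{-1,d} = 0. *)
Definition dimP (l d : nat) : nat := if l is k.+1 then 'C(k + d, d) else 0%N.

Lemma sum_dimH (l d : nat) : (0 < d)%N -> (\sum_(i < l) dimH i d)%N = dimP l d.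
Proof.
case: d => // d _; elim: l => [|l IHl]; first by rewrite big_ord0.
rewrite big_ord_recr IHl /dimH /= addnS /=.
case: l {IHl} => [|l] /=; first by rewrite !binn.
by rewrite addSn !addnS binS.
Qed.

Definition mindex (d : nat) := {ffun 'I_d -> nat}.
Definition mdeg (d : nat) (a : mindex d) : nat := (\sum_i a i)%N.
Definition mfact (d : nat) (a : mindex d) : nat := (\prod_i (a i)`!)%N.

(* An arbitrary fixed order of the monomials within each degree: mono k
   enumerates, bijectively, the multi-indices of degree k. *)
Record mono_order (d : nat) := MonoOrder {
  mono : forall k : nat, 'I_(dimH k d) -> mindex d;
  mono_inj : forall k, injective (@mono k);
  mono_deg : forall k i, mdeg (@mono k i) = k;
  mono_surj : forall k (a : mindex d), mdeg a = k -> exists i, @mono k i = a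
}.

Lemma mono_order_exists (d : nat) : (0 < d)%N -> inhabited (mono_order d).
Proof.
case: d => // d _.
pose S k := [set t : d.+1.-tuple 'I_k.+1 | (\sum_(i <- t) i)%N == k]%SET.
have cS k : dimH k d.+1 = #|S k|.
  by rewrite card_ord_partitions /dimH addnS addnC.
pose toS k (i : 'I_(dimH k d.+1)) : d.+1.-tuple 'I_k.+1 :=
  enum_val (cast_ord (cS k) i).
pose m k i : mindex d.+1 := [ffun j => val (tnth (@toS k i) j)].
have mE k i : (mdeg (@m k i) = \sum_(j <- toS k i) j)%N.
  by rewrite /mdeg big_tuple; apply: eq_bigr => j _; rewrite ffunE.
constructor; apply: (@MonoOrder _ m) => [k i j eqm|k i|k a ak].
- apply: (@cast_ord_inj _ _ (cS k)); apply: enum_val_inj.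
  apply: eq_from_tnth => s; apply: val_inj.
  by move/ffunP/(_ s): eqm; rewrite !ffunE.
- by rewrite mE; apply/eqP; have := enum_valP (cast_ord (cS k) i); rewrite inE.
- have lea s : (a s < k.+1)%N by rewrite ltnS -ak /mdeg (bigD1 s) //= leq_addr.
  pose t : d.+1.-tuple 'I_k.+1 := [tuple Ordinal (lea s) | s < d.+1].
  have tS : t \in S k.
    rewrite inE big_tuple; apply/eqP; rewrite -[RHS]ak /mdeg.
    by apply: eq_bigr => s _; rewrite tnth_mktuple.
  exists (cast_ord (esym (cS k)) (enum_rank_in tS t)).
  apply/ffunP => s; rewrite ffunE /toS cast_ordKV enum_rankK_in //.
  by rewrite tnth_mktuple.
Qed.

Definition norm2 (R : realType) (d : nat) (x : 'rV[R]_d) : R :=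
  Num.sqrt (\sum_i x ord0 i ^+ 2).

Definition posdef (R : realType) (m : nat) (A : 'M[R]_m) : Prop :=
  A^T = A /\ forall u : 'cV[R]_m, u != 0 -> 0 < (u^T *m A *m u) ord0 ord0.

Definition possemidef (R : realType) (m : nat) (A : 'M[R]_m) : Prop :=
  A^T = A /\ forall u : 'cV[R]_m, 0 <= (u^T *m A *m u) ord0 ord0.

Definition kernel_mx (R : realType) (d m : nat)
    (K : 'rV[R]_d -> 'rV[R]_d -> R) (y : 'I_m -> 'rV[R]_d) : 'M[R]_m :=
  \matrix_(i, j) K (y i) (y j).

Definition posdef_kernel (R : realType) (d : nat)
    (K : 'rV[R]_d -> 'rV[R]_d -> R) : Prop :=
  forall (m : nat) (y : 'I_m -> 'rV[R]_d), injective y ->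
    posdef (kernel_mx K y).

Definition stationary (R : realType) (d : nat)
    (K : 'rV[R]_d -> 'rV[R]_d -> R) (f : R -> R) : Prop :=
  forall x y, K x y = f (norm2 (x - y)).

Definition scaled_kernel (R : realType) (d : nat) (f : R -> R) (e : R)
    (x y : 'rV[R]_d) : R := f (e * norm2 (x - y)).

Definition analytic_at0 (R : realType) (f : R -> R) (fc : nat -> R) : Prop :=
  \forall t \near (0 : R), pseries fc t @ \oo --> f t.

(* r = min {s >= 1 : fc (2s-1) <> 0}; in particular r is finite. *)
Definition smoothness_order (R : realType) (fc : nat -> R) (r : nat) : Prop :=
  [/\ (1 <= r)%N, fc (r.*2.-1) != 0 &
      forall s, (1 <= s < r)%N -> fc (s.*2.-1) = 0].

Section Wronskian.
Context {R : realType} {d : nat}.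

Definition partial (i : 'I_d) (g : 'rV[R]_d -> R) : 'rV[R]_d -> R :=
  fun x => 'D_(delta_mx ord0 i) (g : 'rV[R]_d -> R^o) x.

Definition mpartial (a : mindex d) (g : 'rV[R]_d -> R) : 'rV[R]_d -> R :=
  foldr (fun i h => iter (a i) (partial i) h) g (enum 'I_d).

Definition kernel_deriv (K : 'rV[R]_d -> 'rV[R]_d -> R) (a b : mindex d)
    (x y : 'rV[R]_d) : R :=
  mpartial a (fun x' => mpartial b (K x') y) x.

Variable o : mono_order d.

(* The block of the Wronskian matrix with |alpha| = i and |beta| = j. *)
Definition wronskian_block (K : 'rV[R]_d -> 'rV[R]_d -> R) (i j : nat) :
    'M[R]_(dimH i d, dimH j d) :=
  \matrix_(s, t) (kernel_deriv K (mono o s) (mono o t) 0 0 /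
                  ((mfact (mono o s))%:R * (mfact (mono o t))%:R)).

(* W_{<= l-1}: blocks of degrees strictly below l, empty for l = 0. *)
Definition wronskian_lt (K : 'rV[R]_d -> 'rV[R]_d -> R) (l : nat) :=
  \mxblock_(i < l, j < l) wronskian_block K i j.

(* W_{<= l} is partitioned as
     [ wronskian_lt K l   wronskian_ur K l     ]
     [ wronskian_ll K l   wronskian_block K l l ]. *)
Definition wronskian_ur (K : 'rV[R]_d -> 'rV[R]_d -> R) (l : nat) :=
  \mxcol_(i < l) wronskian_block K i l.

Definition wronskian_ll (K : 'rV[R]_d -> 'rV[R]_d -> R) (l : nat) :=
  \mxrow_(j < l) wronskian_block K l j.

Definition wronskian_schur (K : 'rV[R]_d -> 'rV[R]_d -> R) (l : nat) :
    'M[R]_(dimH l d) :=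
  wronskian_block K l l
  - wronskian_ll K l *m invmx (wronskian_lt K l) *m wronskian_ur K l.

End Wronskian.

Section Vandermonde.
Context {R : realType} {d n : nat}.
Variables (o : mono_order d) (x : 'I_n -> 'rV[R]_d).

Definition vander_deg (k : nat) : 'M[R]_(n, dimH k d) :=
  \matrix_(i, s) \prod_j x i ord0 j ^+ mono o s j.

(* V_{<= l-1} = [V_0 ... V_{l-1}], empty for l = 0; by sum_dimH it has
   P_{l-1,d} columns. *)
Definition vander_lt (l : nat) := \mxrow_(k < l) vander_deg k.

Definition dist_mx (s : nat) : 'M[R]_n :=
  \matrix_(i, j) norm2 (x i - x j) ^+ s.

End Vandermonde.

(* A random subset of a ground set of n items enters only through its law. *)
Record subset_law (R : realType) (n : nat) := SubsetLaw {
  prob :> {set 'I_n} -> R;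
  prob_ge0 : forall X, 0 <= prob X;
  prob_sum1 : \sum_X prob X = 1
}.

Section Processes.
Context {R : realType} {n : nat}.

Definition proportional (P : subset_law R n) (w : {set 'I_n} -> R) : Prop :=
  exists c : R, forall X, P X = c * w X.

Definition rows_in (X : {set 'I_n}) (q : nat) (V : 'M[R]_(n, q)) :
    'M[R]_(#|X|, q) := rowsub (fun i : 'I_#|X| => enum_val i) V.

Definition principal (X : {set 'I_n}) (L : 'M[R]_n) : 'M[R]_#|X| :=
  mxsub (fun i : 'I_#|X| => enum_val i) (fun i : 'I_#|X| => enum_val i) L.

Definition DPP (L : 'M[R]_n) (P : subset_law R n) : Prop :=
  possemidef L /\ proportional P (fun X => \det (principal X L)).

Definition fixed_size_DPP (m : nat) (L : 'M[R]_n) (P : subset_law R n) : Prop :=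
  possemidef L /\
  proportional P (fun X => if #|X| == m then \det (principal X L) else 0).

Definition extended_DPP (q : nat) (L : 'M[R]_n) (V : 'M[R]_(n, q))
    (P : subset_law R n) : Prop :=
  [/\ L^T = L, \rank V = q,
      forall u : 'cV[R]_n, V^T *m u = 0 -> 0 <= (u^T *m L *m u) ord0 ord0 &
      proportional P (fun X => (-1) ^+ q *
        \det (block_mx (principal X L) (rows_in X V) (rows_in X V)^T 0))].

End Processes.

(* Main.v *)
Require Import Defs.
From mathcomp Require Import all_boot all_order all_algebra.
From mathcomp Require Import all_classical all_reals all_analysis.
From mathcomp Require Import perm ring lra zify.
Import Order.TTheory GRing.Theory Num.Theory.
Import numFieldNormedType.Exports.
Local Open Scope classical_set_scope.
Local Open Scope ring_scope.

(** Why the theorem is true.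

    Let E collect the Taylor terms of the profile f below f_(2r-1) t^(2r-1).  By
    definition of r they have even degree, so E(|x - y|) is a polynomial in
    (x, y), of total degree at most 2r - 2.  Fix l <= r, and sort its monomials
    x^a y^b by whether |a| < l and whether |b| < l.  With V for V_{<= l-1}, D for
    the diagonal matrix of the e^|a|, and W for the coefficients of the x^a y^b
    with |a|, |b| < l, the kernel matrix at scale e is

      K_e = (V D) W (V D)^T + N (V D)^T + (V D) N^T + R_e,     N = O(e^l),

    where R_e = e^(2l) V_l W_l V_l^T + O(e^(2l+1)) if l < r, with W_l the
    coefficients for |a| = |b| = l, and
    R_e = e^(2r-1) f_(2r-1) D^(2r-1) + O(e^(2r)) if l = r, with D^(2r-1) the
    matrix of the distances to the power 2r - 1 ([even_part_decomp],
    [remainder_expand_smooth], [remainder_expand_rough]).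

    Two positivity facts carry the proof.  W is positive definite
    ([wronskian_form_gt0]), and f_(2r-1) D^(2r-1) is positive definite on the
    kernel of V_{<= r-1}^T ([distance_form_gt0]).  Semidefiniteness is the
    positivity of the kernel itself, read at the leading order as e -> 0.  For a
    vector that makes one of these forms vanish, Cauchy-Schwarz (or positivity
    along a line) against well chosen further evaluations gives more: their
    pairing with the vector must be small to a high order, while the odd term
    f_(2r-1) t^(2r-1), not being polynomial in the points, is visible at a lower
    order unless the vector is zero.

    Suppose that V has rank q, its number of columns.  Completing the square
    writes alpha e^-p K_e as U T U^T + S, where U -> V, T^-1 -> 0, and
    S -> alpha M if the Schur complement R_e - N W^-1 N^T is e^p (M + O(e)).
    Since

      det (S_X + U_X T U_X^T) = det T . (-1)^q det [S_X, U_X; U_X^T, - T^-1],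

    dividing by det T, which does not depend on X, lets every weight converge,
    and the limit is the extended L-ensemble of alpha M and V
    ([det_bordered_schur], [flat_limit_extended]).  Here M is
    V_l Wbar V_l^T if p = 2l < 2r - 1, it is 0 if p = 2l - 1 < 2r - 1, and it is
    f_(2r-1) D^(2r-1) if p = 2r - 1 and l = r.  For M = 0 the bordered
    determinants are those of V V^T on the sets of size q, and 0 otherwise
    ([det_offdiag]).

    In the remaining cases K_e >= c e^m for some m < p, because V has
    independent rows (then m = 2l - 2), or because p > 2r - 1 (then m = 2r - 1,
    by Finsler's lemma).  A column of the adjugate of K_e on the indices X and i,
    for i outside X, turns this bound into P(X) = O(e^(p-m)) P(X and i), so all
    the mass goes to the full set ([principal_minor_step], [dpp_limit_full]).

    Finally the coefficients of E(|x - y|) are the entries of the Wronskian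
    matrix: the rest of the kernel is h(x - y) with h(z) = O(|z|^(2r-1)), and
    although h need not be smooth, its iterated partial derivatives of order at
    most 2r - 2 exist near 0 and vanish at 0 ([kernel_deriv_coef]). *)

Set Implicit Arguments.
Unset Strict Implicit.
Unset Printing Implicit Defensive.

(** * Orders of vanishing at the right of 0, and the binomial series *)

Section BigLimits.
Context {R : realType} {T : Type} {F : set_system T} {FF : Filter F}.

Lemma cvg_bigsum (I : Type) (r : seq I) (P : pred I) (u : I -> T -> R) (l : I -> R) :
  (forall i, P i -> u i x @[x --> F] --> l i) ->
  \sum_(i <- r | P i) u i x @[x --> F] --> \sum_(i <- r | P i) l i.
Proof. by move=> H; apply: cvg_big => //; exact: add_continuous. Qed.

Lemma cvg_bigprod (I : Type) (r : seq I) (P : pred I) (u : I -> T -> R) (l : I -> R) :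
  (forall i, P i -> u i x @[x --> F] --> l i) ->
  \prod_(i <- r | P i) u i x @[x --> F] --> \prod_(i <- r | P i) l i.
Proof.
move=> H; elim: r => [|i r IHr].
  by rewrite big_nil; under eq_cvg do rewrite big_nil; exact: cvg_cst.
rewrite big_cons; under eq_cvg do rewrite big_cons.
by case: ifPn => // Pi; apply: cvgM => //; exact: H.
Qed.

End BigLimits.

Section Order.
Context {R : realType}.
Implicit Types (g h : R -> R) (N M : nat).

(** The relation g(e) = O(e^N) as e -> 0 with e > 0. *)
Definition vanish N g : Prop :=
  exists C d : R, [/\ 0 <= C, 0 < d &
    forall e, 0 < e -> e < d -> `|g e| <= C * e ^+ N].

Lemma vanish_le N g h : (exists2 d, 0 < d & forall e, 0 < e -> e < d ->
  `|g e| <= `|h e|) -> vanish N h -> vanish N g.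
Proof.
case=> d1 d10 gh [C [d [C0 d0 H]]]; exists C, (Num.min d d1).
split; rewrite ?lt_min ?d0 ?ltr01 // => e e0.
rewrite lt_min => /andP[? ?]; by rewrite (le_trans (gh _ _ _)) // H.
Qed.

Lemma vanish_near_eq N g h : (exists2 d, 0 < d & forall e, 0 < e -> e < d ->
  g e = h e) -> vanish N h -> vanish N g.
Proof.
by case=> d d0 gh; apply: vanish_le; exists d => // e e0 ed; rewrite gh.
Qed.

Lemma vanish_eq N g h : (forall e, 0 < e -> g e = h e) ->
  vanish N h -> vanish N g.
Proof. by move=> gh; apply: vanish_near_eq; exists 1 => // e e0 _; exact: gh. Qed.

Lemma vanishD N g h : vanish N g -> vanish N h -> vanish N (fun e => g e + h e).
Proof.
move=> [C [d [C0 d0 H]]] [C' [d' [C'0 d'0 H']]].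
exists (C + C'), (Num.min d d'); split; rewrite ?lt_min ?d0 ?addr_ge0 // => e e0.
rewrite lt_min => /andP[? ?]; rewrite (le_trans (ler_normD _ _))//.
by rewrite mulrDl lerD // ?H ?H'.
Qed.

Lemma vanishM N M g h : vanish N g -> vanish M h ->
  vanish (N + M) (fun e => g e * h e).
Proof.
move=> [C [d [C0 d0 H]]] [C' [d' [C'0 d'0 H']]].
exists (C * C'), (Num.min d d'); split; rewrite ?lt_min ?d0 ?mulr_ge0 // => e e0.
rewrite lt_min => /andP[? ?]; rewrite normrM exprD mulrACA.
by rewrite ler_pM // ?H ?H'.
Qed.

Lemma vanish_cst c : vanish 0 (fun=> c).
Proof. by exists `|c|, 1; split => // e _ _; rewrite expr0 mulr1. Qed.

Lemma vanishX N : vanish N (fun e => e ^+ N).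
Proof.
by exists 1, 1; split => // e e0 _; rewrite mul1r ger0_norm // exprn_ge0 // ltW.
Qed.

Lemma vanish0 N : vanish N (fun=> 0).
Proof.
by exists 0, 1; split => // e e0 _; rewrite mul0r normr0.
Qed.

Lemma vanishW N M g : (M <= N)%N -> vanish N g -> vanish M g.
Proof.
move=> MN [C [d [C0 d0 H]]]; exists C, (Num.min d 1).
split; rewrite ?lt_min ?d0 ?ltr01 // => e e0.
rewrite lt_min => /andP[? e1]; rewrite (le_trans (H _ _ _)) // ler_wpM2l //.
by apply: ler_wiXn2l => //; exact: ltW.
Qed.

Lemma vanishZ N c g : vanish N g -> vanish N (fun e => c * g e).
Proof. by move=> Hg; rewrite -[N]add0n; apply: vanishM => //; exact: vanish_cst. Qed.

Lemma vanishN N g : vanish N g -> vanish N (fun e => - g e).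
Proof.
by move=> /(vanishZ (-1)); apply: vanish_eq => e _; rewrite mulN1r.
Qed.

Lemma vanishB N g h : vanish N g -> vanish N h -> vanish N (fun e => g e - h e).
Proof. by move=> Hg /vanishN; exact: vanishD. Qed.

Lemma vanish_sum N (I : Type) (s : seq I) (P : pred I) (F : I -> R -> R) :
  (forall i, P i -> vanish N (F i)) -> vanish N (fun e => \sum_(i <- s | P i) F i e).
Proof.
move=> HF; elim: s => [|i s IHs].
  by apply: vanish_eq (vanish0 N) => e _; rewrite big_nil.
have [Pi|nPi] := boolP (P i).
  by apply: vanish_eq (vanishD (HF _ Pi) IHs) => e _; rewrite big_cons Pi.
by apply: vanish_eq IHs => e _; rewrite big_cons (negPf nPi).
Qed.

Lemma vanish_comp N B g : (0 < B)%N -> vanish N g ->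
  vanish (B * N) (fun e => g (e ^+ B)).
Proof.
move=> B0 [C [d [C0 d0 H]]]; exists C, (Num.min d 1).
split; rewrite ?lt_min ?d0 ?ltr01 // => e e0; rewrite lt_min => /andP[ed e1].
rewrite exprM H ?exprn_gt0 // (le_lt_trans _ ed) //.
by rewrite -[leRHS]expr1; apply: ler_wiXn2l => //; exact: ltW.
Qed.

Lemma vanish_divX N k g : vanish (N + k) (fun e => e ^+ k * g e) -> vanish N g.
Proof.
move=> [C [d [C0 d0 H]]]; exists C, d; split => // e e0 ed.
have := H _ e0 ed; rewrite normrM exprD mulrA [`|_ ^+ _|]ger0_norm; last first.
  by rewrite exprn_ge0 // ltW.
by rewrite (mulrC (e ^+ k)) ler_pM2r // exprn_gt0.
Qed.

Lemma vanish_cvg0 g : vanish 1 g -> g e @[e --> 0^'+] --> (0 : R).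
Proof.
move=> [C [d [C0 d0 H]]]; apply/cvgr0Pnorm_lt => eps eps0.
near=> e.
have e0 : 0 < e by near: e; exact: nbhs_right_gt.
have ed : e < d by near: e; exact: nbhs_right_lt.
apply: le_lt_trans (H _ e0 ed) _; rewrite expr1.
apply: le_lt_trans (_ : (C + 1) * e < _); first by rewrite ler_wpM2r ?lerDl // ltW.
rewrite mulrC -ltr_pdivlMr ?ltr_wpDl //; near: e; apply: nbhs_right_lt.
by rewrite divr_gt0 // ltr_wpDl.
Unshelve. all: by end_near. Qed.

Lemma vanish_cvg g c : vanish 1 (fun e => g e - c) -> g e @[e --> 0^'+] --> c.
Proof.
move=> /vanish_cvg0 H; rewrite -[c]add0r.
under eq_fun do rewrite -[g _](subrK c).
by apply: cvgD => //; exact: cvg_cst.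
Qed.

Lemma vanish1_cst c : vanish 1 (fun=> c) -> c = 0.
Proof. by move/vanish_cvg0/cvg_lim => <- //; rewrite lim_cst. Qed.

(** Dividing by e^j isolates the j-th coefficient of a polynomial whose lower
    coefficients are already known to vanish. *)
Lemma vanish_coef N n (a : nat -> R) :
  vanish N (fun e => \sum_(i < n) a i * e ^+ i) ->
  forall j, (j < N)%N -> (j < n)%N -> a j = 0.
Proof.
move=> H; elim/ltn_ind => j IHj jN jn.
apply: vanish1_cst.
have Hj : vanish j.+1 (fun e => a j * e ^+ j).
  have H1 : vanish j.+1 (fun e => \sum_(i < n | (j < i)%N) a i * e ^+ i).
    apply: vanish_sum => i ji; apply: vanishZ.
    by apply: vanishW ji _; exact: vanishX.
  apply: vanish_eq (vanishB (vanishW jN H) H1) => e _.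
  rewrite [X in X - _](bigID (fun i : 'I_n => (j < i)%N)) /=.
  rewrite addrAC subrr add0r.
  rewrite (bigD1 (Ordinal jn)) /= ?ltnn // big1 ?addr0 // => i.
  rewrite -leqNgt => /andP[ij ne]; rewrite IHj ?mul0r // ?ltn_ord //.
    by rewrite ltn_neqAle ij andbT; apply: contra ne => /eqP ne; apply/eqP/val_inj.
  by rewrite (leq_ltn_trans ij).
apply: (@vanish_divX 1 j); rewrite add1n.
by apply: vanish_eq Hj => e _; rewrite mulrC.
Qed.

End Order.

Section Binomial.
Context {R : realType}.

(** The binomial coefficient (a choose i), for any real a. *)
Definition gbin (a : R) (i : nat) : R := (\prod_(j < i) (a - j%:R)) / i`!%:R.

Lemma gbinS a i : i.+1%:R * gbin a i.+1 = a * gbin (a - 1) i.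
Proof.
rewrite /gbin big_ord_recl subr0 factS natrM.
under eq_bigr => j _ do rewrite /= /bump /= add1n -natr1 opprD addrCA addrC.
have : (i`!%:R : R) != 0 by rewrite pnatr_eq0 -lt0n fact_gt0.
have : (i.+1%:R : R) != 0 by rewrite pnatr_eq0.
under [in RHS]eq_bigr => j _ do rewrite -addrA [-1 - _]addrC addrC.
set P := \prod_(j < i) _; set Q := \prod_(j < i) _.
have -> : P = Q by apply: eq_bigr => j _; ring.
by move=> ? ?; field; apply/andP.
Qed.

Lemma gbin0 a : gbin a 0 = 1.
Proof. by rewrite /gbin big_ord0 fact0 divr1. Qed.

Lemma gbin_gt0 a i : i%:R - 1 < a -> 0 < gbin a i.
Proof.
move=> ia; rewrite divr_gt0 ?ltr0n ?fact_gt0 // prodr_gt0 // => j _.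
rewrite subr_gt0 (le_lt_trans _ ia) // lerBrDr natr1 ler_nat; exact: ltn_ord.
Qed.

Lemma powR1D_bounded (a : R) :
  exists2 C : R, 0 <= C & forall b : R, `|b| <= 2^-1 -> `|(1 + b) `^ a| <= C.
Proof.
exists (2 `^ a + ((2^-1) `^ (- a))^-1).
  by rewrite addr_ge0 ?invr_ge0 ?powR_ge0.
move=> b; rewrite ler_norml => /andP[b1 b2].
rewrite ger0_norm ?powR_ge0 //.
have [a0|a0] := leP 0 a.
  apply: le_trans (_ : 2 `^ a <= _).
    by apply: ge0_ler_powR => //; rewrite ?nnegrE //; lra.
  by rewrite lerDl invr_ge0 powR_ge0.
rewrite -{1}[a]opprK (powRN (1 + b)); apply: le_trans (_ : ((2^-1) `^ (- a))^-1 <= _).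
  rewrite lef_pV2 ?posrE ?powR_gt0 //; try lra.
  by apply: ge0_ler_powR; rewrite ?nnegrE ?oppr_ge0 ?(ltW a0) //; lra.
by rewrite lerDr powR_ge0.
Qed.

(** For the exponent a, the derivative of the remainder is a times the remainder
    of one order less for the exponent a - 1; the mean value theorem then gains
    one power of b. *)
Lemma gbin_expand (N : nat) (a : R) :
  exists2 C : R, 0 <= C & forall b : R, `|b| <= 2^-1 ->
    `|(1 + b) `^ a - \sum_(i < N) gbin a i * b ^+ i| <= C * `|b| ^+ N.
Proof.
elim: N a => [|N IHN] a.
  have [C C0 H] := powR1D_bounded a; exists C => // b /H.
  by rewrite big_ord0 subr0 expr0 mulr1.
have [C C0 H] := IHN (a - 1); exists (`|a| * C); first by rewrite mulr_ge0.
pose g (b : R) : R := (1 + b) `^ a - \sum_(i < N.+1) gbin a i * b ^+ i.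
pose g' (b : R) : R := a * ((1 + b) `^ (a - 1) - \sum_(i < N) gbin (a - 1) i * b ^+ i).
have g0 : g 0 = 0.
  rewrite /g addr0 powR1 big_ord_recl big1 => [|i _].
    by rewrite gbin0 expr0 mulr1 addr0 subrr.
  by rewrite expr0n mulr0.
have dg (b : R) : `|b| <= 2^-1 -> is_derive b (1 : R) g (g' b).
  rewrite ler_norml => /andP[b1 b2].
  have b3 : 0 < 1 + b by lra.
  have d1 : is_derive b (1 : R) (fun b : R => 1 + b) 1.
    have -> : (fun b : R => 1 + b) = cst 1 + id by apply/funext.
    by apply: is_derive_eq; rewrite add0r.
  have dp : is_derive b (1 : R) (fun b => (1 + b) `^ a) (a * (1 + b) `^ (a - 1)).
    have := @is_derive1_comp R (fun x => x `^ a) (fun b => 1 + b) b _ _ (@is_derive1_powR R a (1 + b) b3) d1.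
    by rewrite mulr1.
  pose p := \poly_(i < N.+1) gbin a i.
  have -> : g = (fun b => (1 + b) `^ a) - horner p.
    by apply/funext => c; rewrite /g -[RHS]/((1 + c) `^ a - p.[c]) horner_poly.
  apply: is_derive_eq; rewrite /g' mulrBr; congr (_ - _).
  have -> : p^`() = \poly_(i < N) (a * gbin (a - 1) i).
    apply/polyP => i; rewrite coef_deriv !coef_poly ltnS.
    by case: ifP => _; rewrite ?mul0rn // -mulr_natl gbinS.
  by rewrite horner_poly mulr_sumr; apply: eq_bigr => i _; rewrite -(mulrA a).
move=> b b2.
have key (c : R) : `|c| <= `|b| -> `|g' c| <= `|a| * C * `|b| ^+ N.
  move=> cb; rewrite normrM -mulrA ler_wpM2l // (le_trans (H _ _)) ?(le_trans cb) //.
  by rewrite ler_wpM2l // lerXn2r // nnegrE.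
have lip (u v : R) : u <= v -> `|u| <= `|b| -> `|v| <= `|b| ->
    `|g v - g u| <= `|a| * C * `|b| ^+ N * (v - u).
  move=> uv ub vb.
  have inb c : u <= c -> c <= v -> `|c| <= `|b|.
    move=> uc cv; move: ub vb; rewrite !ler_norml => /andP[? _] /andP[_ ?].
    by apply/andP; split; lra.
  have [||c] := @MVT_segment _ g g' u v uv.
  - move=> c; rewrite in_itv /= => /andP[/ltW uc /ltW cv].
    by apply: dg; exact: le_trans (inb _ uc cv) b2.
  - apply: derivable_within_continuous => c; rewrite in_itv /= => /andP[uc cv].
    have /dg d : `|c| <= 2^-1 by exact: le_trans (inb _ uc cv) b2.
    exact: ex_derive.
  rewrite in_itv /= => /andP[uc cv] ->.
  by rewrite normrM [`|v - u|]ger0_norm ?subr_ge0 // ler_wpM2r ?subr_ge0 // key // inb.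
rewrite -/(g b) -[g b]subr0 -g0 exprSr mulrA.
have [b0|b0] := leP 0 b.
  have := lip 0 b b0; rewrite normr0 subr0 => /(_ (normr_ge0 _) (lexx _)).
  by rewrite !(ger0_norm b0).
have := lip b 0 (ltW b0); rewrite normr0 sub0r => /(_ (lexx _) (normr_ge0 _)).
by rewrite distrC -[- b](ltr0_norm b0).
Qed.

End Binomial.

(** * Power series and their derivatives near 0 *)

Section PowerSeries.
Context {R : realType}.
Implicit Types (c : nat -> R) (t x z : R).

Lemma geometric_sum_le (q : R) (n : nat) : 0 <= q -> q < 1 ->
  \sum_(j < n) q ^+ j <= (1 - q)^-1.
Proof.
move=> q0 q1; have q1' : 0 < 1 - q by rewrite subr_gt0.
rewrite -[leRHS]mul1r ler_pdivlMr // mulrC -opprB mulNr -subrX1 opprB.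
by rewrite gerBl exprn_ge0.
Qed.

Lemma natr_geometric_le (q : R) (i : nat) : 0 <= q -> q < 1 ->
  i.+1%:R * q ^+ i <= (1 - q)^-1.
Proof.
move=> q0 q1; apply: le_trans (geometric_sum_le i.+1 q0 q1).
rewrite mulr_natl -[X in _ *+ X]card_ord -sumr_const; apply: ler_sum => j _.
by apply: ler_wiXn2l => //; [exact: ltW|rewrite -ltnS ltn_ord].
Qed.

(** The factor i + 1 of the derived series is absorbed by passing through a
    radius y strictly between |z| and |x|. *)
Lemma is_cvg_pseries_diffs c x z : cvgn (pseries c x) -> `|z| < `|x| ->
  cvgn (pseries (pseries_diffs c) z).
Proof.
move=> cx zx; pose y : R := (`|z| + `|x|) / 2.
have zy : `|z| < y by rewrite /y; lra.
have yx : y < `|x| by rewrite /y; lra.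
have y0 : 0 < y by rewrite (le_lt_trans _ zy).
have qy0 : 0 <= `|z| / y by rewrite divr_ge0 // ltW.
have qy1 : `|z| / y < 1 by rewrite ltr_pdivrMr // mul1r.
have cy : cvgn (pseries (fun i => `|c i|) y).
  by apply: is_cvg_pseries_inside_norm cx _; rewrite ger0_norm // ltW.
apply: normed_cvg.
pose D := (1 - `|z| / y)^-1 / y.
have D0 : 0 <= D by rewrite mulr_ge0 ?invr_ge0 ?subr_ge0 // ltW.
pose v i := D * (`|c i.+1| * y ^+ i.+1).
have v0 i : 0 <= v i.
  by apply: mulr_ge0 => //; apply: mulr_ge0 => //; exact: exprn_ge0 (ltW y0).
apply: (@series_le_cvg _ _ v _ v0) => [i|i|]; first exact: normr_ge0.
- rewrite /=.
  rewrite /v /D /pseries_diffs !normrM normr_nat normrX.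
  have -> : i.+1%:R * `|c i.+1| * `|z| ^+ i =
            i.+1%:R * (`|z| / y) ^+ i * (`|c i.+1| * y ^+ i).
    rewrite expr_div_n; field; by rewrite expf_neq0 // gt_eqF.
  set w := (1 - `|z| / y)^-1.
  have -> : w / y * (`|c i.+1| * y ^+ i.+1) = w * (`|c i.+1| * y ^+ i).
    by rewrite exprS; field; rewrite gt_eqF.
  apply: ler_wpM2r; last exact: natr_geometric_le.
  by rewrite mulr_ge0 // exprn_ge0 // ltW.
- have -> : series v = fun n => D * ((pseries (fun i => `|c i|) y n.+1) - `|c 0%N|).
    apply/funext => n; rewrite /pseries /series /= big_nat_recl //= expr0 mulr1.
    by rewrite addrAC subrr add0r /v mulr_sumr.
  case/cvg_ex: cy => L cy; apply/cvg_ex; exists (D * (L - `|c 0%N|)).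
  apply: cvgM; first exact: cvg_cst.
  by apply: cvgB; [rewrite (cvg_shiftS (pseries _ y))|exact: cvg_cst].
Qed.

Lemma is_cvg_pseries_iter_diffs c r k t :
  (forall t, `|t| < r -> cvgn (pseries c t)) -> `|t| < r ->
  cvgn (pseries (iter k (@pseries_diffs R) c) t).
Proof.
move=> H; elim: k t => [|k IHk] t tr; first exact: H.
pose y : R := (`|t| + r) / 2.
have y0 : 0 <= y by rewrite /y; have := normr_ge0 t; lra.
apply: (@is_cvg_pseries_diffs _ y); last by rewrite (ger0_norm y0) /y; lra.
by apply: IHk; rewrite (ger0_norm y0) /y; lra.
Qed.

Lemma is_derive_pseries c r t :
  (forall t, `|t| < r -> cvgn (pseries c t)) -> `|t| < r ->
  is_derive t (1 : R) (fun t => limn (pseries c t)) (limn (pseries (pseries_diffs c) t)).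
Proof.
move=> H tr; pose y : R := (`|t| + r) / 2.
have y0 : 0 <= y by rewrite /y; have := normr_ge0 t; lra.
have yr : `|y| < r by rewrite (ger0_norm y0) /y; lra.
apply: (@pseries_snd_diffs _ _ y).
- exact: H.
- exact: (@is_cvg_pseries_iter_diffs c r 1).
- exact: (@is_cvg_pseries_iter_diffs c r 2).
- by rewrite (ger0_norm y0) /y; lra.
Qed.

Lemma lim_norm_le (u : nat -> R) (B : R) : cvgn u -> (forall n, `|u n| <= B) ->
  `|limn u| <= B.
Proof.
move=> cu uB; rewrite ler_norml; apply/andP; split.
  by apply: limr_ge => //; near=> n; have := uB n; rewrite ler_norml => /andP[].
by apply: limr_le => //; near=> n; have := uB n; rewrite ler_norml => /andP[].
Unshelve. all: by end_near. Qed.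

(** Relative to |t|^N, the terms are dominated by a geometric series of ratio
    1/2; this is where the radius x / 2 comes from. *)
Lemma pseries_order c x N : 0 < x -> cvgn (pseries c x) ->
  (forall i, (i < N)%N -> c i = 0) ->
  exists2 C : R, 0 <= C & forall t : R, `|t| <= x / 2 ->
    `|limn (pseries c t)| <= C * `|t| ^+ N.
Proof.
move=> x0 cx cN.
have [K [Kr HK]] := cvg_series_bounded cx.
pose K' := `|K| + 1.
have K'0 : 0 <= K' by rewrite addr_ge0.
have Kb i : `|c i * x ^+ i| <= K'.
  by apply: HK => //; rewrite (le_lt_trans (ler_norm _)) // ltrDl.
exists (K' * (2 / x) ^+ N * 2).
  by do 2![apply: mulr_ge0 => //]; apply: exprn_ge0; apply: divr_ge0 => //; exact: ltW.
move=> t tx; apply: lim_norm_le.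
  apply: is_cvg_pseries_inside cx _; rewrite (ger0_norm (ltW x0)).
  by rewrite (le_lt_trans tx) //; lra.
move=> n; rewrite /pseries /series /=.
apply: le_trans (ler_norm_sum _ _ _) _.
have term i : `|c i * t ^+ i| <= K' * (2 / x) ^+ N * `|t| ^+ N * 2^-1 ^+ i.
  have [iN|Ni] := ltnP i N.
    rewrite cN // mul0r normr0; do 3![apply: mulr_ge0 => //]; apply: exprn_ge0 => //.
    by apply: divr_ge0 => //; exact: ltW.
  have -> : c i * t ^+ i = (c i * x ^+ i) * (t / x) ^+ i.
    by rewrite expr_div_n; field; rewrite expf_neq0 // gt_eqF.
  rewrite normrM -!mulrA ler_pM //.
  rewrite normrX normf_div (ger0_norm (ltW x0)) -(subnK Ni) !exprD.
  have q2 : `|t| / x <= 2^-1 by rewrite ler_pdivrMr // mulrC.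
  have -> : (2 / x) ^+ N * (`|t| ^+ N * (2^-1 ^+ (i - N) * 2^-1 ^+ N)) =
            2^-1 ^+ (i - N) * (`|t| / x) ^+ N.
    rewrite !expr_div_n exprVn [2^-1 ^+ N]exprVn; field.
    by rewrite !expf_neq0 ?gt_eqF.
  have tx0 : 0 <= `|t| / x by apply: divr_ge0 => //; exact: ltW.
  apply: ler_wpM2r; first exact: exprn_ge0.
  by rewrite lerXn2r ?nnegrE // invr_ge0.
apply: le_trans (ler_sum _ (fun i _ => term i)) _.
rewrite -mulr_sumr big_mkord [leRHS]mulrAC ler_wpM2l //.
  do 2![apply: mulr_ge0 => //]; apply: exprn_ge0 => //.
  by apply: divr_ge0 => //; exact: ltW.
apply: le_trans (geometric_sum_le _ _ _) _ => //; last first.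
  have -> : 1 - 2^-1 = 2^-1 :> R by lra.
  by rewrite invrK.
by rewrite invf_lt1 // ltr1n.
Qed.

(** Cutting the series rather than dividing the function by t^N keeps the
    remainder a power series, so that it can be differentiated term by term. *)
Lemma analytic_remainder (f : R -> R) c N : analytic_at0 f c ->
  exists2 r : R, 0 < r & forall t, `|t| < r ->
    cvgn (pseries (fun i => if (i < N)%N then 0 else c i) t) /\
    f t = \sum_(i < N) c i * t ^+ i +
          limn (pseries (fun i => if (i < N)%N then 0 else c i) t).
Proof.
case/nbhs_ballP => r /= r0 H; exists r => // t tr.
have /H ct : ball 0 r t by rewrite /ball /= sub0r normrN.
set s := \sum_(i < N) _.
have cv : pseries (fun i => if (i < N)%N then 0 else c i) t @ \oo --> f t - s.
  apply: cvg_trans (cvgB ct (cvg_cst s)); apply: near_eq_cvg; near=> n.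
  have Nn : (N <= n)%N by near: n; exists N.
  rewrite /pseries /series /= !big_mkord /s.
  change (\sum_(0 <= i < n) c i * t ^+ i - \sum_(i < N) c i * t ^+ i =
    \sum_(i < n) (if (i < N)%N then 0 else c i) * t ^+ i).
  rewrite big_mkord (@big_ord_widen _ _ _ N n (fun i => c i * t ^+ i)) //.
  rewrite (bigID (fun i : 'I_n => (i < N)%N)) /=. rewrite addrAC subrr add0r big_mkcond.
  by apply: eq_bigr => i _ /=; case: (i < N)%N; rewrite ?mul0r.
split; first by apply/cvg_ex; exists (f t - s).
by rewrite (cvg_lim _ cv) // addrC subrK.
Unshelve. all: by end_near. Qed.

(** Each derivative lowers the order by one.  With |t|^k on the left, the bound
    also covers the k above N, for which the order of the derivative is just 0. *)
Lemma pseries_deriv_order c r N k : 0 < r ->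
  (forall t, `|t| < r -> cvgn (pseries c t)) ->
  (forall i, (i < N)%N -> c i = 0) ->
  exists2 C : R, 0 <= C & forall t : R, `|t| < r / 4 ->
    `|limn (pseries (iter k (@pseries_diffs R) c) t)| * `|t| ^+ k <= C * `|t| ^+ N.
Proof.
move=> r0 cr cN.
have ck i : (i + k < N)%N -> iter k (@pseries_diffs R) c i = 0.
  elim: k i => [|k IHk] i; first by rewrite addn0; exact: cN.
  by move=> ikN; rewrite /= /pseries_diffs IHk ?mulr0 // addSnnS.
have r2 : 0 < r / 2 by rewrite divr_gt0.
have [||C C0 HC] := @pseries_order (iter k (@pseries_diffs R) c) (r / 2) (N - k) r2.
- apply: is_cvg_pseries_iter_diffs cr _.
  by rewrite gtr0_norm // ltr_pdivrMr // ltr_pMr // ltr1n.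
- by move=> i iN; apply: ck; lia.
exists (C * (r ^+ (N - k + k - N))).
  by rewrite mulr_ge0 // exprn_ge0 // ltW.
move=> t tr.
apply: le_trans (_ : C * `|t| ^+ (N - k) * `|t| ^+ k <= _).
  by rewrite ler_wpM2r ?exprn_ge0 // HC //; lra.
rewrite -!mulrA ler_wpM2l // -exprD.
have {1}-> : (N - k + k = (N - k + k - N) + N)%N by lia.
rewrite exprD ler_wpM2r ?exprn_ge0 // lerXn2r ?nnegrE ?(ltW r0) //.
by apply: ltW; lra.
Qed.

Lemma analytic_expand (f : R -> R) c N : analytic_at0 f c ->
  exists C d : R, [/\ 0 <= C, 0 < d & forall t, `|t| < d ->
    `|f t - \sum_(i < N) c i * t ^+ i| <= C * `|t| ^+ N].
Proof.
move=> /(analytic_remainder N)[r r0 H].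
have [||C C0 HC] := @pseries_deriv_order (fun i => if (i < N)%N then 0 else c i) r N 0 r0.
- by move=> t /H[].
- by move=> i ->.
exists C, (r / 4); split; rewrite ?divr_gt0 // => t tr.
have [|_ ->] := H t; first by lra.
by rewrite addrAC subrr add0r; have := HC _ tr; rewrite expr0 mulr1.
Qed.

End PowerSeries.

(** * Monomials, polynomial functions and the Euclidean norm *)

Section Monomials.
Context {R : realType} {d : nat}.
Implicit Types (a b : mindex d) (x y z : 'rV[R]_d).

Definition mon a x : R := \prod_j x ord0 j ^+ a j.

Definition mindexD a b : mindex d := [ffun j => (a j + b j)%N].
Definition mindex0 : mindex d := [ffun=> 0%N].
Definition mindex1 (i : 'I_d) : mindex d := [ffun j => (j == i : nat)].

Lemma mdegD a b : mdeg (mindexD a b) = (mdeg a + mdeg b)%N.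
Proof. by rewrite /mdeg -big_split; apply: eq_bigr => j _; rewrite ffunE. Qed.

Lemma mdeg0 : mdeg mindex0 = 0%N.
Proof. by rewrite /mdeg big1 // => j _; rewrite ffunE. Qed.

Lemma mdeg1 i : mdeg (mindex1 i) = 1%N.
Proof.
rewrite /mdeg (bigD1 i) //= ffunE eqxx big1 // => j ji.
by rewrite ffunE (negPf ji).
Qed.

Lemma monD a b x : mon (mindexD a b) x = mon a x * mon b x.
Proof. by rewrite /mon -big_split; apply: eq_bigr => j _; rewrite ffunE exprD. Qed.

Lemma mon0 x : mon mindex0 x = 1.
Proof. by rewrite /mon big1 // => j _; rewrite ffunE expr0. Qed.

Lemma mon1 i x : mon (mindex1 i) x = x ord0 i.
Proof.
rewrite /mon (bigD1 i) //= ffunE eqxx big1 ?mulr1 // => j ji.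
by rewrite ffunE (negPf ji) expr0.
Qed.

Lemma monZ a (e : R) x : mon a (e *: x) = e ^+ mdeg a * mon a x.
Proof.
rewrite /mon /mdeg -prodrXr -big_split; apply: eq_bigr => j _ /=.
by rewrite mxE exprMn.
Qed.

Lemma mindex_le_mdeg a j : (a j <= mdeg a)%N.
Proof. by rewrite /mdeg (bigD1 j) //= leq_addr. Qed.

(** Monomials are listed, possibly with repetitions, and not indexed by their
    exponents: sums, products and symmetrizations are then operations on lists. *)
Definition bipoly_eval (s : seq (R * (mindex d * mindex d))) x y : R :=
  \sum_(t <- s) t.1 * (mon t.2.1 x * mon t.2.2 y).

Definition bipoly (D : nat) (k : 'rV[R]_d -> 'rV[R]_d -> R) : Prop :=
  exists2 s, (forall t, t \in s -> (mdeg t.2.1 + mdeg t.2.2 <= D)%N) &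
    forall x y, k x y = bipoly_eval s x y.

Lemma bipoly_ext D k k' : (forall x y, k x y = k' x y) -> bipoly D k -> bipoly D k'.
Proof. by move=> kk' [s sD ks]; exists s => // x y; rewrite -kk'. Qed.

Lemma bipolyW D D' k : (D <= D')%N -> bipoly D k -> bipoly D' k.
Proof. by move=> DD' [s sD ks]; exists s => // t /sD tD; exact: leq_trans DD'. Qed.

Lemma bipolyD D k k' : bipoly D k -> bipoly D k' ->
  bipoly D (fun x y => k x y + k' x y).
Proof.
move=> [s sD ks] [s' sD' ks']; exists (s ++ s').
  by move=> t; rewrite mem_cat => /orP[/sD|/sD'].
by move=> x y; rewrite ks ks' /bipoly_eval big_cat.
Qed.

Lemma bipolyM D D' k k' : bipoly D k -> bipoly D' k' ->
  bipoly (D + D') (fun x y => k x y * k' x y).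
Proof.
move=> [s sD ks] [s' sD' ks'].
exists [seq (t.1 * t'.1, (mindexD t.2.1 t'.2.1, mindexD t.2.2 t'.2.2))
       | t <- s, t' <- s'].
  move=> t /allpairsP[[u v] [/sD us /sD' vs ->]] /=.
  by rewrite !mdegD addnACA leq_add.
move=> x y; rewrite ks ks' /bipoly_eval big_distrl big_allpairs_dep /=.
apply: eq_bigr => t _; rewrite big_distrr /=; apply: eq_bigr => t' _.
by rewrite !monD; ring.
Qed.

Lemma bipoly_cst (c : R) : bipoly 0 (fun _ _ => c).
Proof.
exists [:: (c, (mindex0, mindex0))].
  by move=> t; rewrite inE => /eqP ->; rewrite /= mdeg0.
by move=> x y; rewrite /bipoly_eval big_seq1 !mon0 !mulr1.
Qed.

Lemma bipoly_sum D (I : Type) (r : seq I) (P : pred I) k :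
  (forall i, P i -> bipoly D (k i)) ->
  bipoly D (fun x y => \sum_(i <- r | P i) k i x y).
Proof.
move=> Hk; elim: r => [|i r IHr].
  apply: bipoly_ext (bipolyW (leq0n D) (bipoly_cst 0)) => x y.
  by rewrite big_nil.
have [Pi|Pi] := boolP (P i).
  by apply: bipoly_ext (bipolyD (Hk i Pi) IHr) => x y; rewrite big_cons Pi.
by apply: bipoly_ext IHr => x y; rewrite big_cons (negPf Pi).
Qed.

Lemma bipolyX D k n : bipoly D k -> bipoly (n * D) (fun x y => k x y ^+ n).
Proof.
move=> Hk; elim: n => [|n IHn].
  by apply: bipoly_ext (bipoly_cst 1) => x y; rewrite expr0.
by rewrite mulSn; apply: bipoly_ext (bipolyM Hk IHn) => x y; rewrite exprS.
Qed.

Lemma bipoly_coord_diff i : bipoly 1 (fun x y => x ord0 i - y ord0 i).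
Proof.
exists [:: (1, (mindex1 i, mindex0)); (-1, (mindex0, mindex1 i))].
  by move=> t; rewrite !inE => /orP[] /eqP -> /=; rewrite mdeg0 mdeg1.
move=> x y; rewrite /bipoly_eval big_cons big_seq1 /= !mon0 !mon1.
by rewrite mulr1 !mul1r mulN1r.
Qed.

Definition homog (k : nat) (g : 'rV[R]_d -> R) : Prop :=
  exists2 s : seq (R * mindex d), (forall t, t \in s -> mdeg t.2 = k) &
    forall x, g x = \sum_(t <- s) t.1 * mon t.2 x.

Lemma homog_ext k g g' : (forall x, g x = g' x) -> homog k g -> homog k g'.
Proof. by move=> gg' [s sk gs]; exists s => // x; rewrite -gg'. Qed.

Lemma homogD k g g' : homog k g -> homog k g' -> homog k (fun x => g x + g' x).
Proof.
move=> [s sk gs] [s' sk' gs']; exists (s ++ s').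
  by move=> t; rewrite mem_cat => /orP[/sk|/sk'].
by move=> x; rewrite gs gs' big_cat.
Qed.

Lemma homogM k k' g g' : homog k g -> homog k' g' ->
  homog (k + k') (fun x => g x * g' x).
Proof.
move=> [s sk gs] [s' sk' gs'].
exists [seq (t.1 * t'.1, mindexD t.2 t'.2) | t <- s, t' <- s'].
  by move=> t /allpairsP[[u v] [/sk us /sk' vs ->]] /=; rewrite mdegD us vs.
move=> x; rewrite gs gs' big_distrl big_allpairs_dep /=.
apply: eq_bigr => t _; rewrite big_distrr /=; apply: eq_bigr => t' _.
by rewrite monD; ring.
Qed.

Lemma homog0 k : homog k (fun=> 0).
Proof. by exists [::] => // x; rewrite big_nil. Qed.

Lemma homog_cst (c : R) : homog 0 (fun=> c).
Proof.
exists [:: (c, mindex0)]; first by move=> t; rewrite inE => /eqP -> /=; exact: mdeg0.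
by move=> x; rewrite big_seq1 mon0 mulr1.
Qed.

Lemma homog_mon a : homog (mdeg a) (mon a).
Proof.
exists [:: (1, a)]; first by move=> t; rewrite inE => /eqP ->.
by move=> x; rewrite big_seq1 mul1r.
Qed.

Lemma homog_coord i : homog 1 (fun x => x ord0 i).
Proof.
have := homog_mon (mindex1 i); rewrite mdeg1.
by apply: homog_ext => x; rewrite mon1.
Qed.

Lemma homogZ k (c : R) g : homog k g -> homog k (fun x => c * g x).
Proof. by move=> Hg; rewrite -[k]add0n; apply: homogM => //; exact: homog_cst. Qed.

Lemma homog_sum k (I : Type) (r : seq I) (P : pred I) g :
  (forall i, P i -> homog k (g i)) -> homog k (fun x => \sum_(i <- r | P i) g i x).
Proof.
move=> Hg; elim: r => [|i r IHr].
  by apply: homog_ext (homog0 k) => x; rewrite big_nil.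
have [Pi|Pi] := boolP (P i).
  by apply: homog_ext (homogD (Hg i Pi) IHr) => x; rewrite big_cons Pi.
by apply: homog_ext IHr => x; rewrite big_cons (negPf Pi).
Qed.

Lemma homogX k g n : homog k g -> homog (n * k) (fun x => g x ^+ n).
Proof.
move=> Hg; elim: n => [|n IHn].
  by apply: homog_ext (homog_cst 1) => x; rewrite expr0.
by rewrite mulSn; apply: homog_ext (homogM Hg IHn) => x; rewrite exprS.
Qed.

End Monomials.

Section Norm.
Context {R : realType} {d : nat}.
Implicit Types (x y z : 'rV[R]_d).

Definition dot x y : R := \sum_i x ord0 i * y ord0 i.
Definition nsq x : R := \sum_i x ord0 i ^+ 2.

Lemma nsq_ge0 x : 0 <= nsq x.
Proof. by apply: sumr_ge0 => i _; exact: sqr_ge0. Qed.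

Lemma norm2_ge0 x : 0 <= norm2 x.
Proof. exact: sqrtr_ge0. Qed.

Lemma norm2_sqr x : norm2 x ^+ 2 = nsq x.
Proof. by rewrite sqr_sqrtr // nsq_ge0. Qed.

Lemma nsq_eq0 x : (nsq x == 0) = (x == 0).
Proof.
apply/idP/eqP => [/eqP|->]; last first.
  by rewrite /nsq big1 // => i _; rewrite mxE expr0n.
move=> /psumr_eq0P H; apply/rowP => i; rewrite mxE; apply/eqP.
by rewrite -sqrf_eq0 H // => j _; exact: sqr_ge0.
Qed.

Lemma nsq_gt0 x : x != 0 -> 0 < nsq x.
Proof. by move=> x0; rewrite lt_def nsq_eq0 x0 nsq_ge0. Qed.

Lemma norm2_gt0 x : x != 0 -> 0 < norm2 x.
Proof. by move=> x0; rewrite sqrtr_gt0 nsq_gt0. Qed.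

Lemma norm2_0 : norm2 (0 : 'rV[R]_d) = 0.
Proof. by apply/eqP; rewrite -sqrf_eq0 norm2_sqr nsq_eq0. Qed.

Lemma nsqZ (e : R) x : nsq (e *: x) = e ^+ 2 * nsq x.
Proof. by rewrite /nsq mulr_sumr; apply: eq_bigr => i _; rewrite mxE exprMn. Qed.

Lemma norm2Z (e : R) x : norm2 (e *: x) = `|e| * norm2 x.
Proof. by rewrite /norm2 -!/(nsq _) nsqZ sqrtrM ?sqr_ge0 // sqrtr_sqr. Qed.

Lemma norm2N x : norm2 (- x) = norm2 x.
Proof. by rewrite -scaleN1r norm2Z normrN1 mul1r. Qed.

Lemma nsqB x y : nsq (x - y) = nsq x - 2 * dot x y + nsq y.
Proof.
rewrite /nsq /dot mulr_sumr -sumrB -big_split; apply: eq_bigr => i _ /=.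
by rewrite !mxE; ring.
Qed.

Lemma dotC x y : dot x y = dot y x.
Proof. by apply: eq_bigr => i _; rewrite mulrC. Qed.

Lemma dotZr (e : R) x y : dot x (e *: y) = e * dot x y.
Proof. by rewrite /dot mulr_sumr; apply: eq_bigr => i _; rewrite mxE mulrCA. Qed.

Lemma dotNl x y : dot (- x) y = - dot x y.
Proof. by rewrite /dot -sumrN; apply: eq_bigr => i _; rewrite mxE mulNr. Qed.

Lemma homog_nsq : homog 2 (@nsq).
Proof.
apply: homog_sum => i _; rewrite -[2%N]muln1; apply: homogX.
exact: homog_coord.
Qed.

Lemma homog_dot z : homog 1 (dot z).
Proof.
apply: homog_sum => i _; apply: homogZ; exact: homog_coord.
Qed.

(** Normalized by |z - t x|^2 = |z|^2 (1 + relpert z x t), the form to which the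
    binomial series applies. *)
Definition relpert z x (t : R) : R := t * (t * nsq x - 2 * dot z x) / nsq z.

Lemma nsq_relpert z x t : z != 0 -> nsq (z - t *: x) = nsq z * (1 + relpert z x t).
Proof.
move=> z0; rewrite nsqB nsqZ dotZr /relpert.
by field; rewrite gt_eqF // nsq_gt0.
Qed.

Lemma sqrt_powR (s : R) (m : nat) : 0 <= s -> Num.sqrt s ^+ m = s `^ (m%:R / 2).
Proof.
by move=> s0; rewrite mulrC powRrM powR12_sqrt // powR_mulrn // sqrtr_ge0.
Qed.

Lemma vanish_relpert z x : vanish 1 (relpert z x).
Proof.
have H : vanish (1 + 0) (fun t => t * (t * nsq x - 2 * dot z x)).
  apply: vanishM.
    by apply: vanish_eq (vanishX 1) => e _; rewrite expr1.
  apply: vanishB; last exact: vanish_cst.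
  apply: (@vanishW _ 1) => //.
  by apply: vanish_eq (vanishZ (nsq x) (vanishX 1)) => e _; rewrite expr1 mulrC.
by apply: vanish_eq (vanishZ (nsq z)^-1 H) => e _; rewrite mulrC.
Qed.

(** Away from its singularity at 0 the norm is smooth: for z <> 0, even its odd
    powers have a polynomial expansion along the line z - t x. *)
Lemma norm2_pow_expand z x (m N : nat) : z != 0 ->
  vanish N (fun t => norm2 (z - t *: x) ^+ m -
    norm2 z ^+ m * \sum_(i < N) gbin (m%:R / 2) i * relpert z x t ^+ i).
Proof.
move=> z0; have [C C0 HC] := gbin_expand N (m%:R / 2 : R).
have [K [d0 [K0 d00 HK]]] := vanish_relpert z x.
exists (norm2 z ^+ m * (C * K ^+ N)), (Num.min d0 (2 * (K + 1))^-1); split.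
- by rewrite mulr_ge0 ?exprn_ge0 ?norm2_ge0 // mulr_ge0 // exprn_ge0.
- by rewrite lt_min d00 invr_gt0 mulr_gt0 // ltr_wpDl.
move=> t t0; rewrite lt_min => /andP[td tK].
have {HK} := HK _ t0 td; rewrite expr1; set b := relpert z x t => bK.
have b2 : `|b| <= 2^-1.
  apply: le_trans bK _; have K1 : 0 < K + 1 by rewrite ltr_wpDl.
  apply: le_trans (_ : (K + 1) * t <= _); first by rewrite ler_wpM2r ?lerDl // ltW.
  rewrite mulrC -ler_pdivlMr //; apply: le_trans (ltW tK) _.
  by rewrite invfM.
have b1 : 0 <= 1 + b.
  by move: b2; rewrite ler_norml => /andP[]; lra.
have -> : norm2 (z - t *: x) ^+ m = norm2 z ^+ m * (1 + b) `^ (m%:R / 2).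
  rewrite /norm2 -!/(nsq _) nsq_relpert // sqrtrM ?nsq_ge0 // exprMn.
  by rewrite -(sqrt_powR _ b1).
rewrite -mulrBr normrM ger0_norm ?exprn_ge0 ?norm2_ge0 // -!mulrA.
apply: ler_wpM2l; first by rewrite exprn_ge0 ?norm2_ge0.
apply: le_trans (HC _ b2) _; apply: ler_wpM2l => //.
by rewrite -exprMn lerXn2r ?nnegrE // mulr_ge0 // ltW.
Qed.

End Norm.

(** * Positive definite kernels on finite families; dual weights *)

Lemma big_option (T : finType) (V : nmodType) (g : option T -> V) :
  \sum_o g o = g None + \sum_t g (Some t).
Proof.
rewrite (bigD1 None) //=; congr (_ + _).
rewrite (reindex_omap Some id) /=; last by case.
by apply: eq_bigl => t; rewrite eqxx.
Qed.

Section PositiveFamilies.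
Context {R : realType} {d : nat}.

(** Positive definiteness speaks of distinct points; the weights of the points
    that coincide are added first. *)
Lemma posdef_kernel_ge0 (K : 'rV[R]_d -> 'rV[R]_d -> R) (T : finType)
    (y : T -> 'rV[R]_d) (u : T -> R) : posdef_kernel K ->
  0 <= \sum_s \sum_t u s * u t * K (y s) (y t).
Proof.
move=> Kpd; pose s := undup [seq y t | t <- enum T].
have ys t : y t \in s by rewrite mem_undup; apply: map_f; rewrite mem_enum.
pose p (i : 'I_(size s)) : 'rV[R]_d := nth 0 s i.
have p_inj : injective p.
  by move=> i j /eqP; rewrite nth_uniq ?undup_uniq // => /eqP /val_inj.
pose idx t : 'I_(size s) := Ordinal (etrans (index_mem (y t) s) (ys t)).
have pidx t : p (idx t) = y t by rewrite /p /= nth_index.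
have [U sumU] : exists U : 'cV[R]_(size s), forall g : 'rV[R]_d -> R,
    \sum_t u t * g (y t) = \sum_i U i ord0 * g (p i).
  exists (\col_i \sum_(t | idx t == i) u t) => g.
  rewrite (partition_big idx xpredT) //=; apply: eq_bigr => i _.
  rewrite mxE big_distrl /=; apply: eq_bigr => t /eqP <-.
  by rewrite pidx.
have -> : \sum_s \sum_t u s * u t * K (y s) (y t) =
    (U^T *m kernel_mx K p *m U) ord0 ord0.
  under eq_bigr do under eq_bigr do rewrite -mulrA.
  under eq_bigr do rewrite -mulr_sumr sumU.
  rewrite (sumU (fun x => \sum_i U i ord0 * K x (p i))) -mulmxA mxE.
  apply: eq_bigr => i _; rewrite [U^T _ _]mxE mxE; congr (_ * _).
  by apply: eq_bigr => j _; rewrite mxE mulrC.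
have [->|U0] := eqVneq U 0; first by rewrite mulmx0 mxE.
by apply: ltW; case: (Kpd _ p p_inj) => _; apply.
Qed.

Lemma quadratic_ge0_lin (a b : R) : (forall s, 0 <= a * s ^+ 2 + b * s) -> b = 0.
Proof.
move=> H; apply/eqP; apply: contraT => b0.
have A0 : 0 < `|a| + 1 by rewrite ltr_wpDl.
have b2 : 0 < b ^+ 2 by rewrite lt_def sqrf_eq0 b0 sqr_ge0.
have := H (- b / (`|a| + 1)).
have -> : a * (- b / (`|a| + 1)) ^+ 2 + b * (- b / (`|a| + 1)) =
    b ^+ 2 * (a - (`|a| + 1)) / (`|a| + 1) ^+ 2.
  by field; rewrite gt_eqF.
rewrite pmulr_lge0 ?invr_gt0 ?exprn_gt0 // pmulr_rge0 // leNgt => /negP; case.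
by rewrite subr_lt0 (le_lt_trans (ler_norm a)) // ltrDl.
Qed.

(** Cauchy-Schwarz between a finitely supported functional and the evaluation at
    z: positivity is tested on u together with z, weighted by - c / A.  The + 1
    keeps A positive. *)
Lemma kernel_cauchy_schwarz (K : 'rV[R]_d -> 'rV[R]_d -> R) (T : finType)
    (y : T -> 'rV[R]_d) (u : T -> R) (z : 'rV[R]_d) : posdef_kernel K ->
  (forall x y, K x y = K y x) ->
  (\sum_t u t * K z (y t)) ^+ 2 <=
  (`|K z z| + 1) * \sum_s \sum_t u s * u t * K (y s) (y t).
Proof.
move=> Kpd Ksym; set c := \sum_t u t * K z (y t).
set Q := \sum_s \sum_t u s * u t * K (y s) (y t).
set A := `|K z z| + 1; have A0 : 0 < A by rewrite ltr_wpDl.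
pose w (o : option T) := if o is Some t then u t else - c / A.
pose yw (o : option T) := if o is Some t then y t else z.
have := @posdef_kernel_ge0 K _ yw w Kpd.
rewrite big_option /= big_option /=.
under [X in _ + X]eq_bigr do rewrite big_option /=.
rewrite big_split /= -/Q.
have -> : \sum_t - c / A * u t * K z (y t) = - c / A * c.
  rewrite (eq_bigr (fun t => - c / A * (u t * K z (y t)))).
    by rewrite -[X in _ = _ * X]/(\sum_t u t * K z (y t)) mulr_sumr.
  by move=> t _; rewrite mulrA.
have -> : \sum_i u i * (- c / A) * K (y i) z = - c / A * c.
  rewrite (eq_bigr (fun t => - c / A * (u t * K z (y t)))).
    by rewrite -[X in _ = _ * X]/(\sum_t u t * K z (y t)) mulr_sumr.
  by move=> t _; rewrite Ksym; ring.
move=> H; rewrite -ler_pdivrMl //.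
have Kz : K z z <= A by rewrite (le_trans (ler_norm _)) // lerDl.
have := ler_wpM2l (sqr_ge0 (c / A)) Kz.
have -> : (c / A) ^+ 2 * A = A^-1 * c ^+ 2 by field; rewrite gt_eqF.
have e1 : - c / A * (- c / A) * K z z = (c / A) ^+ 2 * K z z by ring.
have e2 : - c / A * c = - (A^-1 * c ^+ 2) by ring.
by rewrite e1 e2 in H; lra.
Qed.

End PositiveFamilies.

Section DualWeights.
Context {R : realType}.

(** The weights are rows of an inverse Vandermonde matrix on the nodes 1, ..., l. *)
Lemma dual_weights1 (l : nat) : exists nu : nat -> 'I_l -> R,
  forall a b, (a < l)%N -> (b < l)%N ->
    \sum_t nu a t * t.+1%:R ^+ b = (a == b)%:R.
Proof.
pose M := Vandermonde l (\row_(j < l) (j.+1%:R : R)).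
have uM : M \in unitmx.
  rewrite unitmxE det_Vandermonde unitfE; apply/prodf_neq0 => i _.
  apply/prodf_neq0 => j ij; rewrite !mxE subr_eq0 eqr_nat eqSS.
  by rewrite gtn_eqF.
exists (fun a t => if insub a is Some i then invmx M t i else 0) => a b al bl.
rewrite insubT /=.
have := congr1 (fun X : 'M[R]_l => X (Ordinal bl) (Ordinal al)) (mulmxV uM).
rewrite /= !mxE -val_eqE /= eq_sym => <-.
by apply: eq_bigr => t _; rewrite !mxE mulrC.
Qed.

(** Products of one-dimensional weights on the grid {1, ..., l}^d.  Nodes
    starting at 1 make every grid point nonzero. *)
Lemma dual_weights (d l : nat) : (0 < d)%N ->
  exists (T : finType) (p : T -> 'rV[R]_d) (w : mindex d -> T -> R),
    (forall t, p t != 0) /\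
    forall a b, (mdeg a < l)%N -> (mdeg b < l)%N ->
      \sum_t w a t * mon b (p t) = (a == b)%:R.
Proof.
move=> d0; have [nu Hnu] := dual_weights1 l.
exists {ffun 'I_d -> 'I_l},
  (fun t : {ffun 'I_d -> 'I_l} => \row_j (t j).+1%:R),
  (fun (a : mindex d) (t : {ffun 'I_d -> 'I_l}) => \prod_j nu (a j) (t j)); split => [t|a b al bl].
  by apply/eqP => /rowP/(_ (Ordinal d0))/eqP; rewrite !mxE pnatr_eq0.
under eq_bigr do (rewrite /mon -big_split; under eq_bigr do rewrite /= mxE).
rewrite -(bigA_distr_bigA (fun j t => nu (a j) t * t.+1%:R ^+ b j)) /=.
under eq_bigr => j _.
  rewrite Hnu; first over.
    exact: leq_ltn_trans (mindex_le_mdeg a j) al.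
  exact: leq_ltn_trans (mindex_le_mdeg b j) bl.
have [->|ab] := eqVneq a b; first by rewrite big1 // => j _; rewrite eqxx.
have [j abj] : exists j, a j != b j.
  apply/existsP; apply: contraNT ab; rewrite negb_exists => /forallP H.
  by apply/eqP/ffunP => j; apply/eqP; have := H j; rewrite negbK.
by rewrite (bigD1 j) //= (negPf abj) mul0r.
Qed.

End DualWeights.

(** * Expansion of a stationary kernel at small scale *)

Section Coefficients.
Context {R : realType} {d : nat}.
Implicit Types (S : seq (R * (mindex d * mindex d))).

(** The coefficient of x^a y^b, collecting the repetitions in the list. *)
Definition bcoef S (a b : mindex d) : R := \sum_(t <- S | t.2 == (a, b)) t.1.

(** Averaging with the exchanged monomials.  The last conclusion says that the
    list itself is symmetric: it can be used for sums that are not polynomial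
    evaluations, such as those where a and b are restricted by degree. *)
Lemma bipoly_symmetric D (k : 'rV[R]_d -> 'rV[R]_d -> R) :
  (forall x y, k x y = k y x) -> bipoly D k ->
  exists S, [/\ forall t, t \in S -> (mdeg t.2.1 + mdeg t.2.2 <= D)%N,
    forall x y, k x y = bipoly_eval S x y &
    forall g : mindex d -> mindex d -> R,
      \sum_(t <- S) t.1 * g t.2.1 t.2.2 = \sum_(t <- S) t.1 * g t.2.2 t.2.1].
Proof.
move=> ksym [S SD kS].
exists ([seq (t.1 / 2, t.2) | t <- S] ++ [seq (t.1 / 2, (t.2.2, t.2.1)) | t <- S]).
split.
- move=> t; rewrite mem_cat => /orP[] /mapP[t' /SD H ->] //=.
  by rewrite addnC.
- move=> x y; rewrite /bipoly_eval big_cat !big_map /=.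
  have -> : k x y = (k x y + k y x) / 2 by rewrite -(ksym x y); field.
  rewrite !kS /bipoly_eval mulrDl !mulr_suml; congr (_ + _).
    by apply: eq_bigr => t _; ring.
  by apply: eq_bigr => t _; ring.
- by move=> g; rewrite !big_cat !big_map /= addrC.
Qed.

Lemma bcoefE S a b :
  bcoef S a b = \sum_(t <- S) t.1 * ((t.2.1 == a)%:R * (t.2.2 == b)%:R).
Proof.
rewrite /bcoef big_mkcond; apply: eq_bigr => -[u [a' b']] _ /=.
by rewrite xpair_eqE -natrM mulnb; case: (_ && _); rewrite ?mulr1 ?mulr0.
Qed.

Lemma quad_bipoly_eval S (T T' : finType) (u : T -> R) (v : T' -> R)
    (y : T -> 'rV[R]_d) (z : T' -> 'rV[R]_d) :
  \sum_s \sum_t u s * v t * bipoly_eval S (y s) (z t) =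
  \sum_(c <- S) c.1 * ((\sum_s u s * mon c.2.1 (y s)) *
                       (\sum_t v t * mon c.2.2 (z t))).
Proof.
under eq_bigr do under eq_bigr do rewrite /bipoly_eval mulr_sumr.
under eq_bigr do rewrite exchange_big /=.
rewrite exchange_big /=; apply: eq_bigr => c _.
rewrite big_distrl /= mulr_sumr; apply: eq_bigr => s _.
by rewrite !big_distrr /=; apply: eq_bigr => t _; ring.
Qed.

End Coefficients.

Lemma sum_parity (V : nmodType) (F : nat -> V) (n : nat) :
  \sum_(i < n.*2) F i = \sum_(i < n) F i.*2 + \sum_(i < n) F i.*2.+1.
Proof.
elim: n => [|n IHn]; first by rewrite !big_ord0 addr0.
by rewrite doubleS !big_ord_recr /= IHn addrACA -!addrA.
Qed.

Lemma vanish_ge0 (R : realType) (g : R -> R) (c : R) (k : nat) :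
  (forall e, 0 < e -> 0 <= g e) -> vanish k.+1 (fun e => g e - c * e ^+ k) -> 0 <= c.
Proof.
move=> g0 H; have {}H : vanish 1 (fun e => g e / e ^+ k - c).
  apply: (@vanish_divX _ 1 k); rewrite add1n; apply: vanish_eq H => e e0.
  by field; rewrite expf_neq0 // gt_eqF.
rewrite -(cvg_lim _ (vanish_cvg H)) //; apply: limr_ge.
  by apply/cvg_ex; exists c; exact: vanish_cvg.
near=> e; have e0 : 0 < e by near: e; exact: nbhs_right_gt.
by rewrite divr_ge0 ?g0 // exprn_ge0 // ltW.
Unshelve. all: by end_near. Qed.

Section RadialKernel.
Context {R : realType} {d : nat}.
Variables (kappa : 'rV[R]_d -> 'rV[R]_d -> R) (f : R -> R) (fc : nat -> R) (r : nat).
Hypothesis kappa_pd : posdef_kernel kappa.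
Hypothesis kappa_stat : stationary kappa f.
Hypothesis f_analytic : analytic_at0 f fc.
Hypothesis f_order : smoothness_order fc r.

Lemma smoothness_gt0 : (0 < r)%N. Proof. by case: f_order. Qed.

Lemma odd_coef0 m : odd m -> (m < r.*2.-1)%N -> fc m = 0.
Proof.
case: f_order => _ _ H om mr; have -> : m = m./2.+1.*2.-1 by lia.
by apply: H; lia.
Qed.

(** The expansion is taken along e g(e), with g only bounded, because g will be
    the norm of a vector that itself depends on e. *)
Lemma profile_expand N (g : R -> R) : vanish 0 g ->
  vanish N (fun e => f (e * g e) - \sum_(i < N) fc i * (e * g e) ^+ i).
Proof.
move=> [G [dg [G0 dg0 HG]]].
have [C [df [C0 df0 Hf]]] := analytic_expand N f_analytic.
exists (C * G ^+ N), (Num.min dg (df / (G + 1))); split.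
- by rewrite mulr_ge0 // exprn_ge0.
- by rewrite lt_min dg0 divr_gt0 // ltr_wpDl.
move=> e e0; rewrite lt_min => /andP[edg edf].
have eG : `|e * g e| <= G * e.
  rewrite normrM (gtr0_norm e0) mulrC ler_wpM2r ?(ltW e0) //.
  by have := HG _ e0 edg; rewrite expr0 mulr1.
have G1 : 0 < G + 1 by rewrite ltr_wpDl.
apply: le_trans (Hf _ _) _.
  apply: le_lt_trans eG _; rewrite ltr_pdivlMr // in edf.
  apply: le_lt_trans _ edf; rewrite mulrC ler_wpM2l ?(ltW e0) //.
  by rewrite lerDl.
rewrite -mulrA; apply: ler_wpM2l => //.
by rewrite -exprMn lerXn2r ?nnegrE // mulr_ge0 // ltW.
Qed.

(** What precedes the first odd Taylor term: only even powers of the norm occur,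
    so that this is a polynomial in (x, y). *)
Definition even_part (x y : 'rV[R]_d) : R := \sum_(i < r) fc i.*2 * nsq (x - y) ^+ i.

Lemma even_part_bipoly : bipoly (r.*2 - 2) even_part.
Proof.
apply: bipoly_sum => i _; rewrite -[(_ - 2)%N]add0n; apply: bipolyM.
  exact: bipoly_cst.
apply: (@bipolyW _ _ (i * 2)); first by have := ltn_ord i; lia.
apply: bipolyX; apply: bipoly_sum => j _.
apply: bipoly_ext (bipolyX 2 (bipoly_coord_diff j)) => x y.
by rewrite !mxE.
Qed.

Lemma even_part_sym x y : even_part x y = even_part y x.
Proof.
apply: eq_bigr => i _; congr (_ * _ ^+ _); rewrite !nsqB dotC; ring.
Qed.

Lemma kernel_expand (c : R) : 0 <= c ->
  vanish r.*2 (fun e => f (e * c) - (\sum_(i < r) fc i.*2 * (e * c) ^+ i.*2 +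
     fc r.*2.-1 * c ^+ r.*2.-1 * e ^+ r.*2.-1)).
Proof.
move=> c0; apply: vanish_eq (profile_expand r.*2 (vanish_cst c)) => e _.
congr (_ - _); rewrite (sum_parity (fun i => fc i * (e * c) ^+ i)).
congr (_ + _); have := smoothness_gt0; case: r odd_coef0 => // r' H _.
rewrite big_ord_recr /= big1 => [|i _]; last first.
  by rewrite H ?mul0r //= ?odd_double //; have := ltn_ord i; lia.
by rewrite add0r exprMn; ring.
Qed.

Lemma kernel_expand_pair (x y : 'rV[R]_d) :
  vanish r.*2 (fun e => kappa (e *: x) (e *: y) - (even_part (e *: x) (e *: y) +
     fc r.*2.-1 * norm2 (x - y) ^+ r.*2.-1 * e ^+ r.*2.-1)).
Proof.
apply: vanish_eq (kernel_expand (norm2_ge0 (x - y))) => e e0.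
rewrite kappa_stat -scalerBr norm2Z (gtr0_norm e0); congr (_ - (_ + _)).
apply: eq_bigr => i _; congr (_ * _).
by rewrite -scalerBr -norm2_sqr norm2Z (gtr0_norm e0) -exprM mul2n.
Qed.

Lemma kernel_form_expand (T : finType) (y : T -> 'rV[R]_d) (u : T -> R) :
  vanish r.*2 (fun e =>
    \sum_s \sum_t u s * u t * kappa (e *: y s) (e *: y t) -
    (\sum_s \sum_t u s * u t * even_part (e *: y s) (e *: y t) +
     fc r.*2.-1 * (\sum_s \sum_t u s * u t * norm2 (y s - y t) ^+ r.*2.-1) *
     e ^+ r.*2.-1)).
Proof.
have H : vanish r.*2 (fun e => \sum_s \sum_t u s * u t *
    (kappa (e *: y s) (e *: y t) - (even_part (e *: y s) (e *: y t) +
     fc r.*2.-1 * norm2 (y s - y t) ^+ r.*2.-1 * e ^+ r.*2.-1))).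
  apply: vanish_sum => s _; apply: vanish_sum => t _; apply: vanishZ.
  exact: kernel_expand_pair.
apply: vanish_eq H => e _; rewrite mulr_sumr mulr_suml -big_split -sumrB.
apply: eq_bigr => s _ /=; rewrite mulr_sumr mulr_suml -big_split -sumrB.
by apply: eq_bigr => t _ /=; ring.
Qed.

Definition annihilates (T : finType) (y : T -> 'rV[R]_d) (u : T -> R) (n : nat) :=
  forall a, (mdeg a < n)%N -> \sum_t u t * mon a (y t) = 0.

(** In each monomial x^a y^b of the even part, of degree at most 2r - 2, one of
    |a| and |b| is below r. *)
Lemma even_part_annihilated (T : finType) (y : T -> 'rV[R]_d) (u : T -> R) (e : R) :
  annihilates y u r ->
  \sum_s \sum_t u s * u t * even_part (e *: y s) (e *: y t) = 0.
Proof.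
move=> yu; have [S [SD HS _]] := bipoly_symmetric even_part_sym even_part_bipoly.
have r0 := smoothness_gt0.
under eq_bigr do under eq_bigr do rewrite HS.
rewrite (quad_bipoly_eval S u u (fun t => e *: y t) (fun t => e *: y t)).
rewrite big_seq big1 // => c /SD cD.
have z a : (mdeg a < r)%N -> \sum_s u s * mon a (e *: y s) = 0.
  move=> ar; under eq_bigr do rewrite monZ mulrCA.
  by rewrite -mulr_sumr yu // mulr0.
have [/z ->|H] := ltnP (mdeg c.2.1) r; first by rewrite mul0r mulr0.
have /z -> : (mdeg c.2.2 < r)%N by lia.
by rewrite mulr0 mulr0.
Qed.

(** When the degrees below r are annihilated, the distance form is the leading
    term of the form of the scaled kernel, and inherits its sign. *)
Lemma distance_form_ge0 (T : finType) (y : T -> 'rV[R]_d) (u : T -> R) :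
  annihilates y u r ->
  0 <= fc r.*2.-1 * \sum_s \sum_t u s * u t * norm2 (y s - y t) ^+ r.*2.-1.
Proof.
move=> yu; apply: (@vanish_ge0 _ (fun e =>
    \sum_s \sum_t u s * u t * kappa (e *: y s) (e *: y t)) _ r.*2.-1).
  by move=> e _; exact: (posdef_kernel_ge0 (fun t => e *: y t) u kappa_pd).
have -> : r.*2.-1.+1 = r.*2 by have := smoothness_gt0; lia.
apply: vanish_eq (kernel_form_expand y u) => e _.
by rewrite even_part_annihilated // add0r.
Qed.

End RadialKernel.

(** * Strict positivity of the distance form *)

Section Extrapolation.
Context {R : realType}.

(** The nodes -1, 1, ..., L: a single one lies on the side of 0 where |t|^m and
    t^m differ for odd m. *)
Definition exnode L (o : option 'I_L) : R := if o is Some t then t.+1%:R else -1.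

(** Evaluation at -1 minus its extrapolation from the nodes 1, ..., L. *)
Lemma extrapolation_weights L : exists v : option 'I_L -> R,
  v None = 1 /\ forall b, (b < L)%N -> \sum_o v o * exnode o ^+ b = 0.
Proof.
have [nu Hnu] := @dual_weights1 R L.
exists (fun o => if o is Some t then - \sum_(a < L) nu a t * (-1) ^+ a else 1).
split=> // b bL; rewrite big_option /= mul1r.
under eq_bigr do rewrite mulNr mulr_suml.
rewrite sumrN exchange_big /= (bigD1 (Ordinal bL)) //= [X in _ - (_ + X)]big1 ?addr0 => [|a ab].
  under eq_bigr do rewrite mulrAC.
  by rewrite -mulr_suml Hnu // eqxx mul1r subrr.
under eq_bigr do rewrite mulrAC.
by rewrite -mulr_suml Hnu // -[(_ == b)]/(a == Ordinal bL) (negPf ab) mul0r.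
Qed.

Lemma extrapolation_poly L (v : option 'I_L -> R) (q : {poly R}) (e : R) :
  (forall b, (b < L)%N -> \sum_o v o * exnode o ^+ b = 0) ->
  \sum_o v o * q.[e * exnode o] =
  \sum_(i < size q | (L <= i)%N) q`_i * (\sum_o v o * exnode o ^+ i) * e ^+ i.
Proof.
move=> Hv; under eq_bigr do rewrite horner_coef mulr_sumr.
rewrite exchange_big /= [RHS]big_mkcond /=; apply: eq_bigr => i _.
have -> : \sum_o v o * (q`_i * (e * exnode o) ^+ i) =
    q`_i * (\sum_o v o * exnode o ^+ i) * e ^+ i.
  rewrite mulr_sumr mulr_suml; apply: eq_bigr => o _.
  by rewrite exprMn; ring.
by case: leqP => // iL; rewrite Hv // mulr0 mul0r.
Qed.

Lemma vanish_extrapolation L (v : option 'I_L -> R) (q : {poly R}) :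
  (forall b, (b < L)%N -> \sum_o v o * exnode o ^+ b = 0) ->
  vanish L (fun e => \sum_o v o * q.[e * exnode o]).
Proof.
move=> Hv; apply: (@vanish_eq _ _ _ (fun e =>
  \sum_(i < size q | (L <= i)%N) q`_i * (\sum_o v o * exnode o ^+ i) * e ^+ i)).
  by move=> e _; exact: extrapolation_poly.
by apply: vanish_sum => i Li; apply: vanishZ; apply: vanishW Li _; exact: vanishX.
Qed.

(** The weights annihilate t^m, from which |t|^m differs only at the node -1. *)
Lemma extrapolation_abs L (v : option 'I_L -> R) m : odd m -> (m < L)%N ->
  (forall b, (b < L)%N -> \sum_o v o * exnode o ^+ b = 0) ->
  \sum_o v o * `|exnode o| ^+ m = 2 * v None.
Proof.
move=> om mL Hv; have := Hv m mL; rewrite !big_option /= normrN1 expr1n.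
rewrite -signr_odd om expr1 => H.
under eq_bigr do rewrite normr_nat.
have -> : \sum_(t < L) v (Some t) * t.+1%:R ^+ m = v None.
  by apply/eqP; rewrite -subr_eq0 -mulN1r addrC mulrC; apply/eqP.
by rewrite mulr1 mulr2n mulrDl mul1r.
Qed.

End Extrapolation.

Section Strictness.
Context {R : realType} {d : nat}.

Definition dform m (T T' : finType) (y : T -> 'rV[R]_d) (u : T -> R)
    (z : T' -> 'rV[R]_d) (v : T' -> R) : R :=
  \sum_s \sum_t u s * v t * norm2 (y s - z t) ^+ m.

Lemma dform_sum m (T T' : finType) (y : T -> 'rV[R]_d) (u : T -> R)
    (z : T' -> 'rV[R]_d) (v : T' -> R) (s : R) :
  let yz (o : T + T') := match o with inl t => y t | inr t => z t end in
  let uv (o : T + T') := match o with inl t => u t | inr t => s * v t end in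
  dform m yz uv yz uv =
  dform m z v z v * s ^+ 2 + 2 * dform m y u z v * s + dform m y u y u.
Proof.
rewrite /= /dform big_sumType /=.
under eq_bigr do rewrite big_sumType /=.
under [X in _ + X]eq_bigr do rewrite big_sumType /=.
rewrite !big_split /=.
have -> : \sum_i \sum_j u i * (s * v j) * norm2 (y i - z j) ^+ m =
   s * dform m y u z v.
  rewrite /dform mulr_sumr; apply: eq_bigr => i _.
  by rewrite mulr_sumr; apply: eq_bigr => j _; ring.
have -> : \sum_i \sum_j s * v i * u j * norm2 (z i - y j) ^+ m =
   s * dform m y u z v.
  rewrite exchange_big /dform mulr_sumr; apply: eq_bigr => i _.
  rewrite mulr_sumr; apply: eq_bigr => j _.
  by rewrite -norm2N opprB; ring.
have -> : \sum_i \sum_j s * v i * (s * v j) * norm2 (z i - z j) ^+ m =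
   s ^+ 2 * dform m z v z v.
  rewrite /dform mulr_sumr; apply: eq_bigr => i _.
  by rewrite mulr_sumr; apply: eq_bigr => j _; ring.
rewrite /dform; ring.
Qed.

Lemma mon_line (a : mindex d) (y : 'rV[R]_d) (i : 'I_d) : exists2 q : {poly R},
  (size q <= (mdeg a).+1)%N & forall t, mon a (y + t *: delta_mx ord0 i) = q.[t].
Proof.
exists ((\prod_(j | j != i) y ord0 j ^+ a j) *: ('X + (y ord0 i)%:P) ^+ a i).
  apply: leq_trans (size_scale_leq _ _) _.
  have -> : 'X + (y ord0 i)%:P = 'X - (- y ord0 i)%:P by rewrite polyCN opprK.
  by rewrite size_exp_XsubC ltnS mindex_le_mdeg.
move=> t; rewrite /mon (bigD1 i) //= !mxE !eqxx mulr1 hornerZ horner_exp.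
rewrite hornerD hornerX hornerC mulrC [t + _]addrC; congr (_ * _).
by apply: eq_bigr => j ji; rewrite !mxE (negPf ji) mulr0 addr0.
Qed.

Variables (kappa : 'rV[R]_d -> 'rV[R]_d -> R) (f : R -> R) (fc : nat -> R) (r : nat).
Hypothesis d_gt0 : (0 < d)%N.
Hypothesis kappa_pd : posdef_kernel kappa.
Hypothesis kappa_stat : stationary kappa f.
Hypothesis f_analytic : analytic_at0 f fc.
Hypothesis f_order : smoothness_order fc r.

(** If the form vanishes at u, its positivity on u + s v for all s makes u
    orthogonal to every v that annihilates the degrees below r.  Take for v the
    extrapolation weights, on points at distance of order e from y t0 along a
    coordinate axis.  Seen from the other points y t the norm is smooth, and v
    integrates it to O(e^(2r)); seen from y t0 it contributes 2 (u t0) e^(2r-1).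
    Hence u t0 = 0. *)
Lemma distance_form_gt0 (T : finType) (y : T -> 'rV[R]_d) (u : T -> R) (t0 : T) :
  injective y -> annihilates y u r -> u t0 != 0 ->
  0 < fc r.*2.-1 * \sum_s \sum_t u s * u t * norm2 (y s - y t) ^+ r.*2.-1.
Proof.
move=> y_inj yu ut0; have r0 := smoothness_gt0 f_order.
have ge0 T' y' u' := @distance_form_ge0 _ _ _ _ _ _ kappa_pd kappa_stat f_analytic f_order T' y' u'.
rewrite lt_def ge0 // andbT; apply: contraNneq ut0 => B0.
set m := r.*2.-1 in B0 ge0.
have [v [v0 Hv]] := @extrapolation_weights R r.*2.
pose z (e : R) (o : option 'I_(r.*2)) := y t0 + (e * exnode o) *: delta_mx ord0 (Ordinal d_gt0).
have zv e : annihilates (z e) v r.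
  move=> a ar; have [q qa Hq] := mon_line a (y t0) (Ordinal d_gt0).
  under eq_bigr do rewrite Hq.
  rewrite extrapolation_poly // big1 // => i ri; exfalso.
  by have := ltn_ord i; lia.
have B_lin e : dform m y u (z e) v = 0.
  have c0 : fc m != 0 by case: f_order.
  suff : 2 * fc m * dform m y u (z e) v = 0.
    by move/eqP; rewrite !mulf_eq0 (negPf c0) pnatr_eq0 /= => /eqP.
  apply: (@quadratic_ge0_lin _ (fc m * dform m (z e) v (z e) v)) => s.
  have := ge0 _ (fun o : T + option 'I_(r.*2) => match o with inl t => y t | inr t => z e t end)
    (fun o => match o with inl t => u t | inr t => s * v t end).
  rewrite -/(dform m _ _ _ _) dform_sum => H.
  have : annihilates (fun o : T + option 'I_(r.*2) => match o with inl t => y t | inr t => z e t end)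
    (fun o => match o with inl t => u t | inr t => s * v t end) r.
    move=> a ar; rewrite big_sumType /= yu // add0r.
    by under eq_bigr do rewrite -mulrA; rewrite -mulr_sumr zv // mulr0.
  move/H; rewrite mulrDr B0 addr0 => H'.
  by apply: le_trans H' _; rewrite le_eqVlt; apply/orP; left; apply/eqP; ring.
have Hne t : t != t0 -> vanish r.*2 (fun e => \sum_o v o * norm2 (y t - z e o) ^+ m).
  move=> tt0; set w := y t - y t0; set x := delta_mx ord0 (Ordinal d_gt0) : 'rV[R]_d.
  have w0 : w != 0 by rewrite subr_eq0 (inj_eq y_inj).
  pose b : {poly R} := (nsq x / nsq w) *: 'X^2 - (2 * dot w x / nsq w) *: 'X.
  pose q := norm2 w ^+ m *: \sum_(i < r.*2) gbin (m%:R / 2) i *: b ^+ i.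
  have bE e (c : R) : relpert w (c *: x) e = b.[e * c].
    rewrite /relpert nsqZ dotZr /b !hornerE /=; ring.
  have H : vanish r.*2 (fun e => \sum_o v o * (norm2 (w - e *: (exnode o *: x)) ^+ m -
       norm2 w ^+ m * \sum_(i < r.*2) gbin (m%:R / 2) i * relpert w (exnode o *: x) e ^+ i)).
    by apply: vanish_sum => o _; apply: vanishZ; exact: norm2_pow_expand.
  apply: vanish_eq (vanishD H (vanish_extrapolation q Hv)) => e _.
  rewrite -big_split; apply: eq_bigr => o _ /=; rewrite -mulrDr; congr (_ * _).
  have -> : y t - z e o = w - e *: (exnode o *: x).
    by rewrite /z /w opprD addrA scalerA.
  rewrite /q hornerZ horner_sum.
  under [X in _ = _ - _ * X + _]eq_bigr do rewrite bE.
  under [X in _ = _ - _  + _ * X]eq_bigr do rewrite hornerZ horner_exp.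
  by rewrite subrK.
have Heq e : 0 < e -> \sum_o v o * norm2 (y t0 - z e o) ^+ m = 2 * e ^+ m.
  move=> e0; have om : odd m by rewrite /m; lia.
  have mr : (m < r.*2)%N by rewrite /m; lia.
  have := extrapolation_abs om mr Hv; rewrite v0 mulr1 => <-.
  rewrite mulr_suml; apply: eq_bigr => o _; rewrite /z opprD addrA subrr add0r.
  rewrite norm2N norm2Z normrM (gtr0_norm e0).
  have -> : norm2 (delta_mx ord0 (Ordinal d_gt0) : 'rV[R]_d) = 1.
    rewrite /norm2 (bigD1 (Ordinal d_gt0)) //= big1 => [|j jd].
      by rewrite mxE !eqxx expr1n addr0 sqrtr1.
    by rewrite mxE (negPf jd) andbF expr0n.
  by rewrite mulr1 exprMn; ring.
apply/eqP; apply: vanish1_cst; apply: (@vanish_divX _ 1 m).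
have -> : (1 + m = r.*2)%N by rewrite /m; lia.
have H : vanish r.*2 (fun e => \sum_(t | t != t0) u t * \sum_o v o * norm2 (y t - z e o) ^+ m).
  by apply: vanish_sum => t tt0; apply: vanishZ; exact: Hne.
apply: vanish_eq (vanishZ (- 2^-1) H) => e e0.
have := B_lin e; rewrite /dform (bigD1 t0) //=.
under eq_bigr do rewrite -mulrA.
rewrite -mulr_sumr Heq //.
under eq_bigr do (under eq_bigr do rewrite -mulrA; rewrite -mulr_sumr).
move/eqP; rewrite addr_eq0 => /eqP; set S := \sum_(i | _) _ => E.
have -> : S = - (u t0 * (2 * e ^+ m)) by rewrite E opprK.
by field.
Qed.

End Strictness.

(** * Strict positivity of the form of the even Taylor terms *)

Lemma vanish_sqr (R : realType) N (g : R -> R) :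
  vanish (N + N) (fun e => g e ^+ 2) -> vanish N g.
Proof.
move=> [C [d [C0 d0 H]]]; exists (Num.sqrt C), d; split; rewrite ?sqrtr_ge0 // => e e0 ed.
have := H e e0 ed; rewrite normrX addnn -mul2n mulnC exprM => {}H.
rewrite -(@ler_pXn2r _ 2) ?nnegrE ?mulr_ge0 ?sqrtr_ge0 ?exprn_ge0 ?(ltW e0) //.
by rewrite exprMn sqr_sqrtr.
Qed.

Section Words.
Context {R : realType} {d : nat}.

(** The letters come in the order in which iterated partial derivatives are
    composed, so that words serve for monomials and for derivatives. *)
Definition word (b : mindex d) : seq 'I_d :=
  flatten [seq nseq (b j) j | j <- enum 'I_d].

Lemma size_word b : size (word b) = mdeg b.
Proof.
rewrite /word size_flatten /shape -map_comp sumnE big_map big_enum /=.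
by apply: eq_bigr => j _; rewrite size_nseq.
Qed.

Lemma prod_word b (x : 'rV[R]_d) : \prod_(j <- word b) x ord0 j = mon b x.
Proof.
rewrite /word big_flatten big_map big_enum /=; apply: eq_bigr => j _.
by rewrite big_nseq -Monoid.iteropE.
Qed.

Lemma mon_as_product b k : mdeg b = k ->
  exists phi : {ffun 'I_k -> 'I_d}, forall x : 'rV[R]_d,
    \prod_i x ord0 (phi i) = mon b x.
Proof.
move=> bk; have sk : size (word b) == k by rewrite size_word bk.
exists [ffun i => tnth (Tuple sk) i] => x.
rewrite -prod_word -[X in _ = \prod_(j <- X) _]/(tval (Tuple sk)) big_tuple.
by apply: eq_bigr => i _; rewrite ffunE.
Qed.

(** The powers of the inner product are positive semidefinite kernels, with
    the monomials, counted with multiplicity, as features. *)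
Lemma dot_pow_form (T : finType) (p : T -> 'rV[R]_d) (u : T -> R) (n : nat) :
  \sum_s \sum_t u s * u t * dot (p s) (p t) ^+ n =
  \sum_(phi : {ffun 'I_n -> 'I_d}) (\sum_t u t * \prod_i p t ord0 (phi i)) ^+ 2.
Proof.
have E x y : dot x y ^+ n =
    \sum_(phi : {ffun 'I_n -> 'I_d}) (\prod_i x ord0 (phi i)) * \prod_i (y : 'rV[R]_d) ord0 (phi i).
  rewrite -[n in LHS]card_ord -prodr_const /dot.
  rewrite (bigA_distr_bigA (fun (i : 'I_n) j => x ord0 j * y ord0 j)).
  by apply: eq_bigr => phi _; rewrite big_split.
under eq_bigr do under eq_bigr do rewrite E mulr_sumr.
under eq_bigr do rewrite exchange_big /=.
rewrite exchange_big /=; apply: eq_bigr => phi _.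
rewrite expr2 big_distrl /=; apply: eq_bigr => s _.
by rewrite big_distrr /=; apply: eq_bigr => t _; ring.
Qed.

End Words.

(** Let Q be the quadratic form of the coefficients bcoef S (a j) (a j') at the
    vector c, and k an upper bound for the degrees of the a j with c j <> 0.
    Dual weights discretize c into a finitely supported functional U e, on the
    points e p, whose form for the kernel is e^(2k) (Q + O(e)); hence Q >= 0.

    If Q = 0, Cauchy-Schwarz against the evaluation at e z, with the functional
    taken at the much smaller scale e^B, gives G z e = O(e^N).  Since z <> 0,
    kappa (e z) (e^B p) expands in powers of e.  The coefficient of
    e^(B k - k + 2r - 1) must vanish, for z and for - z; after symmetrization only
    the odd term f_(2r-1) paired with the part of c of degree k is left in it,
    namely top z up to a nonzero factor.  Finally, top is a
    combination with positive coefficients of positive semidefinite kernels, in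
    which a monomial of degree k is a feature: pairing it with c itself yields a
    vanishing sum of nonnegative terms, among them the squares of the c j with
    |a j| = k. *)
Section WronskianForm.
Context {R : realType} {d : nat}.
Variables (kappa : 'rV[R]_d -> 'rV[R]_d -> R) (f : R -> R) (fc : nat -> R) (r : nat).
Hypothesis kappa_pd : posdef_kernel kappa.
Hypothesis kappa_stat : stationary kappa f.
Hypothesis f_analytic : analytic_at0 f fc.
Hypothesis f_order : smoothness_order fc r.

Variable S : seq (R * (mindex d * mindex d)).
Hypothesis S_even : forall x y, even_part fc r x y = bipoly_eval S x y.

Variables (J : finType) (a : J -> mindex d) (c : J -> R) (k : nat).
Hypothesis a_deg : forall j, (mdeg (a j) < r)%N.
Hypothesis c_top : forall j, c j != 0 -> (mdeg (a j) <= k)%N.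
Hypothesis kr : (k < r)%N.

Variables (T : finType) (p : T -> 'rV[R]_d) (w : mindex d -> T -> R).
Hypothesis p_neq0 : forall t, p t != 0.
Hypothesis w_dual : forall a b, (mdeg a < r)%N -> (mdeg b < r)%N ->
  \sum_t w a t * mon b (p t) = (a == b)%:R.

(** Picks the coefficient of the monomial a j in polynomials of degree below r. *)
Let lam j (g : 'rV[R]_d -> R) : R := \sum_t w (a j) t * g (p t).

Let lam_homog j n g : homog n g -> (n < r)%N -> n != mdeg (a j) -> lam j g = 0.
Proof.
move=> [s sn gs] nr nj; rewrite /lam.
under eq_bigr do rewrite gs mulr_sumr.
rewrite exchange_big /= big_seq big1 // => t ts.
under eq_bigr do rewrite mulrCA.
rewrite -mulr_sumr w_dual ?sn //.
have /negPf -> : a j != t.2 by apply: contraNneq nj => ->; rewrite sn.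
by rewrite mulr0.
Qed.

(** The functional c discretized on the points e p, and multiplied by e^k to
    avoid negative powers of e. *)
Let U (e : R) t : R := \sum_j c j * e ^+ (k - mdeg (a j)) * w (a j) t.

Let vanish_U t : vanish 0 (fun e => U e t).
Proof.
apply: vanish_sum => j _.
apply: vanish_eq (vanishZ (c j * w (a j) t) (vanishW (leq0n _) (vanishX (k - mdeg (a j))))).
by move=> e _; rewrite mulrAC.
Qed.

Let C b : R := \sum_j c j * (a j == b)%:R.

Let sumU (e : R) g : \sum_t U e t * g (p t) = \sum_j c j * e ^+ (k - mdeg (a j)) * lam j g.
Proof.
under eq_bigr do rewrite /U mulr_suml.
rewrite exchange_big; apply: eq_bigr => j _ /=.
by rewrite /lam mulr_sumr; apply: eq_bigr => t _; rewrite mulrA.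
Qed.

Let U_mon b : vanish k.+1 (fun e => \sum_t U e t * mon b (e *: p t) - e ^+ k * C b).
Proof.
have E e : \sum_t U e t * mon b (e *: p t) =
    \sum_j c j * e ^+ (k - mdeg (a j) + mdeg b) * lam j (mon b).
  under eq_bigr do rewrite monZ mulrCA.
  rewrite -mulr_sumr sumU mulr_sumr; apply: eq_bigr => j _.
  by rewrite exprD; ring.
have [br|rb] := ltnP (mdeg b) r.
  apply: vanish_eq (vanish0 _) => e _; rewrite E /C mulr_sumr -sumrB big1 // => j _.
  rewrite /lam w_dual //; have [<-|_] := eqVneq (a j) b; last by rewrite !mulr0 subrr.
  have [->|/c_top jk] := eqVneq (c j) 0; first by rewrite !mul0r !mulr0 subrr.
  by rewrite subnK // mulrCA mulrA subrr.
have -> : C b = 0.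
  apply: big1 => j _; case: eqP => [ab|_]; last by rewrite mulr0.
  by have := a_deg j; rewrite ab ltnNge rb.
apply: (@vanish_eq _ _ _ (fun e => \sum_j c j * e ^+ (k - mdeg (a j) + mdeg b) * lam j (mon b))).
  by move=> e _; rewrite E mulr0 subr0.
apply: vanish_sum => j _.
have H : vanish k.+1 (fun e : R => e ^+ (k - mdeg (a j) + mdeg b)).
  by apply: vanishW (vanishX _); lia.
by apply: vanish_eq (vanishZ (c j * lam j (mon b)) H) => e _; ring.
Qed.

Let Q := \sum_j \sum_j' c j * c j' * bcoef S (a j) (a j').

Let QE : Q = \sum_(t <- S) t.1 * (C t.2.1 * C t.2.2).
Proof.
rewrite /Q; under eq_bigr do under eq_bigr do rewrite bcoefE mulr_sumr.
under eq_bigr do rewrite exchange_big.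
rewrite exchange_big; apply: eq_bigr => t _ /=.
rewrite /C big_distrl mulr_sumr; apply: eq_bigr => j _ /=.
rewrite !big_distrr; apply: eq_bigr => j' _ /=.
by rewrite [t.2.1 == _]eq_sym [t.2.2 == _]eq_sym; ring.
Qed.

Let form e := \sum_s \sum_t U e s * U e t * kappa (e *: p s) (e *: p t).

Let form_expand : vanish k.*2.+1 (fun e => form e - Q * e ^+ k.*2).
Proof.
have H1 : vanish k.*2.+1 (fun e => \sum_s \sum_t (U e s * U e t) *
   (kappa (e *: p s) (e *: p t) - (even_part fc r (e *: p s) (e *: p t) +
     fc r.*2.-1 * norm2 (p s - p t) ^+ r.*2.-1 * e ^+ r.*2.-1))).
  apply: vanish_sum => s _; apply: vanish_sum => t _.
  apply: (@vanishW _ (0 + 0 + r.*2)); first by lia.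
  apply: vanishM; first exact: vanishM.
  exact: kernel_expand_pair kappa_stat f_analytic f_order _ _.
have H2 : vanish k.*2.+1 (fun e => \sum_s \sum_t (U e s * U e t) *
     (fc r.*2.-1 * norm2 (p s - p t) ^+ r.*2.-1 * e ^+ r.*2.-1)).
  apply: vanish_sum => s _; apply: vanish_sum => t _.
  apply: (@vanishW _ (0 + 0 + r.*2.-1)); first by lia.
  apply: vanishM; first exact: vanishM.
  by apply: vanishZ; exact: vanishX.
have H3 : vanish k.*2.+1 (fun e => \sum_(t <- S) t.1 *
    ((\sum_s U e s * mon t.2.1 (e *: p s)) * (\sum_s U e s * mon t.2.2 (e *: p s)) -
     (e ^+ k * C t.2.1) * (e ^+ k * C t.2.2))).
  apply: vanish_sum => t _; apply: vanishZ.
  have Hm b : vanish k (fun e => \sum_s U e s * mon b (e *: p s)).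
    have := vanishD (vanishW (leqnSn k) (U_mon b)) (vanishZ (C b) (vanishX k)).
    by apply: vanish_eq => e _; ring.
  have Hc b : vanish k (fun e => e ^+ k * C b).
    by apply: vanish_eq (vanishZ (C b) (vanishX k)) => e _; rewrite mulrC.
  have -> : (k.*2.+1 = k + k.+1)%N by lia.
  have A1 := vanishM (Hm t.2.1) (U_mon t.2.2).
  have A2 := vanishM (Hc t.2.2) (U_mon t.2.1).
  by apply: vanish_eq (vanishD A1 A2) => e _; ring.
apply: vanish_eq (vanishD (vanishD H1 H2) H3) => e _.
have -> : form e = \sum_s \sum_t U e s * U e t * (kappa (e *: p s) (e *: p t) -
     (even_part fc r (e *: p s) (e *: p t) +
     fc r.*2.-1 * norm2 (p s - p t) ^+ r.*2.-1 * e ^+ r.*2.-1)) +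
   \sum_s \sum_t (U e s * U e t) *
     (fc r.*2.-1 * norm2 (p s - p t) ^+ r.*2.-1 * e ^+ r.*2.-1) +
   \sum_s \sum_t U e s * U e t * bipoly_eval S (e *: p s) (e *: p t).
  rewrite -!big_split; apply: eq_bigr => s _ /=; rewrite -!big_split.
  by apply: eq_bigr => t _ /=; rewrite S_even; ring.
rewrite -addrA; congr (_ + _).
rewrite (quad_bipoly_eval S (U e) (U e) (fun t => e *: p t) (fun t => e *: p t)).
rewrite QE mulr_suml -sumrB; apply: eq_bigr => t _ /=.
by rewrite -addnn exprD; ring.
Qed.

Lemma wronskian_form_ge0 : 0 <= Q.
Proof.
apply: (@vanish_ge0 _ form _ k.*2); last exact: form_expand.
by move=> e _; exact: (posdef_kernel_ge0 (fun t => e *: p t) (U e) kappa_pd).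
Qed.

Let g (z : 'rV[R]_d) i h x : R := (- 2 * dot z x) ^+ (i - h) * nsq x ^+ h.

Let g_homog z i h : (h <= i)%N -> homog (i + h) (g z i h).
Proof.
move=> hi; have -> : (i + h = (i - h) * 1 + h * 2)%N by lia.
apply: homogM; apply: homogX; last exact: homog_nsq.
by apply: homogZ; exact: homog_dot.
Qed.

Let gN z i h x : g (- z) i h x = (- 1) ^+ (i - h) * g z i h x.
Proof. by rewrite /g dotNl mulrN -mulN1r exprMn mulrA. Qed.

Let relpert_pow z x (t : R) i : relpert z x t ^+ i =
  \sum_(h < i.+1) 'C(i, h)%:R / nsq z ^+ i * t ^+ (i + h) * g z i h x.
Proof.
rewrite /relpert !exprMn exprVn addrC -mulNr exprDn mulr_sumr mulr_suml.
apply: eq_bigr => h _; rewrite exprD /g -mulr_natl !exprMn.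
set u := (-2) ^+ _; set v := dot z x ^+ _; set n := nsq x ^+ _.
set tt := t ^+ i; set th := t ^+ h; set nz := _^-1.
ring.
Qed.

(* The form at scale e^B is O(e^(B (2k + 1))); its square root gains B / 2 = 2r
   powers of e over e^(B k), which reaches beyond the odd term. *)
Let B := (r * 4)%N.
Let N := (B * k + r.*2)%N.

Let G (z : 'rV[R]_d) (e : R) := \sum_t U (e ^+ B) t * kappa (e *: z) (e ^+ B *: p t).

Let G_vanish z : Q = 0 -> vanish N (G z).
Proof.
move=> Q0; apply: vanish_sqr.
have B0 : (0 < B)%N by rewrite /B; lia.
have H : vanish (B * k.*2.+1) (fun e => form (e ^+ B)).
  apply: (@vanish_comp _ _ _ form B0).
  by apply: vanish_eq form_expand => e _; rewrite Q0 mul0r subr0.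
have ksym x y : kappa x y = kappa y x.
  by rewrite !kappa_stat -norm2N opprB.
apply: (@vanish_le _ _ _ (fun e => (`|f 0| + 1) * form (e ^+ B))); last first.
  apply: vanishZ; apply: vanishW H; rewrite /N /B; lia.
exists 1 => // e e0 _; rewrite ger0_norm ?sqr_ge0 //.
apply: le_trans (ler_norm _).
have := kernel_cauchy_schwarz (fun t => e ^+ B *: p t) (U (e ^+ B)) (e *: z) kappa_pd ksym.
by rewrite [kappa (e *: z) (e *: z)]kappa_stat subrr norm2_0.
Qed.

Let K (z : 'rV[R]_d) m i h : R := fc m * norm2 z ^+ m * gbin (m%:R / 2) i * 'C(i, h)%:R / nsq z ^+ i.

Let kappa_expand z t : z != 0 ->
  vanish N (fun e => kappa (e *: z) (e ^+ B *: p t) -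
    \sum_(m < N) \sum_(i < N) \sum_(h < i.+1)
      K z m i h * e ^+ (m + B.-1 * (i + h)) * g z i h (p t)).
Proof.
move=> z0; have B1 : (0 < B.-1)%N by rewrite /B; lia.
pose n (e : R) := norm2 (z - e ^+ B.-1 *: p t).
have n0 : vanish 0 n.
  have := vanish_comp B1 (norm2_pow_expand (p t) 1 0 z0).
  rewrite muln0; apply: vanish_eq => e _.
  by rewrite big_ord0 mulr0 subr0 expr1.
have H1 := profile_expand f_analytic N n0.
have H2 : vanish N (fun e => \sum_(m < N) fc m * (e ^+ m * (n e ^+ m -
    norm2 z ^+ m * \sum_(i < N) gbin (m%:R / 2) i * relpert z (p t) (e ^+ B.-1) ^+ i))).
  apply: vanish_sum => m _; apply: vanishZ.
  apply: (@vanishW _ (m + B.-1 * N)); first by rewrite /N; nia.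
  apply: vanishM; first exact: vanishX.
  exact: vanish_comp B1 (norm2_pow_expand (p t) m N z0).
apply: vanish_eq (vanishD H1 H2) => e e0.
have -> : kappa (e *: z) (e ^+ B *: p t) = f (e * n e).
  rewrite kappa_stat /n; congr f.
  have -> : e *: z - e ^+ B *: p t = e *: (z - e ^+ B.-1 *: p t).
    by rewrite scalerBr scalerA -exprS prednK // /B; lia.
  by rewrite norm2Z (gtr0_norm e0).
rewrite -addrA; congr (_ + _); rewrite -sumrN -[X in _ = X + _]sumrN -big_split.
apply: eq_bigr => m _ /=; rewrite exprMn.
have -> : \sum_(i < N) \sum_(h < i.+1) K z m i h * e ^+ (m + B.-1 * (i + h)) * g z i h (p t) =
  fc m * e ^+ m * (norm2 z ^+ m * \sum_(i < N) gbin (m%:R / 2) i * relpert z (p t) (e ^+ B.-1) ^+ i).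
  rewrite !mulr_sumr; apply: eq_bigr => i _; rewrite relpert_pow !mulr_sumr.
  by apply: eq_bigr => h _; rewrite -exprM exprD /K; ring.
by ring.
Qed.

(** The coefficient of e^(B k - k + n) in the expansion of G z e. *)
Let A (z : 'rV[R]_d) n : R := \sum_j \sum_(m < N) \sum_(i < N) \sum_(h < i.+1)
  ((i + h == mdeg (a j)) && (m + (k - mdeg (a j)) == n))%N%:R *
    (c j * K z m i h * lam j (g z i h)).

(** In the expansion, the index pairs (i, h) with i + h < r contribute only if
    i + h = |a j|, since lam j annihilates the other degrees; those with
    i + h >= r appear at orders beyond the relevant one, B being large. *)
Let A_eq0 z : Q = 0 -> z != 0 -> A z r.*2.-1 = 0.
Proof.
move=> Q0 z0.
apply: (@vanish_coef _ r.*2 (N + k.+1) (A z)); [|lia|rewrite /N; lia].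
apply: (@vanish_divX _ _ (B * k - k)).
pose F e t := \sum_(m < N) \sum_(i < N) \sum_(h < i.+1)
      K z m i h * e ^+ (m + B.-1 * (i + h)) * g z i h (p t).
have H1 : vanish N (fun e => \sum_t U (e ^+ B) t * F e t).
  have H : vanish N (fun e => \sum_t U (e ^+ B) t * (kappa (e *: z) (e ^+ B *: p t) - F e t)).
    apply: vanish_sum => t _; rewrite -[N]add0n; apply: vanishM; last exact: kappa_expand.
    have B0 : (0 < B)%N by rewrite /B; lia.
    by have := vanish_comp B0 (vanish_U t); rewrite muln0.
  apply: vanish_eq (vanishB (G_vanish z Q0) H) => e _.
  by rewrite /G -sumrB; apply: eq_bigr => t _; ring.
have E1 e : \sum_t U (e ^+ B) t * F e t =
   \sum_j \sum_(m < N) \sum_(i < N) \sum_(h < i.+1)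
     c j * K z m i h * lam j (g z i h) * e ^+ (B * (k - mdeg (a j)) + (m + B.-1 * (i + h))).
  rewrite /F; under eq_bigr do rewrite mulr_sumr.
  rewrite exchange_big [RHS]exchange_big; apply: eq_bigr => m _ /=.
  under eq_bigr do rewrite mulr_sumr.
  rewrite exchange_big [RHS]exchange_big; apply: eq_bigr => i _ /=.
  under eq_bigr do rewrite mulr_sumr.
  rewrite exchange_big [RHS]exchange_big; apply: eq_bigr => h _ /=.
  under eq_bigr do rewrite mulrCA.
  rewrite -mulr_sumr sumU mulr_sumr; apply: eq_bigr => j _.
  by rewrite !exprD -exprM; ring.
have E2 e : e ^+ (B * k - k) * (\sum_(n < N + k.+1) A z n * e ^+ n) =
   \sum_j \sum_(m < N) \sum_(i < N) \sum_(h < i.+1)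
     (i + h == mdeg (a j))%N%:R * (c j * K z m i h * lam j (g z i h)) *
      e ^+ (B * k - k + (m + (k - mdeg (a j)))).
  have -> : \sum_(n < N + k.+1) A z n * e ^+ n =
    \sum_j \sum_(m < N) \sum_(i < N) \sum_(h < i.+1)
     (i + h == mdeg (a j))%N%:R * (c j * K z m i h * lam j (g z i h)) *
      e ^+ (m + (k - mdeg (a j))).
    under eq_bigr do rewrite /A mulr_suml.
    rewrite exchange_big; apply: eq_bigr => j _ /=.
    under eq_bigr do rewrite mulr_suml.
    rewrite exchange_big; apply: eq_bigr => m _ /=.
    under eq_bigr do rewrite mulr_suml.
    rewrite exchange_big; apply: eq_bigr => i _ /=.
    under eq_bigr do rewrite mulr_suml.
    rewrite exchange_big; apply: eq_bigr => h _ /=.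
    have nN : (m + (k - mdeg (a j)) < N + k.+1)%N by have := ltn_ord m; lia.
    rewrite (bigD1 (Ordinal nN)) //= eqxx andbT big1 ?addr0 // => n nn.
    have -> : (m + (k - mdeg (a j)) == n)%N = false.
      by apply: contraNF nn => /eqP nn; apply/eqP/val_inj.
    by rewrite andbF !mul0r.
  rewrite mulr_sumr; apply: eq_bigr => j _; rewrite mulr_sumr; apply: eq_bigr => m _.
  rewrite mulr_sumr; apply: eq_bigr => i _; rewrite mulr_sumr; apply: eq_bigr => h _.
  by rewrite [in RHS]exprD; ring.
have H2 : vanish (r.*2 + (B * k - k)) (fun e =>
   \sum_j \sum_(m < N) \sum_(i < N) \sum_(h < i.+1)
     c j * K z m i h * lam j (g z i h) *
     ((i + h == mdeg (a j))%N%:R * e ^+ (B * k - k + (m + (k - mdeg (a j)))) -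
      e ^+ (B * (k - mdeg (a j)) + (m + B.-1 * (i + h))))).
  apply: vanish_sum => j _; apply: vanish_sum => m _; apply: vanish_sum => i _.
  apply: vanish_sum => h _.
  have [c0|/c_top jk] := eqVneq (c j) 0.
    by apply: vanish_eq (vanish0 _) => e _; rewrite c0 !mul0r.
  have kB : (k <= B * k)%N by rewrite /B; nia.
  have [ih|ih] := eqVneq (i + h)%N (mdeg (a j)).
    apply: vanish_eq (vanish0 _) => e _; rewrite mul1r ih.
    have -> : (B * (k - mdeg (a j)) + (m + B.-1 * mdeg (a j)) = B * k - k + (m + (k - mdeg (a j))))%N.
      have : (B = B.-1.+1)%N by rewrite prednK // /B; lia.
      by nia.
    by rewrite subrr mulr0.
  have [ihr|rih] := ltnP (i + h)%N r.
    apply: vanish_eq (vanish0 _) => e _; rewrite (@lam_homog j (i + h)) ?mulr0 ?mul0r //.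
    by apply: g_homog; rewrite -ltnS ltn_ord.
  apply: vanishZ; apply: (@vanish_eq _ _ _ (fun e : R => - e ^+ (B * (k - mdeg (a j)) + (m + B.-1 * (i + h))))).
    by move=> e _; rewrite mul0r add0r.
  apply: vanishN; apply: vanishW (vanishX _).
  have Bp : (B = B.-1.+1)%N by rewrite prednK // /B; lia.
  have B2 : (r.*2 <= B.-1)%N by rewrite /B; lia.
  have [dl Hd] : exists dl, (i + h = mdeg (a j) + dl.+1)%N.
    by exists (i + h - (mdeg (a j)).+1)%N; have := a_deg j; lia.
  rewrite Hd; move: B2 jk kB Bp; clear; nia.
apply: vanish_eq (vanishD (vanishW _ H1) H2) => [e _|]; last by rewrite /N /B; nia.
rewrite E1 E2 -big_split; apply: eq_bigr => j _; rewrite -big_split; apply: eq_bigr => m _.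
rewrite -big_split; apply: eq_bigr => i _; rewrite -big_split; apply: eq_bigr => h _ /=.
by ring.
Qed.

Let top z : R := \sum_(j | mdeg (a j) == k) \sum_(i < N) \sum_(h < i.+1)
  (i + h == k)%N%:R * (c j * (gbin (r.*2.-1%:R / 2) i * 'C(i, h)%:R / nsq z ^+ i) *
    lam j (g z i h)).

(** Under z -> - z the term (i, h) gets the sign (-1)^(i - h).  The terms that
    do not cancel have k - |a j| even, thus m odd with m <= 2r - 1, and f_m = 0
    unless m = 2r - 1, which forces |a j| = k. *)
Let AN z : A z r.*2.-1 + (-1) ^+ k * A (- z) r.*2.-1 =
  2 * fc r.*2.-1 * norm2 z ^+ r.*2.-1 * top z.
Proof.
have KN m i h : K (- z) m i h = K z m i h.
  by rewrite /K norm2N -!norm2_sqr norm2N.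
have lamN j i h : lam j (g (- z) i h) = (-1) ^+ (i - h) * lam j (g z i h).
  by rewrite /lam mulr_sumr; apply: eq_bigr => t _; rewrite gN mulrCA.
have mN : (r.*2.-1 < N)%N by rewrite /N; lia.
have E j : (\sum_(m < N) \sum_(i < N) \sum_(h < i.+1)
  ((i + h == mdeg (a j)) && (m + (k - mdeg (a j)) == r.*2.-1))%N%:R *
    (c j * K z m i h * lam j (g z i h))) + (-1) ^+ k *
  (\sum_(m < N) \sum_(i < N) \sum_(h < i.+1)
  ((i + h == mdeg (a j)) && (m + (k - mdeg (a j)) == r.*2.-1))%N%:R *
    (c j * K (- z) m i h * lam j (g (- z) i h))) =
  if mdeg (a j) == k then 2 * fc r.*2.-1 * norm2 z ^+ r.*2.-1 *
    \sum_(i < N) \sum_(h < i.+1)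
  (i + h == k)%N%:R * (c j * (gbin (r.*2.-1%:R / 2) i * 'C(i, h)%:R / nsq z ^+ i) *
    lam j (g z i h)) else 0.
  have [c0|/c_top jk] := eqVneq (c j) 0.
    rewrite !big1 => [|i _|m _|m _]; last 3 first.
    - by apply: big1 => h _; rewrite c0 !mul0r mulr0.
    - by apply: big1 => i _; apply: big1 => h _; rewrite c0 !mul0r mulr0.
    - by apply: big1 => i _; apply: big1 => h _; rewrite c0 !mul0r mulr0.
    by rewrite !mulr0 addr0; case: ifP.
  have sgn i h : (h <= i)%N -> (-1) ^+ k * (-1) ^+ (i - h) = (-1) ^+ (k + (i + h)) :> R.
    move=> hi; rewrite -exprD -signr_odd -[RHS]signr_odd; congr (_ ^+ _).
    by rewrite !oddD oddB // addbA.
  have fac (s s' x y : R) : x * y + s * (x * (s' * y)) = (1 + s * s') * (x * y).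
    by ring.
  have pick (F : 'I_N -> R) : (forall m, m != Ordinal mN -> F m = 0) ->
      \sum_m F m = F (Ordinal mN).
    by move=> F0; rewrite (bigD1 (Ordinal mN)) //= big1 ?addr0.
  case: eqP => [jk'|/eqP jk'].
    rewrite pick => [|m mm]; last first.
      apply: big1 => i _; apply: big1 => h _; rewrite jk' subnn addn0.
      by rewrite -[(m == _ :> nat)]/(m == Ordinal mN) (negPf mm) andbF mul0r.
    rewrite [X in _ + _ * X]pick => [|m mm]; last first.
      apply: big1 => i _; apply: big1 => h _; rewrite jk' subnn addn0.
      by rewrite -[(m == _ :> nat)]/(m == Ordinal mN) (negPf mm) andbF mul0r.
    rewrite !mulr_sumr -big_split; apply: eq_bigr => i _ /=.
    rewrite !mulr_sumr -big_split; apply: eq_bigr => h _ /=.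
    rewrite jk' subnn addn0 eqxx andbT KN lamN.
    have [ih|_] := eqVneq (i + h)%N k; last by rewrite !(mul0r, mulr0) addr0.
    have hi : (h <= i)%N by rewrite -ltnS ltn_ord.
    have := sgn i h hi; rewrite ih addnn -mul2n exprM sqrrN !expr1n => {}sgn.
    by rewrite !mul1r fac sgn /K; ring.
  rewrite mulr_sumr -big_split big1 // => m _ /=.
  rewrite mulr_sumr -big_split big1 // => i _ /=.
  rewrite mulr_sumr -big_split big1 // => h _ /=.
  rewrite KN lamN; case: andP => [[/eqP ih /eqP mk]|_]; last by rewrite !(mul0r, mulr0) addr0.
  have hi : (h <= i)%N by rewrite -ltnS ltn_ord.
  have [kj|kj] := boolP (odd (k - mdeg (a j))); last first.
    suff -> : K z m i h = 0 by rewrite !(mul0r, mulr0) addr0.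
    by rewrite /K (odd_coef0 f_order) ?mul0r //; lia.
  rewrite !mul1r fac sgn // ih -signr_odd.
  have -> : odd (k + mdeg (a j)) by lia.
  by rewrite expr1 subrr mul0r.
rewrite /A mulr_sumr -big_split /top mulr_sumr [RHS]big_mkcond.
by apply: eq_bigr => j _; exact: E.
Qed.

Let top_eq0 z : Q = 0 -> z != 0 -> top z = 0.
Proof.
move=> Q0 z0; have := AN z; rewrite !A_eq0 ?oppr_eq0 // mulr0 addr0 => /esym/eqP.
have c0 : fc r.*2.-1 != 0 by case: f_order.
have n0 : norm2 z ^+ r.*2.-1 != 0 by rewrite expf_neq0 // gt_eqF // norm2_gt0.
by rewrite !mulf_eq0 pnatr_eq0 (negPf c0) (negPf n0) => /eqP.
Qed.

Let om t : R := \sum_(j | mdeg (a j) == k) c j * w (a j) t.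

Let om_lam z i h : \sum_(j | mdeg (a j) == k) c j * lam j (g z i h) =
  \sum_t om t * g z i h (p t).
Proof.
rewrite /om; under [RHS]eq_bigr do rewrite mulr_suml.
rewrite exchange_big; apply: eq_bigr => j _ /=.
by rewrite /lam mulr_sumr; apply: eq_bigr => t _; rewrite mulrA.
Qed.

Let P i h := \sum_s \sum_t (om s * nsq (p s) ^+ h) * (om t * nsq (p t) ^+ h) *
  dot (p s) (p t) ^+ (i - h).

Let P_ge0 i h : 0 <= P i h.
Proof.
rewrite /P (dot_pow_form p (fun t => om t * nsq (p t) ^+ h)).
by apply: sumr_ge0 => phi _; exact: sqr_ge0.
Qed.

(** Multiplication by (-1)^k |z|^(2k) removes signs and denominators. *)
Let top_om z : z != 0 -> (-1) ^+ k * nsq z ^+ k * top z =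
  \sum_(i < N) \sum_(h < i.+1) (i + h == k)%N%:R *
   (gbin (r.*2.-1%:R / 2) i * 'C(i, h)%:R * 2 ^+ (i - h) *
    (\sum_t nsq z ^+ h * (om t * nsq (p t) ^+ h) * dot z (p t) ^+ (i - h))).
Proof.
move=> z0; rewrite /top exchange_big mulr_sumr; apply: eq_bigr => i _ /=.
rewrite exchange_big mulr_sumr; apply: eq_bigr => h _ /=.
have [ih|_] := eqVneq (i + h)%N k; last first.
  by rewrite mul0r big1 ?mulr0 // => j _; rewrite mul0r.
have hi : (h <= i)%N by rewrite -ltnS ltn_ord.
have -> : \sum_(j | mdeg (a j) == k) 1%:R * (c j * (gbin (r.*2.-1%:R / 2) i *
    'C(i, h)%:R / nsq z ^+ i) * lam j (g z i h)) =
   (gbin (r.*2.-1%:R / 2) i * 'C(i, h)%:R / nsq z ^+ i) * \sum_t om t * g z i h (p t).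
  by rewrite -om_lam mulr_sumr; apply: eq_bigr => j _; ring.
rewrite !mulr_sumr; apply: eq_bigr => t _; rewrite mul1r /g.
have -> : (-1) ^+ k = (-1) ^+ (i - h) :> R.
  by rewrite -signr_odd -[RHS]signr_odd -ih oddD oddB.
have m2 : (- 2) ^+ (i - h) = (-1) ^+ (i - h) * 2 ^+ (i - h) :> R.
  by rewrite -exprMn mulN1r.
rewrite -ih exprD exprMn m2.
have s1 : (-1) ^+ (i - h) * (-1) ^+ (i - h) = 1 :> R.
  by rewrite -exprD addnn -mul2n exprM sqrrN !expr1n.
transitivity ((-1) ^+ (i - h) * (-1) ^+ (i - h) * (gbin (r.*2.-1%:R / 2) i * 'C(i, h)%:R *
  2 ^+ (i - h) * (nsq z ^+ h * (om t * nsq (p t) ^+ h) * dot z (p t) ^+ (i - h)))).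
  by field; rewrite expf_neq0 // gt_eqF // nsq_gt0.
by rewrite s1 mul1r.
Qed.

Hypothesis a_inj : injective a.

(** The binomial coefficients (r - 1/2 choose i) are positive for i <= k < r,
    so every term vanishes; the one with h = 0 is the sum of squares that
    contains (c j)^2. *)
Lemma wronskian_form_null j : Q = 0 -> mdeg (a j) = k -> c j = 0.
Proof.
move=> Q0 jk.
have S0 : \sum_(i < N) \sum_(h < i.+1) (i + h == k)%N%:R *
   (gbin (r.*2.-1%:R / 2) i * 'C(i, h)%:R * 2 ^+ (i - h) * P i h) = 0.
  have : \sum_s om s * ((-1) ^+ k * nsq (p s) ^+ k * top (p s)) = 0.
    by apply: big1 => s _; rewrite top_eq0 // !mulr0.
  under eq_bigr do rewrite top_om // mulr_sumr.
  rewrite exchange_big => H; rewrite -[RHS]H {H}; apply: eq_bigr => i _ /=.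
  under [RHS]eq_bigr do rewrite mulr_sumr.
  rewrite exchange_big; apply: eq_bigr => h _ /=.
  under [RHS]eq_bigr do rewrite mulrCA [om _ * _]mulrCA.
  rewrite -mulr_sumr; congr (_ * _); rewrite -mulr_sumr; congr (_ * _).
  apply: eq_bigr => s _; rewrite mulr_sumr; apply: eq_bigr => t _; ring.
have kN : (k < N)%N by rewrite /N; lia.
have gpos i : (i <= k)%N -> 0 < gbin (r.*2.-1%:R / 2 : R) i.
  move=> ik; apply: gbin_gt0.
  have : (i.*2 + 2 <= r.*2.-1 + 1)%N by lia.
  rewrite -(ler_nat R) !natrD -mul2n natrM => H.
  rewrite ltr_pdivlMr //; lra.
have ge0 i h : 0 <= (i + h == k)%N%:R *
   (gbin (r.*2.-1%:R / 2) i * 'C(i, h)%:R * 2 ^+ (i - h) * P i h).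
  have [ih|_] := eqVneq (i + h)%N k; last by rewrite mul0r.
  have ik : (i <= k)%N by rewrite -ih leq_addr.
  rewrite mul1r; apply: mulr_ge0 => //; apply: mulr_ge0; last exact: exprn_ge0.
  by apply: mulr_ge0 => //; exact: ltW (gpos i ik).
have S1 : \sum_(h < k.+1) (k + h == k)%N%:R *
   (gbin (r.*2.-1%:R / 2) k * 'C(k, h)%:R * 2 ^+ (k - h) * P k h) = 0.
  have := psumr_eq0P (fun (i : 'I_N) _ => sumr_ge0 _ (fun (h : 'I_i.+1) _ => ge0 i h)) S0.
  by move=> /(_ (Ordinal kN) isT).
have := psumr_eq0P (fun (h : 'I_k.+1) _ => ge0 k h) S1 => /(_ ord0 isT).
rewrite /= addn0 eqxx mul1r bin0 mulr1 => /eqP.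
have n0 : gbin (r.*2.-1%:R / 2 : R) k * 2 ^+ (k - 0) != 0.
  by rewrite mulf_neq0 ?expf_neq0 ?pnatr_eq0 // gt_eqF // gpos.
rewrite mulf_eq0 (negPf n0) => /eqP.
rewrite /P (dot_pow_form p (fun t => om t * nsq (p t) ^+ 0)) subn0 => P0.
have [phi Hphi] := @mon_as_product R d (a j) k jk.
have := psumr_eq0P (fun phi _ => sqr_ge0 _) P0 => /(_ phi isT)/eqP.
rewrite sqrf_eq0 => /eqP.
under eq_bigr do rewrite expr0 mulr1 Hphi /om mulr_suml.
rewrite exchange_big /= (bigD1 j) ?jk //= [X in _ + X]big1 ?addr0 => [|i /andP[_ ij]].
  under eq_bigr do rewrite -mulrA.
  by rewrite -mulr_sumr w_dual // eqxx mulr1.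
under eq_bigr do rewrite -mulrA.
by rewrite -mulr_sumr w_dual // (inj_eq a_inj) (negPf ij) mulr0.
Qed.

End WronskianForm.

Section WronskianPositive.
Context {R : realType} {d : nat}.
Variables (kappa : 'rV[R]_d -> 'rV[R]_d -> R) (f : R -> R) (fc : nat -> R) (r : nat).
Hypothesis d_gt0 : (0 < d)%N.
Hypothesis kappa_pd : posdef_kernel kappa.
Hypothesis kappa_stat : stationary kappa f.
Hypothesis f_analytic : analytic_at0 f fc.
Hypothesis f_order : smoothness_order fc r.

(** Apply the null case to the largest degree in the support of c. *)
Lemma wronskian_form_gt0 (S : seq (R * (mindex d * mindex d))) (J : finType)
    (a : J -> mindex d) (c : J -> R) (j0 : J) :
  (forall x y, even_part fc r x y = bipoly_eval S x y) ->
  injective a -> (forall j, (mdeg (a j) < r)%N) -> c j0 != 0 ->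
  0 < \sum_j \sum_j' c j * c j' * bcoef S (a j) (a j').
Proof.
move=> S_even a_inj a_deg cj0.
have [T [p [w [p0 wd]]]] := @dual_weights R d r d_gt0.
pose A := [pred j | c j != 0].
have [|j1 cj1 kE] := @eq_bigmax_cond _ A (fun j => mdeg (a j)).
  by apply/card_gt0P; exists j0.
set k := \max_(j in A) mdeg (a j) in kE.
have c_top j : c j != 0 -> (mdeg (a j) <= k)%N.
  by move=> cj; apply: (@leq_bigmax_cond _ A (fun j => mdeg (a j))).
have kr : (k < r)%N by rewrite kE.
rewrite lt_def (wronskian_form_ge0 kappa_pd kappa_stat f_analytic f_order S_even a_deg c_top kr wd) andbT.
apply: contraTneq cj1 => Q0; rewrite inE negbK; apply/eqP.
exact: (wronskian_form_null kappa_pd kappa_stat f_analytic f_order S_even a_deg c_top kr p0 wd a_inj Q0 (esym kE)).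
Qed.

End WronskianPositive.

(** * Partial derivatives of functions with a radial singularity at 0 *)

Section LineDerivative.
Context {R : realType} {d : nat}.
Implicit Types (g h : 'rV[R]_d -> R) (z v : 'rV[R]_d) (D : R).

(** Directional derivatives are derivatives along a line, for which the chain
    rule of one real variable is available. *)
Lemma is_derive_line g z v D :
  is_derive (0 : R) (1 : R) (fun t : R => g (t *: v + z)) D <-> is_derive z v g D.
Proof.
have E : (fun h : R => h^-1 *: (((fun t : R => g (t *: v + z)) \o shift 0) (h *: (1 : R)) -
     g ((0 : R) *: v + z))) = (fun h : R => h^-1 *: ((g \o shift z) (h *: v) - g z)).
  apply/funext => h /=; rewrite scale0r add0r addr0.
  by rewrite -[h *: 1]/(h * 1) mulr1.
split=> -[H1 H2]; split.
- by move: H1; rewrite /derivable E.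
- by move: H2; rewrite /derive E.
- by rewrite /derivable E.
- by rewrite /derive E.
Qed.

Lemma is_derive_quotient g z v D :
  (fun t : R => t^-1 * (g (t *: v + z) - g z)) @ 0^' --> D -> is_derive z v g D.
Proof.
by move=> H; split; [apply/cvg_ex; exists D|apply: cvg_lim].
Qed.

Lemma is_derive_coord z v i : is_derive z v (fun x => x ord0 i) (v ord0 i).
Proof.
apply: is_derive_quotient; apply: (cvg_trans _ (@cvg_cst _ _ _ _ (dnbhs_filter _))).
apply: near_eq_cvg; near=> t; have t0 : t != 0 by near: t; exact: nbhs_dnbhs_neq.
by rewrite !mxE addrK mulKf.
Unshelve. all: by end_near. Qed.

Lemma is_derive_comp1 g (phi : R -> R) z v D E :
  is_derive z v g D -> is_derive (g z) (1 : R) phi E -> is_derive z v (phi \o g) (E * D).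
Proof.
move=> /is_derive_line H1 H2; apply/is_derive_line.
have := @is_derive1_comp R phi (fun t : R => g (t *: v + z)) 0 E D.
by rewrite scale0r add0r; apply.
Qed.

Lemma is_derive_nsq z v : is_derive z v (@nsq R d) (2 * dot z v).
Proof.
have E : @nsq R d = \sum_(i < d) (fun x : 'rV[R]_d => x ord0 i) ^+ 2.
  by apply/funext => x; rewrite /nsq fct_sumE.
rewrite E; have H i := is_derive_coord z v i.
apply: is_derive_eq; rewrite /dot mulr_sumr; apply: eq_bigr => i _.
by rewrite expr1 -[_ *: _]/(_ * _); ring.
Qed.

Lemma is_derive_norm2 z v : z != 0 -> is_derive z v (@norm2 R d) (dot z v / norm2 z).
Proof.
move=> z0; have := is_derive_comp1 (is_derive_nsq z v) (is_derive1_sqrt (nsq_gt0 z0)).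
move=> H; apply: (is_derive_eq H); rewrite -/(norm2 z).
by field; rewrite gt_eqF // norm2_gt0.
Qed.

Lemma norm2_continuous : continuous (@norm2 R d).
Proof.
move=> z; apply: (continuous_comp (f := @nsq R d) (g := Num.sqrt)); last exact: sqrt_continuous.
apply: (cvg_bigsum (F := nbhs z)) => i _.
apply: (continuous_comp (f := fun x : 'rV[R]_d => x ord0 i) (g := fun t : R => t ^+ 2)).
  exact: coord_continuous.
exact: exprn_continuous.
Qed.

Lemma near_norm2_lt z (rho : R) : norm2 z < rho -> \forall x \near z, norm2 x < rho.
Proof. move=> zr; exact: (cvgr_lt (norm2 z) (norm2_continuous (x:=z)) _ zr). Qed.

Lemma near_neq0 z : z != 0 -> \forall x \near z, x != 0.
Proof.
move=> z0; have : \forall x \near z, 0 < norm2 x.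
  exact: (cvgr_gt (norm2 z) (norm2_continuous (x:=z)) _ (norm2_gt0 z0)).
by apply: filterS => x; apply: contraTneq => ->; rewrite norm2_0 ltxx.
Qed.

End LineDerivative.

Section Flat.
Context {R : realType} {d : nat}.
Implicit Types (h : 'rV[R]_d -> R) (z : 'rV[R]_d).
Variables (gs : nat -> R -> R) (rho : R) (M : nat).
Hypothesis rho_gt0 : 0 < rho.
Hypothesis gs_derive : forall k t, `|t| < rho -> is_derive t (1 : R) (gs k) (gs k.+1 t).
Hypothesis gs_bound : forall k, exists2 C : R, 0 <= C &
  forall t, `|t| < rho -> `|gs k t| * `|t| ^+ k <= C * `|t| ^+ M.

(** Combinations of the terms z^b gs_k(|z|) |z|^-j, graded by n = k + j - |b|.
    The class is stable under partial derivatives, each of which raises n by one,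
    and its members are O(|z|^(M - n)) when gs_k is O(|t|^(M - k)). *)
Inductive flat : nat -> ('rV[R]_d -> R) -> Prop :=
| flat_radial k j : flat (k + j) (fun z => gs k (norm2 z) * (norm2 z)^-1 ^+ j)
| flat_coord n i h : flat n.+1 h -> flat n (fun z => z ord0 i * h z)
| flat_add n h1 h2 : flat n h1 -> flat n h2 -> flat n (fun z => h1 z + h2 z)
| flat_scale n c h : flat n h -> flat n (fun z => c * h z).

Lemma flat_derive n h : flat n h -> forall i, exists2 h', flat n.+1 h' &
  forall z, z != 0 -> norm2 z < rho -> is_derive z (delta_mx ord0 i) h (h' z).
Proof.
elim=> {n h} [k j|n i0 h Hh IH|n h1 h2 _ IH1 _ IH2|n c h _ IH] i.
- exists (fun z => z ord0 i * (gs k.+1 (norm2 z) * (norm2 z)^-1 ^+ j.+1) +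
                   z ord0 i * (- j%:R * (gs k (norm2 z) * (norm2 z)^-1 ^+ j.+2))).
    apply: flat_add; apply: flat_coord.
      have -> : ((k + j).+2 = k.+1 + j.+1)%N by lia.
      exact: flat_radial.
    apply: flat_scale.
    have -> : ((k + j).+2 = k + j.+2)%N by lia.
    exact: flat_radial.
  move=> z z0 zr; have nz := norm2_gt0 z0.
  have D1 : is_derive (norm2 z) (1 : R) (fun t : R => gs k t * t^-1 ^+ j)
     (gs k.+1 (norm2 z) * (norm2 z)^-1 ^+ j + gs k (norm2 z) * (- j%:R * (norm2 z)^-1 ^+ j.+1)).
    have Dg : is_derive (norm2 z) (1 : R) (gs k) (gs k.+1 (norm2 z)).
      by apply: gs_derive; rewrite ger0_norm // ltW.
    have Di : is_derive (norm2 z) (1 : R) (fun t : R => t^-1) (- (norm2 z) ^- 2 *: (1 : R)).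
      by apply: (@is_deriveV _ id); exact: lt0r_neq0.
    have DX := @is_deriveX _ _ (fun t : R => t^-1) j (norm2 z) 1 _ Di.
    have -> : (fun t : R => gs k t * t^-1 ^+ j) = gs k * (fun t : R => t^-1) ^+ j.
      by apply/funext => t; rewrite !fctE.
    apply: is_derive_eq (is_deriveM Dg DX) _.
    have -> : ((fun t : R => t^-1) ^+ j) (norm2 z) = (norm2 z)^-1 ^+ j by rewrite fctE.
    have sc (x y : R) : x *: y = x * y by [].
    rewrite !sc; case: j {DX} => [|j]; first by rewrite !expr0; ring.
    by rewrite /= !exprS; field; exact: lt0r_neq0.
  have := is_derive_comp1 (is_derive_norm2 (delta_mx ord0 i) z0) D1.
  move=> H; apply: (is_derive_eq H).
  have -> : dot z (delta_mx ord0 i) = z ord0 i.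
    rewrite /dot (bigD1 i) //= mxE !eqxx mulr1 big1 ?addr0 // => j' ji.
    by rewrite mxE (negPf ji) andbF mulr0.
  by rewrite !exprS; ring.
- have [h' Hh' D] := IH i.
  exists (fun z => (i0 == i)%:R * h z + z ord0 i0 * h' z).
    by apply: flat_add; [apply: flat_scale|apply: flat_coord].
  move=> z z0 zr; have := is_deriveM (is_derive_coord z (delta_mx ord0 i) i0) (D z z0 zr).
  move=> H; apply: (is_derive_eq H).
  by rewrite -!/(_ * _) mxE eqxx /= addrC mulrC.
- have [h1' Hh1 D1] := IH1 i; have [h2' Hh2 D2] := IH2 i.
  exists (fun z => h1' z + h2' z); first exact: flat_add.
  by move=> z z0 zr; exact: is_deriveD (D1 z z0 zr) (D2 z z0 zr).
- have [h' Hh' D] := IH i; exists (fun z => c * h' z); first exact: flat_scale.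
  by move=> z z0 zr; exact: is_deriveZ (D z z0 zr).
Qed.

Lemma norm_coord_le z i : `|z ord0 i| <= norm2 z.
Proof.
rewrite -(@ler_pXn2r _ 2) ?nnegrE ?norm2_ge0 // norm2_sqr real_normK ?num_real //.
by rewrite /nsq (bigD1 i) //= lerDl sumr_ge0 // => j _; exact: sqr_ge0.
Qed.

Lemma flat_bound n h : flat n h -> exists2 C : R, 0 <= C &
  forall z, z != 0 -> norm2 z < rho -> `|h z| * norm2 z ^+ n <= C * norm2 z ^+ M.
Proof.
elim=> {n h} [k j|n i h _ [C C0 H]|n h1 h2 _ [C1 C10 H1] _ [C2 C20 H2]|n c h _ [C C0 H]].
- have [C C0 H] := gs_bound k; exists C => // z z0 zr; have nz := norm2_gt0 z0.
  have := H (norm2 z); rewrite (gtr0_norm nz) => /(_ zr).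
  rewrite normrM normrX normfV (gtr0_norm nz) exprVn exprD.
  have -> : `|gs k (norm2 z)| / norm2 z ^+ j * (norm2 z ^+ k * norm2 z ^+ j) =
      `|gs k (norm2 z)| * norm2 z ^+ k.
    by field; rewrite expf_neq0 // lt0r_neq0.
  by [].
- exists C => // z z0 zr; apply: le_trans (H z z0 zr).
  rewrite normrM exprS mulrA [`|h z| * _]mulrC; apply: ler_wpM2r.
    exact: exprn_ge0 (norm2_ge0 z).
  by apply: ler_wpM2r => //; exact: norm_coord_le.
- exists (C1 + C2); first exact: addr_ge0.
  move=> z z0 zr; apply: le_trans (_ : (`|h1 z| + `|h2 z|) * norm2 z ^+ n <= _).
    by apply: ler_wpM2r; [exact: exprn_ge0 (norm2_ge0 z)|exact: ler_normD].
  by rewrite !mulrDl lerD ?H1 ?H2.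
- exists (`|c| * C); first exact: mulr_ge0.
  by move=> z z0 zr; rewrite normrM -!mulrA; apply: ler_wpM2l => //; exact: H.
Qed.

(** The formulas of flat functions make sense away from 0 only, so the value at
    0 is prescribed separately. *)
Definition remainder n h : Prop :=
  h 0 = 0 /\ exists2 h0, flat n h0 &
    forall z, z != 0 -> norm2 z < rho -> h z = h0 z.

(** At 0 the difference quotient is O(|t|^(M - n - 1)), and M - n >= 2. *)
Lemma remainder_partial n h i : (n.+1 < M)%N -> remainder n h ->
  remainder n.+1 (partial i h) /\
  forall z, norm2 z < rho -> is_derive z (delta_mx ord0 i) h (partial i h z).
Proof.
move=> nM [h00 [h0 Hh0 hE]]; have [h' Hh' D] := flat_derive Hh0 i.
have [C C0 HC] := flat_bound Hh0.
have D1 z : z != 0 -> norm2 z < rho -> is_derive z (delta_mx ord0 i) h (h' z).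
  move=> z0 zr; apply: near_eq_is_derive (D z z0 zr).
  near=> x; rewrite hE //; near: x; [exact: near_neq0|exact: near_norm2_lt].
have D0 : is_derive (0 : 'rV[R]_d) (delta_mx ord0 i) h 0.
  apply: is_derive_quotient; apply/cvgr0Pnorm_lt => eps eps0.
  near=> t.
  have t0 : t != 0 by near: t; exact: nbhs_dnbhs_neq.
  have tr : `|t| < rho by near: t; exact: dnbhs0_lt.
  have t1 : `|t| < 1 by near: t; exact: dnbhs0_lt.
  have te : `|t| < eps / (C + 1) by near: t; apply: dnbhs0_lt; rewrite divr_gt0 // ltr_wpDl.
  have tp : 0 < `|t| by rewrite normr_gt0.
  rewrite h00 subr0 addr0; set e := t *: _.
  have ne : norm2 e = `|t|.
    rewrite /e norm2Z; suff -> : norm2 (delta_mx ord0 i : 'rV[R]_d) = 1 by rewrite mulr1.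
    rewrite /norm2 (bigD1 i) //= big1 => [|j ji].
      by rewrite mxE !eqxx expr1n addr0 sqrtr1.
    by rewrite mxE (negPf ji) andbF expr0n.
  have e0 : e != 0 by apply: contraTneq tp => e0; rewrite -ne e0 norm2_0 ltxx.
  have := HC e e0; rewrite ne => /(_ tr); rewrite -hE ?ne // => H.
  rewrite normrM normfV mulrC ltr_pdivrMr //.
  have H2 : `|h e| <= C * `|t| ^+ 2.
    rewrite -(@ler_pM2r _ (`|t| ^+ n)) ?exprn_gt0 //; apply: le_trans H _.
    rewrite -mulrA -exprD; apply: ler_wpM2l => //.
    by apply: ler_wiXn2l; [exact: ltW|exact: ltW|lia].
  apply: le_lt_trans H2 _; rewrite expr2 mulrA ltr_pM2r //.
  move: te; rewrite ltr_pdivlMr ?ltr_wpDl // => te.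
  by apply: le_lt_trans te; rewrite mulrC ler_wpM2l // lerDl.
have DE z : norm2 z < rho -> is_derive z (delta_mx ord0 i) h (partial i h z).
  move=> zr; have [->|z0] := eqVneq z 0.
    by case: D0 => H1 H2; split.
  by case: (D1 z z0 zr) => H1 H2; split.
split=> //; split; first by case: D0 => _ <-.
by exists h' => // z z0 zr; case: (D1 z z0 zr) => _ <-.
Unshelve. all: by end_near. Qed.

End Flat.

Section PolynomialDerivatives.
Context {R : realType} {d : nat}.
Implicit Types (s : seq (R * mindex d)) (z : 'rV[R]_d).

Definition poly_eval s z : R := \sum_(t <- s) t.1 * mon t.2 z.

Definition mindex_pred (a : mindex d) (i : 'I_d) : mindex d :=
  [ffun j => (a j - (j == i))%N].

Definition poly_derive (i : 'I_d) s : seq (R * mindex d) :=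
  [seq (t.1 * (t.2 i)%:R, mindex_pred t.2 i) | t : R * mindex d <- s].

Lemma is_derive_mon a z i :
  is_derive z (delta_mx ord0 i) (@mon R d a) ((a i)%:R * mon (mindex_pred a i) z).
Proof.
pose P : R := \prod_(j | j != i) z ord0 j ^+ a j.
have E : (fun t : R => mon a (t *: delta_mx ord0 i + z)) =
    (P \*: (fun u : R => u ^+ a i)) \o (fun t : R => t + z ord0 i).
  apply/funext => t /=; rewrite /mon (bigD1 i) //= !mxE !eqxx mulr1 mulrC.
  congr (_ * _); apply: eq_bigr => j ji.
  by rewrite !mxE (negPf ji) andbF mulr0 add0r.
apply/is_derive_line; rewrite E.
have Ds : is_derive (0 : R) (1 : R) (fun t : R => t + z ord0 i) 1.
  have -> : (fun t : R => t + z ord0 i) = id + cst (z ord0 i) by apply/funext.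
  by apply: is_derive_eq; rewrite addr0.
have Dp : is_derive (0 + z ord0 i) (1 : R) (P \*: (fun u : R => u ^+ a i))
    (P * ((a i)%:R * z ord0 i ^+ (a i).-1)).
  apply: is_deriveZ; rewrite add0r.
  have := @is_deriveX _ _ (id : R -> R) (a i) (z ord0 i) 1 1 _.
  move=> /(_ (is_derive_id _ _)) H; have -> : (fun u : R => u ^+ a i) = id ^+ a i.
    by apply/funext => u; rewrite fctE.
  by apply: (is_derive_eq H); rewrite -[_ *: _]/(_ * _) mulr1.
apply: is_derive_eq (@is_derive1_comp R _ _ 0 _ _ Dp Ds) _.
rewrite mulr1 mulrCA; congr (_ * _).
rewrite /mon (bigD1 i) //= ffunE eqxx subn1 mulrC; congr (_ * _).
by apply: eq_bigr => j ji; rewrite ffunE (negPf ji) subn0.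
Qed.

Lemma is_derive_poly_eval s z i :
  is_derive z (delta_mx ord0 i) (poly_eval s) (poly_eval (poly_derive i s) z).
Proof.
elim: s => [|t s IHs].
  have -> : poly_eval [::] = cst 0 by apply/funext => x; rewrite /poly_eval big_nil.
  exact: is_derive_cst.
have -> : poly_eval (t :: s) = (t.1 \*: @mon R d t.2) + poly_eval s.
  by apply/funext => x; rewrite /poly_eval big_cons.
have := is_deriveD (is_deriveZ t.1 (is_derive_mon t.2 z i)) IHs.
move=> H; apply: (is_derive_eq H).
by rewrite /poly_eval big_cons /= -[_ *: _]/(_ * _) mulrA.
Qed.

Definition wpartial (w : seq 'I_d) (g : 'rV[R]_d -> R) := foldr partial g w.

Lemma mpartial_word (a : mindex d) g : mpartial a g = wpartial (word a) g.
Proof.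
rewrite /mpartial /wpartial /word; elim: (enum 'I_d) => //= i s ->.
by rewrite foldr_cat; elim: (a i) => //= n ->.
Qed.

Lemma count_word (a : mindex d) i : count_mem i (word a) = a i.
Proof.
rewrite /word count_flatten -map_comp sumnE big_map big_enum /=.
rewrite (bigD1 i) //= count_nseq /= eqxx mul1n big1 ?addn0 // => j ji.
by rewrite count_nseq /= (negPf ji).
Qed.

Lemma poly_derive_word w s :
  foldr poly_derive s w =
  [seq (t.1 * (\prod_i (t.2 i) ^_ (count_mem i w))%:R,
        [ffun i => (t.2 i - count_mem i w)%N] : mindex d) | t : R * mindex d <- s].
Proof.
elim: w => [|i w IHw] /=.
  rewrite -[LHS]map_id; apply: eq_map => -[c a] /=; rewrite big1 ?mulr1.
    by congr pair; apply/ffunP => i; rewrite ffunE subn0.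
  by move=> i _; rewrite ffactn0.
rewrite IHw /poly_derive -map_comp; apply: eq_map => -[c a] /=; congr pair.
  rewrite -mulrA -natrM; congr (_ * _%:R); rewrite ffunE.
  rewrite (bigD1 i) //= [in RHS](bigD1 i) //= eqxx add1n ffactnSr.
  rewrite mulnAC; congr (_ * _)%N; apply: eq_bigr => j ji.
  by rewrite eq_sym (negPf ji).
by apply/ffunP => j; rewrite !ffunE addnC subnDA [i == j]eq_sym.
Qed.

(** Differentiating b along the word of a leaves, at the origin, b = a only. *)
Lemma poly_derive_at0 (a : mindex d) s :
  poly_eval (foldr poly_derive s (word a)) 0 =
  (\sum_(t <- s | t.2 == a) t.1) * (mfact a)%:R.
Proof.
rewrite poly_derive_word /poly_eval big_map mulr_suml [RHS]big_mkcond /=.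
apply: eq_bigr => -[c b] _ /=.
have [->|ba] := eqVneq b a.
  have -> : mon [ffun i => (a i - count_mem i (word a))%N] (0 : 'rV[R]_d) = 1.
    by rewrite /mon big1 // => i _; rewrite ffunE count_word subnn expr0.
  rewrite mulr1; congr (_ * _%:R); apply: eq_bigr => i _.
  by rewrite count_word ffactnn.
have [i bai] : exists i, b i != a i.
  apply/existsP; apply: contraNT ba; rewrite negb_exists => /forallP H.
  by apply/eqP/ffunP => i; apply/eqP; have := H i; rewrite negbK.
have [lt|gt|] := ltngtP (b i) (a i); last by move/eqP; rewrite (negPf bai).
  by rewrite (bigD1 i) //= count_word ffact_small // mul0n mulr0 mul0r.
rewrite /mon [X in _ * X](bigD1 i) //= ffunE count_word mxE expr0n.
by rewrite subn_eq0 leqNgt gt /= mul0r mulr0.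
Qed.

End PolynomialDerivatives.

(** * The Wronskian matrix *)

Section WordDerivatives.
Context {R : realType} {d : nat}.
Implicit Types (h : 'rV[R]_d -> R) (z : 'rV[R]_d).
Variables (gs : nat -> R -> R) (rho : R) (M : nat).
Hypothesis rho_gt0 : 0 < rho.
Hypothesis gs_derive : forall k t, `|t| < rho -> is_derive t (1 : R) (gs k) (gs k.+1 t).
Hypothesis gs_bound : forall k, exists2 C : R, 0 <= C &
  forall t, `|t| < rho -> `|gs k t| * `|t| ^+ k <= C * `|t| ^+ M.

Lemma remainder_word w n h : (n + size w < M)%N -> remainder gs rho n h ->
  remainder gs rho (n + size w) (wpartial w h).
Proof.
move=> + Hh; elim: w => [|i w IHw] /= nM; first by rewrite addn0.
have nM' : (n + size w < M)%N by lia.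
rewrite addnS; apply: (remainder_partial rho_gt0 gs_derive gs_bound i _ (IHw nM')).1.
by rewrite -addnS.
Qed.

Lemma norm2_affine_lt c z (theta : R) : `|theta| = 1 ->
  norm2 c < rho / 2 -> norm2 z < rho / 2 -> norm2 (c + theta *: z) < rho.
Proof.
move=> t1 cr zr; rewrite -(@ltr_pXn2r _ 2) ?nnegrE ?norm2_ge0 ?(ltW rho_gt0) //.
rewrite norm2_sqr; set y := theta *: z.
have ny : norm2 y < rho / 2 by rewrite norm2Z t1 mul1r.
have r2 : 0 <= rho / 2 by rewrite divr_ge0 // ltW.
have sq (u : 'rV[R]_d) : norm2 u < rho / 2 -> nsq u < (rho / 2) ^+ 2.
  by move=> ur; rewrite -norm2_sqr ltr_pXn2r ?nnegrE ?norm2_ge0.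
have := sq _ cr; have := sq _ ny; have := nsq_ge0 (c - y); rewrite nsqB.
have -> : nsq (c + y) = nsq c + 2 * dot c y + nsq y.
  rewrite -[y in c + y]opprK nsqB dotC dotNl dotC -!norm2_sqr norm2N; ring.
have -> : (rho / 2) ^+ 2 = rho ^+ 2 / 4 by field.
by move=> H1 H2 H3; lra.
Qed.

Lemma is_derive_affine h c z v (theta D : R) :
  is_derive (c + theta *: z) v h D ->
  is_derive z v (fun y => h (c + theta *: y)) (theta * D).
Proof.
move=> /is_derive_line H; apply/is_derive_line.
have -> : (fun t : R => h (c + theta *: (t *: v + z))) =
    (fun u : R => h (u *: v + (c + theta *: z))) \o (fun t : R => theta * t).
  apply/funext => t /=; congr h; rewrite scalerDr scalerA addrCA.
  by [].
rewrite mulrC; apply: is_derive1_comp; first by rewrite mulr0.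
have -> : (fun t : R => theta * t) = theta \*: id by apply/funext.
by apply: is_derive_eq; rewrite -[_ *: _]/(_ * _) mulr1.
Qed.

(** The two signs of theta serve the two arguments of the kernel, through which
    h is seen as y -> h (x - y) and then as x -> h x. *)
Lemma wpartial_affine w s h n c (theta sigma : R) : `|theta| = 1 ->
  norm2 c < rho / 2 -> remainder gs rho n h -> (n + size w < M)%N ->
  forall y, norm2 y < rho / 2 ->
  wpartial w (fun y => poly_eval s y + sigma * h (c + theta *: y)) y =
  poly_eval (foldr poly_derive s w) y +
  sigma * theta ^+ size w * wpartial w h (c + theta *: y).
Proof.
move=> t1 cr Hh; elim: w => [|i w IHw] /= nM y yr; first by rewrite expr0 mulr1.
have nM' : (n + size w < M)%N by lia.
rewrite {1}/partial.
rewrite (@near_eq_derive _ _ _ _ (fun y => poly_eval (foldr poly_derive s w) y +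
  sigma * theta ^+ size w * wpartial w h (c + theta *: y))); last first.
  by near=> x; apply: IHw => //; near: x; exact: near_norm2_lt.
have nM2 : ((n + size w).+1 < M)%N by lia.
have [_ /(_ (c + theta *: y) (norm2_affine_lt t1 cr yr)) D] :=
  remainder_partial rho_gt0 gs_derive gs_bound i nM2 (remainder_word nM' Hh).
have := is_deriveD (is_derive_poly_eval (foldr poly_derive s w) y i)
  (is_deriveZ (sigma * theta ^+ size w) (is_derive_affine D)).
case=> _ E; transitivity (poly_eval (poly_derive i (foldr poly_derive s w)) y +
   (sigma * theta ^+ size w) *: (theta * partial i (wpartial w h) (c + theta *: y))).
  exact: E.
by rewrite -[_ *: _]/(_ * _) exprS; congr (_ + _); ring.
Unshelve. all: by end_near. Qed.

Lemma wpartial_local w (G G' : 'rV[R]_d -> R) (delta : R) :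
  (forall y, norm2 y < delta -> G y = G' y) ->
  forall y, norm2 y < delta -> wpartial w G y = wpartial w G' y.
Proof.
move=> GG'; elim: w => [|i w IHw] y yd; first exact: GG'.
rewrite /= /partial.
apply: near_eq_derive; near=> x; apply: IHw; near: x; exact: near_norm2_lt.
Unshelve. all: by end_near. Qed.

End WordDerivatives.

Section KernelDerivatives.
Context {R : realType} {d : nat}.
Variables (kappa : 'rV[R]_d -> 'rV[R]_d -> R) (f : R -> R) (fc : nat -> R) (r : nat).
Hypothesis kappa_stat : stationary kappa f.
Hypothesis f_analytic : analytic_at0 f fc.
Hypothesis f_order : smoothness_order fc r.

(** The kernel is the even part plus h (x - y), where h (z) is a power series in
    |z| starting at order 2r - 1.  The derivatives of h of order at most 2r - 2
    vanish at 0, and those of the even part are its coefficients. *)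
Lemma kernel_deriv_coef (S : seq (R * (mindex d * mindex d))) (a b : mindex d) :
  (forall x y, even_part fc r x y = bipoly_eval S x y) ->
  (mdeg a + mdeg b < r.*2.-1)%N ->
  kernel_deriv kappa a b 0 0 = (mfact a)%:R * (mfact b)%:R * bcoef S a b.
Proof.
move=> S_even abr; have r0 := smoothness_gt0 f_order.
set M := r.*2.-1 in abr *.
have [rho0 rho00 Hrho] := analytic_remainder M f_analytic.
set c := fun i : nat => if (i < M)%N then 0 else fc i in Hrho.
pose gs k t := limn (pseries (iter k (@pseries_diffs R) c) t).
have cvc t : `|t| < rho0 -> cvgn (pseries c t) by move=> /Hrho[].
pose rho := rho0 / 4.
have rho_gt0 : 0 < rho by rewrite divr_gt0.
have rho_lt t : `|t| < rho -> `|t| < rho0 by rewrite /rho => ?; lra.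
have gs_derive k t : `|t| < rho -> is_derive t (1 : R) (gs k) (gs k.+1 t).
  move=> tr; apply: (@is_derive_pseries _ _ rho0); last exact: rho_lt.
  by move=> u ur; exact: is_cvg_pseries_iter_diffs cvc ur.
have gs_bound k : exists2 C : R, 0 <= C &
    forall t, `|t| < rho -> `|gs k t| * `|t| ^+ k <= C * `|t| ^+ M.
  by apply: pseries_deriv_order => // i; rewrite /c => ->.
pose h (z : 'rV[R]_d) := f (norm2 z) - \sum_(i < r) fc i.*2 * nsq z ^+ i.
have hE z : norm2 z < rho -> h z = gs 0 (norm2 z).
  move=> zr; have [|_ E] := Hrho (norm2 z).
    by apply: rho_lt; rewrite ger0_norm // norm2_ge0.
  rewrite /h E /gs /=; apply/eqP; rewrite subr_eq addrC; apply/eqP; congr (_ + _).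
  have -> : M = (r.-1.*2).+1 by rewrite /M; lia.
  rewrite big_ord_recr /= (sum_parity (fun i => fc i * norm2 z ^+ i)).
  rewrite [X in _ + X + _]big1 ?addr0 => [|i _]; last first.
    by rewrite (odd_coef0 f_order) ?mul0r //= ?odd_double //; have := ltn_ord i; lia.
  case: r r0 => // r' _; rewrite [RHS]big_ord_recr /=; congr (_ + _).
    by apply: eq_bigr => i _; rewrite -norm2_sqr -exprM mul2n.
  by rewrite -norm2_sqr -exprM mul2n.
have h_rem : remainder gs rho 0 h.
  split.
    rewrite hE ?norm2_0 //; have [C C0 /(_ 0)] := gs_bound 0%N.
    rewrite normr0 rho_gt0 expr0 mulr1 expr0n.
    have -> : (M == 0)%N = false by rewrite /M; lia.
    rewrite mulr0 normr_le0 => /(_ isT) /eqP.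
    by [].
  exists (fun z => gs 0 (norm2 z) * (norm2 z)^-1 ^+ 0); first exact: (flat_radial gs 0 0).
  by move=> z _ zr; rewrite hE // expr0 mulr1.
have r2 : 0 < rho / 2 by rewrite divr_gt0.
pose s1 (x : 'rV[R]_d) := [seq (t.1 * mon t.2.1 x, t.2.2) | t : R * (mindex d * mindex d) <- S].
have KE x : kappa x = fun y => poly_eval (s1 x) y + 1 * h (x + (-1) *: y).
  apply/funext => y; rewrite kappa_stat mul1r scaleN1r.
  have -> : poly_eval (s1 x) y = even_part fc r x y.
    rewrite S_even /poly_eval /s1 big_map; apply: eq_bigr => t _ /=.
    by rewrite mulrA.
  by rewrite /h /even_part [RHS]addrC subrK.
have n1 : `|-1 : R| = 1 by rewrite normrN1.
have bM : (0 + size (word b) < M)%N by rewrite size_word; lia.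
have yE x : norm2 x < rho / 2 -> mpartial b (kappa x) 0 =
   (\sum_(t <- S | t.2.2 == b) t.1 * mon t.2.1 x) * (mfact b)%:R +
   (-1) ^+ size (word b) * wpartial (word b) h x.
  move=> xr; rewrite mpartial_word KE.
  rewrite (wpartial_affine rho_gt0 gs_derive gs_bound _ _ n1 xr h_rem bM) ?norm2_0 //.
  rewrite poly_derive_at0 scaler0 addr0 mul1r; congr (_ * _ + _).
  by rewrite /s1 big_map.
pose s2 := [seq (t.1 * (mfact b)%:R, t.2.1) | t : R * (mindex d * mindex d) <- S & t.2.2 == b].
set hb := wpartial (word b) h in yE *.
rewrite /kernel_deriv mpartial_word.
have n0 : norm2 (0 : 'rV[R]_d) < rho / 2 by rewrite norm2_0.
rewrite (@wpartial_local _ _ _ _ (fun x => poly_eval s2 x +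
   (-1) ^+ size (word b) * hb (0 + 1 *: x)) (rho / 2)) //; last first.
  move=> x xr; rewrite yE // add0r scale1r; congr (_ + _).
  rewrite /s2 /poly_eval big_map big_filter mulr_suml; apply: eq_bigr => t _ /=.
  by rewrite mulrAC.
have hb_rem := remainder_word rho_gt0 gs_derive gs_bound bM h_rem.
have aM : (0 + size (word b) + size (word a) < M)%N by rewrite !size_word; lia.
rewrite (wpartial_affine rho_gt0 gs_derive gs_bound _ _ (normr1 R) n0 hb_rem aM) //.
have [z0 _] := remainder_word rho_gt0 gs_derive gs_bound aM hb_rem.
rewrite scaler0 addr0 z0 mulr0 addr0 poly_derive_at0 /s2 big_map big_filter_cond /=.
rewrite -mulr_suml /bcoef -mulrA mulrC [(mfact b)%:R * _]mulrC; congr (_ * _).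
by apply: eq_bigl => -[u [a' b']] /=; rewrite xpair_eqE andbC.
Qed.
End KernelDerivatives.

(** * Bordered determinants and nested principal minors *)

Section MatrixLimits.
Context {R : realType}.
Implicit Types (m n q : nat).

Definition mx_cvg m n (A : R -> 'M[R]_(m, n)) (A0 : 'M[R]_(m, n)) : Prop :=
  forall i j, A e i j @[e --> 0^'+] --> A0 i j.

Lemma mx_cvg_cst m n (A : 'M[R]_(m, n)) : mx_cvg (fun=> A) A.
Proof. by move=> i j; exact: cvg_cst. Qed.

Lemma mx_cvgD m n A B (A0 B0 : 'M[R]_(m, n)) : mx_cvg A A0 -> mx_cvg B B0 ->
  mx_cvg (fun e => A e + B e) (A0 + B0).
Proof.
by move=> HA HB i j; rewrite mxE; under eq_fun do rewrite mxE; exact: cvgD.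
Qed.

Lemma mx_cvgN m n A (A0 : 'M[R]_(m, n)) : mx_cvg A A0 -> mx_cvg (fun e => - A e) (- A0).
Proof. by move=> HA i j; rewrite mxE; under eq_fun do rewrite mxE; exact: cvgN. Qed.

Lemma mx_cvgM m n q A B (A0 : 'M[R]_(m, n)) (B0 : 'M[R]_(n, q)) :
  mx_cvg A A0 -> mx_cvg B B0 -> mx_cvg (fun e => A e *m B e) (A0 *m B0).
Proof.
move=> HA HB i j; rewrite mxE; under eq_fun do rewrite mxE.
by apply: cvg_bigsum => k _; apply: cvgM; [exact: HA|exact: HB].
Qed.

Lemma mx_cvgT m n A (A0 : 'M[R]_(m, n)) : mx_cvg A A0 -> mx_cvg (fun e => (A e)^T) A0^T.
Proof. by move=> HA i j; rewrite mxE; under eq_fun do rewrite mxE; exact: HA. Qed.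

Lemma mx_cvgZ m n (a : R -> R) (a0 : R) A (A0 : 'M[R]_(m, n)) :
  a e @[e --> 0^'+] --> a0 -> mx_cvg A A0 ->
  mx_cvg (fun e => a e *: A e) (a0 *: A0).
Proof. by move=> Ha HA i j; rewrite mxE; under eq_fun do rewrite mxE; exact: cvgM. Qed.

Lemma mx_cvg_sub m n m' n' (f : 'I_m' -> 'I_m) (g : 'I_n' -> 'I_n) A (A0 : 'M[R]_(m, n)) :
  mx_cvg A A0 -> mx_cvg (fun e => mxsub f g (A e)) (mxsub f g A0).
Proof. by move=> HA i j; rewrite mxE; under eq_fun do rewrite mxE; exact: HA. Qed.

Lemma mx_cvg_block m1 m2 n1 n2 A B C D (A0 : 'M[R]_(m1, n1)) (B0 : 'M[R]_(m1, n2))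
    (C0 : 'M[R]_(m2, n1)) (D0 : 'M[R]_(m2, n2)) :
  mx_cvg A A0 -> mx_cvg B B0 -> mx_cvg C C0 -> mx_cvg D D0 ->
  mx_cvg (fun e => block_mx (A e) (B e) (C e) (D e)) (block_mx A0 B0 C0 D0).
Proof.
move=> HA HB HC HD i j.
case: (split_ordP i) => i' ->; case: (split_ordP j) => j' ->.
- by rewrite block_mxEul; under eq_fun do rewrite block_mxEul; exact: HA.
- by rewrite block_mxEur; under eq_fun do rewrite block_mxEur; exact: HB.
- by rewrite block_mxEdl; under eq_fun do rewrite block_mxEdl; exact: HC.
- by rewrite block_mxEdr; under eq_fun do rewrite block_mxEdr; exact: HD.
Qed.

Lemma mx_cvg_det n A (A0 : 'M[R]_n) : mx_cvg A A0 ->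
  \det (A e) @[e --> 0^'+] --> \det A0.
Proof.
move=> HA; rewrite /determinant; apply: cvg_bigsum => s _.
by apply: cvgM; [exact: cvg_cst|apply: cvg_bigprod => i _; exact: HA].
Qed.

Lemma mx_cvg_adj n A (A0 : 'M[R]_n) : mx_cvg A A0 ->
  mx_cvg (fun e => \adj (A e)) (\adj A0).
Proof.
move=> HA i j; rewrite mxE; under eq_fun do rewrite mxE.
apply: cvgM; first exact: cvg_cst.
apply: mx_cvg_det => i' j'; rewrite !mxE; under eq_fun do rewrite !mxE.
exact: HA.
Qed.

End MatrixLimits.

Section Bordered.
Context {R : realType}.

(** Bordering brings in the inverse Y of T, which stays bounded when T blows up. *)
Lemma det_bordered_schur n q (S : 'M[R]_n) (U : 'M[R]_(n, q)) (T Y : 'M[R]_q) :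
  T *m Y = 1%:M ->
  \det (U *m T *m U^T + S) = \det T * ((-1) ^+ q * \det (block_mx S U U^T (- Y))).
Proof.
move=> TY; have YT : Y *m T = 1%:M by apply: mulmx1C.
have E : block_mx S U U^T (- Y) *m block_mx 1%:M 0 (T *m U^T) 1%:M =
    block_mx (U *m T *m U^T + S) U 0 (- Y).
  rewrite mulmx_block !mulmx1 !mulmx0 !add0r mulmxA addrC.
  by rewrite mulNmx mulmxA YT mul1mx subrr.
have := congr1 determinant E.
rewrite det_mulmx det_lblock !det1 !mulr1 det_ublock => ->.
rewrite -[- Y]scaleN1r detZ.
have dTY : \det T * \det Y = 1 by rewrite -det_mulmx TY det1.
have s1 : (-1) ^+ q * (-1) ^+ q = 1 :> R.
  by rewrite -exprD addnn -mul2n exprM sqrrN !expr1n.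
transitivity (\det T * \det Y * ((-1) ^+ q * (-1) ^+ q) * \det (U *m T *m U^T + S)).
  by rewrite dTY s1 !mul1r.
by ring.
Qed.

Lemma principal_lowrank n q (X : {set 'I_n}) (S : 'M[R]_n) (U : 'M[R]_(n, q)) T :
  principal X (U *m T *m U^T + S) =
  rows_in X U *m T *m (rows_in X U)^T + principal X S.
Proof.
apply/matrixP => i j; rewrite !mxE; congr (_ + _).
apply: eq_bigr => k _; rewrite !mxE; congr (_ * _).
by apply: eq_bigr => k' _; rewrite !mxE.
Qed.

Lemma det_bordered_neq0 m q (A : 'M[R]_m) (B : 'M[R]_(m, q)) :
  m = q -> \rank B = q -> \det (block_mx A B B^T 0) != 0.
Proof.
move=> mq rB; rewrite -unitfE -unitmxE -row_free_unit -kermx_eq0.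
apply/rowV0P => u /sub_kermxP; rewrite -[u]hsubmxK mul_row_block mulmx0 addr0.
set x := lsubmx u; set y := rsubmx u => H.
have [H1 H2] : x *m A + y *m B^T = 0 /\ x *m B = 0.
  by move: H; rewrite -[0 in X in X -> _]row_mx0 => /eq_row_mx.
have fB : row_free B by rewrite /row_free rB mq.
have x0 : x = 0 by apply/eqP; rewrite -(mulmx_free_eq0 _ fB) H2.
have fBT : row_free B^T by rewrite /row_free mxrank_tr rB.
have y0 : y = 0.
  by apply/eqP; rewrite -(mulmx_free_eq0 _ fBT) -H1 x0 mul0mx add0r.
by rewrite x0 y0 row_mx0.
Qed.

Lemma full_rank_rows n q (V : 'M[R]_(n, q)) : \rank V = q ->
  exists X : {set 'I_n}, #|X| = q /\ \rank (rows_in X V) = q.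
Proof.
move=> rV; have fV : row_full V by rewrite /row_full rV.
pose g := fullrankfun fV.
have g_inj : injective g by exact: fullrankfun_inj.
exists [set g i | i : 'I_q]; split; first by rewrite card_imset // card_ord.
set X := [set g i | i : 'I_q].
apply/eqP; rewrite eqn_leq rank_leq_col /=.
have /row_fullP[B HB] := fullrowsub_full fV.
have sub : (rowsub g V <= rows_in X V)%MS.
  apply/row_subP => i; have gX : g i \in X by apply: imset_f.
  have -> : row i (rowsub g V) = row (enum_rank_in gX (g i)) (rows_in X V).
    by apply/rowP => j; rewrite !mxE enum_rankK_in.
  exact: row_sub.
by apply: leq_trans (mxrankS sub); rewrite (mxrank_fullrowsub fV).
Qed.

(** Listing the indices in another order permutes rows and columns alike, and
    the two signs cancel. *)
Lemma det_mxsub_principal n m (A : 'M[R]_n) (X : {set 'I_n}) (g : 'I_m -> 'I_n) :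
  injective g -> X = [set g i | i : 'I_m] -> \det (mxsub g g A) = \det (principal X A).
Proof.
move=> g_inj XE; have mX : m = #|X| by rewrite XE card_imset // card_ord.
subst m; have gX i : g i \in X by rewrite XE; apply: imset_f.
pose s0 i : 'I_#|X| := enum_rank_in (gX i) (g i).
have s0E i : enum_val (s0 i) = g i by rewrite enum_rankK_in.
have s0_inj : injective s0 by move=> i j /(congr1 enum_val); rewrite !s0E => /g_inj.
pose s := perm s0_inj.
have -> : mxsub g g A = row_perm s (col_perm s (principal X A)).
  by apply/matrixP => i j; rewrite !mxE !permE !s0E.
rewrite row_permE col_permE !det_mulmx !det_perm odd_permV.
by rewrite mulrA mulrAC -expr2 sqrr_sign mul1r.
Qed.

End Bordered.

Section LowerBound.
Context {R : realType} {n : nat}.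

Definition qform (A : 'M[R]_n) (u : 'cV[R]_n) : R := (u^T *m A *m u) ord0 ord0.

Definition sqn m (u : 'cV[R]_m) : R := \sum_i u i ord0 ^+ 2.

(** Testing the coercivity bound on a column of the adjugate compares two
    nested principal minors. *)
Lemma principal_minor_step (A : 'M[R]_n) (h : R) (X : {set 'I_n}) (i : 'I_n) :
  (forall u, sqn u <= h * qform A u) -> i \notin X ->
  \det (principal X A) ^+ 2 <=
  h * (\det (principal (i |: X) A) * \det (principal X A)).
Proof.
move=> Hh iX.
pose g (k : 'I_#|X|.+1) : 'I_n :=
  if unlift ord0 k is Some k' then enum_val k' else i.
have g0 : g ord0 = i by rewrite /g unlift_none.
have gS k : g (lift ord0 k) = enum_val k by rewrite /g liftK.
have g_inj : injective g.
  move=> k k'; case: (unliftP ord0 k) => [j|] ->; case: (unliftP ord0 k') => [j'|] ->;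
    rewrite ?g0 ?gS //.
  - by move/enum_val_inj => ->.
  - by move=> E; move: iX; rewrite -E enum_valP.
  - by move=> E; move: iX; rewrite E enum_valP.
have gX : i |: X = [set g k | k : 'I_#|X|.+1].
  apply/setP => j; apply/idP/imsetP => [|[k _ ->]].
    rewrite in_setU1 => /orP[/eqP ->|jX]; first by exists ord0.
    by exists (lift ord0 (enum_rank_in jX j)); rewrite // gS enum_rankK_in.
  rewrite in_setU1; case: (unliftP ord0 k) => [j'|] ->; rewrite ?g0 ?gS ?eqxx //.
  by rewrite enum_valP orbT.
pose M := mxsub g g A.
have dM : \det M = \det (principal (i |: X) A) by exact: det_mxsub_principal.
pose G : 'M[R]_(#|X|.+1, n) := \matrix_(k, t) (g k == t)%:R.
have ME : M = G *m A *m G^T.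
  apply/matrixP => k k'; rewrite !mxE (bigD1 (g k')) //= big1 => [|t tk].
    rewrite !mxE eqxx mulr1 addr0 (bigD1 (g k)) //= big1 => [|t tk].
      by rewrite !mxE eqxx mul1r addr0.
    by rewrite !mxE eq_sym (negPf tk) mul0r.
  by rewrite !mxE eq_sym (negPf tk) mulr0.
pose u := row ord0 (\adj M).
have cof : u ord0 ord0 = \det (principal X A).
  rewrite !mxE /cofactor expr0 mul1r; congr (\det _).
  by apply/matrixP => k k'; rewrite !mxE !gS.
have uM : u *m M = \det M *: row ord0 1%:M.
  by rewrite /u -row_mul mul_adj_mx; apply/rowP => j; rewrite !mxE mulr_natr.
have := Hh (u *m G)^T.
have -> : qform A (u *m G)^T = \det M * \det (principal X A).
  rewrite /qform trmxK trmx_mul !mulmxA -!(mulmxA u) -!mulmxA [G *m (A *m _)]mulmxA.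
  rewrite [G *m A *m _]mulmxA -ME mulmxA uM -cof -scalemxAl mxE; congr (_ * _).
  by rewrite -row_mul mul1mx !mxE.
rewrite dM; apply: le_trans.
have -> : \det (principal X A) = (u *m G)^T i ord0.
  rewrite mxE mxE (bigD1 ord0) //= big1 => [|k k0].
    by rewrite [G _ _]mxE g0 eqxx mulr1 addr0 cof.
  by rewrite [G _ _]mxE -g0 (inj_eq g_inj) (negPf k0) mulr0.
rewrite /sqn (bigD1 i) //= lerDl sumr_ge0 // => j _; exact: sqr_ge0.
Qed.

End LowerBound.

(** * Two limit laws for determinantal processes; a lemma of Finsler *)

Section LimitLaws.
Context {R : realType} {n : nat}.
Variables (A : R -> 'M[R]_n) (P : R -> subset_law R n).
Hypothesis P_dpp : forall e, 0 < e -> DPP (A e) (P e).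

Lemma dpp_weight e : 0 < e -> exists2 c : R, 0 < c &
  forall X, P e X = c * \det (principal X (A e)).
Proof.
move=> e0; have [_ [c Hc]] := P_dpp e0; exists c => //.
have c0 : 0 <= c.
  have := prob_ge0 (P e) finset.set0; rewrite Hc.
  have -> : \det (principal finset.set0 (A e)) = 1; last by rewrite mulr1.
  have := cards0 'I_n; move: (principal _ _); rewrite -[#|_|]/(#|finset.set0|).
  move=> M M0; move: M; rewrite M0 => M; exact: det_mx00.
rewrite lt_def c0 andbT; apply/eqP => c1.
have := prob_sum1 (P e); rewrite big1 => [/esym/eqP|X _]; first by rewrite oner_eq0.
by rewrite Hc c1 mul0r.
Qed.

(** The mass of X is at most h e times that of X with one more index, so every
    proper subset loses its mass in the limit. *)
Lemma dpp_limit_full (h : R -> R) : vanish 1 h ->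
  (exists2 d, 0 < d & forall e, 0 < e -> e < d -> forall u, sqn u <= h e * qform (A e) u) ->
  exists Xs : subset_law R n, (forall X, P e X @[e --> 0^'+] --> Xs X) /\ Xs [set: 'I_n]%SET = 1.
Proof.
move=> h1 [d d0 Hd].
have P0 (X : {set 'I_n}) : X != [set: 'I_n]%SET -> P e X @[e --> 0^'+] --> (0 : R).
  rewrite -finset.subTset => /fintype.subsetPn[i _ iX].
  apply: vanish_cvg0; apply: vanish_le h1; exists d => // e e0 ed.
  have [c c0 Hc] := dpp_weight e0.
  have := principal_minor_step (Hd e e0 ed) iX.
  have detE Y : \det (principal Y (A e)) = P e Y / c.
    by rewrite Hc mulrC mulKf // gt_eqF.
  rewrite !detE => H.
  have {}H : P e X ^+ 2 <= h e * P e (i |: X) * P e X.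
    have := ler_wpM2r (ltW (exprn_gt0 2 c0)) H.
    rewrite expr_div_n divfK ?expf_neq0 ?gt_eqF // => /le_trans; apply.
    by rewrite le_eqVlt; apply/orP; left; apply/eqP; field; exact: lt0r_neq0.
  have P1 Y : P e Y <= 1.
    rewrite -(prob_sum1 (P e)) (bigD1 Y) //= lerDl sumr_ge0 // => Z _; exact: prob_ge0.
  rewrite ger0_norm ?prob_ge0 //.
  have [->|PX] := eqVneq (P e X) 0; first exact: normr_ge0.
  have PX0 : 0 < P e X by rewrite lt_def PX prob_ge0.
  rewrite expr2 ler_pM2r // in H; apply: le_trans H _.
  apply: le_trans (ler_norm _) _; rewrite normrM (ger0_norm (prob_ge0 _ _)).
  by rewrite -[leRHS]mulr1; apply: ler_wpM2l.
have ge0 (X : {set 'I_n}) : 0 <= (X == [set: 'I_n]%SET)%:R :> R by [].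
have sum1 : \sum_(X : {set 'I_n}) (X == [set: 'I_n]%SET)%:R = 1 :> R.
  rewrite (bigD1 [set: 'I_n]%SET) //= eqxx big1 ?addr0 // => X.
  by move=> /negPf ->.
exists (SubsetLaw ge0 sum1); split => [X|]; last by rewrite /= eqxx.
rewrite /=; have [->|/P0 //] := eqVneq X [set: 'I_n]%SET.
apply: (@cvg_trans _ (1 - \sum_(Y | Y != [set: 'I_n]%SET) P e Y @[e --> 0^'+])).
  apply: near_eq_cvg; near=> e.
  by rewrite -(prob_sum1 (P e)) (bigD1 [set: 'I_n]%SET) //= addrK.
have S0 : \sum_(Y | Y != [set: 'I_n]%SET) P e Y @[e --> 0^'+] -->
    \sum_(Y : {set 'I_n} | Y != [set: 'I_n]%SET) (0 : R).
  by apply: cvg_bigsum => Y /P0.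
rewrite big1_eq in S0.
have := cvgB (cvg_cst (1 : R)) S0; rewrite subr0; exact.
Unshelve. all: by end_near. Qed.

Definition bordered_weight q (S : 'M[R]_n) (U : 'M[R]_(n, q)) (Y : 'M[R]_q) X : R :=
  (-1) ^+ q * \det (block_mx (principal X S) (rows_in X U) (rows_in X U)^T (- Y)).

(** The weights of X, divided by det T, are the bordered determinants, which
    converge.  The limit weights are not all 0, since V has q independent rows;
    they have the same sign, as limits of positive multiples of probabilities up
    to a common sign. *)
Lemma dpp_limit_extended q (U : R -> 'M[R]_(n, q)) (T Y : R -> 'M[R]_q)
    (S : R -> 'M[R]_n) (V : 'M[R]_(n, q)) (S0 : 'M[R]_n) :
  (forall e, 0 < e -> A e = U e *m T e *m (U e)^T + S e) ->
  (forall e, 0 < e -> T e *m Y e = 1%:M) ->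
  mx_cvg U V -> mx_cvg S S0 -> mx_cvg Y 0 -> \rank V = q -> S0^T = S0 ->
  exists Xs : subset_law R n,
    (forall X, P e X @[e --> 0^'+] --> Xs X) /\ extended_DPP S0 V Xs.
Proof.
move=> AE TY UV SS0 Y0 rV S0T.
pose g e X := bordered_weight (S e) (U e) (Y e) X.
pose w X := bordered_weight S0 V 0 X.
have gw X : g e X @[e --> 0^'+] --> w X.
  apply: cvgM; first exact: cvg_cst.
  apply: mx_cvg_det; apply: mx_cvg_block.
  - exact: mx_cvg_sub.
  - exact: mx_cvg_sub.
  - by apply: mx_cvgT; exact: mx_cvg_sub.
  - exact: mx_cvgN.
have Pg e : 0 < e -> exists2 k : R, k != 0 & forall X, P e X = k * g e X.
  move=> e0; have [c c0 Hc] := dpp_weight e0; exists (c * \det (T e)).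
    rewrite mulf_neq0 ?(gt_eqF c0) //; have := congr1 determinant (TY e e0).
    rewrite det_mulmx det1 => H; apply: contraTneq (oner_neq0 R) => T0.
    by rewrite -H T0 mul0r eqxx.
  move=> X; rewrite Hc AE // principal_lowrank (det_bordered_schur _ _ (TY e e0)).
  by rewrite mulrA.
have [X0 [X0q rX0]] := full_rank_rows rV.
have wX0 : w X0 != 0.
  rewrite /w /bordered_weight oppr0 mulf_neq0 ?det_bordered_neq0 //.
  by rewrite expf_neq0 // oppr_eq0 oner_neq0.
have ww X : 0 <= w X0 * w X.
  have cv : g e X0 * g e X @[e --> 0^'+] --> w X0 * w X by exact: cvgM.
  rewrite -(cvg_lim _ cv) //; apply: limr_ge; first by apply/cvg_ex; exists (w X0 * w X).
  near=> e; have e0 : 0 < e by near: e; exact: nbhs_right_gt.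
  have [k k0 Pk] := Pg e e0.
  rewrite -(@pmulr_rge0 _ (k ^+ 2)); last by rewrite lt_def sqrf_eq0 k0 sqr_ge0.
  have -> : k ^+ 2 * (g e X0 * g e X) = (k * g e X0) * (k * g e X) by ring.
  by rewrite -!Pk mulr_ge0 // prob_ge0.
pose W := \sum_X w X.
have W0 : W != 0.
  have : 0 < w X0 * W.
    rewrite /W mulr_sumr (bigD1 X0) //= ltr_pwDl //.
      by rewrite -expr2 lt_def sqrf_eq0 wX0 sqr_ge0.
    by apply: sumr_ge0 => X _; exact: ww.
  by apply: contraTneq => ->; rewrite mulr0 ltxx.
have Pw X : P e X @[e --> 0^'+] --> w X / W.
  apply: (@cvg_trans _ (g e X / \sum_Y g e Y @[e --> 0^'+])).
    apply: near_eq_cvg; near=> e.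
    have e0 : 0 < e by near: e; exact: nbhs_right_gt.
    have [k k0 Pk] := Pg e e0.
    have k1 : k * \sum_Y g e Y = 1.
      by rewrite -(prob_sum1 (P e)) mulr_sumr; apply: eq_bigr => Z _; rewrite Pk.
    have s0 : \sum_Y g e Y != 0.
      by apply: contraTneq (oner_neq0 R) => s0; rewrite -k1 s0 mulr0 eqxx.
    by rewrite Pk -[RHS]mulr1; apply: (mulIf s0); rewrite mulr1 divfK // mulrAC k1 mul1r.
  apply: cvgM; first exact: gw.
  by apply: cvgV => //; apply: cvg_bigsum => Y' _; exact: gw.
have ge0 X : 0 <= w X / W.
  rewrite -(cvg_lim _ (Pw X)) //; apply: limr_ge; first by apply/cvg_ex; exists (w X / W).
  by near=> e; exact: prob_ge0.
have sum1 : \sum_X w X / W = 1 by rewrite -mulr_suml divff.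
exists (SubsetLaw ge0 sum1); split; first exact: Pw.
split=> //.
- move=> u Vu.
  have [Z VZ] : exists Z, V^T *m Z = 1%:M.
    by apply/row_freeP; rewrite /row_free mxrank_tr rV.
  (* u is moved into the kernel of U^T by a projection along Z, multiplied by
     det (U^T Z), so that no inverse is needed; this factor tends to 1. *)
  pose ue e := \det ((U e)^T *m Z) *: u - Z *m (\adj ((U e)^T *m Z) *m ((U e)^T *m u)).
  have Uu e : (U e)^T *m ue e = 0.
    rewrite /ue mulmxBr -scalemxAr !mulmxA mul_mx_adj -mulmxA mul_scalar_mx.
    by rewrite subrr.
  have uu : mx_cvg ue u.
    have -> : u = \det (V^T *m Z) *: u - Z *m (\adj (V^T *m Z) *m (V^T *m u)).
      by rewrite VZ det1 scale1r Vu !mulmx0 subr0.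
    have UZ : mx_cvg (fun e => (U e)^T *m Z) (V^T *m Z).
      by apply: mx_cvgM; [exact: mx_cvgT|exact: mx_cvg_cst].
    apply: mx_cvgD; first by apply: mx_cvgZ; [exact: mx_cvg_det|exact: mx_cvg_cst].
    apply: mx_cvgN; apply: mx_cvgM; first exact: mx_cvg_cst.
    apply: mx_cvgM; first exact: mx_cvg_adj.
    by apply: mx_cvgM; [exact: mx_cvgT|exact: mx_cvg_cst].
  have cv : mx_cvg (fun e => (ue e)^T *m S e *m ue e) (u^T *m S0 *m u).
    by apply: mx_cvgM => //; apply: mx_cvgM => //; exact: mx_cvgT.
  have {}cv := cv ord0 ord0.
  rewrite -(cvg_lim _ cv) //; apply: limr_ge; first by apply/cvg_ex; eexists; exact: cv.
  near=> e; have e0 : 0 < e by near: e; exact: nbhs_right_gt.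
  have [[_ Apsd] _] := P_dpp e0; have := Apsd (ue e).
  rewrite AE // mulmxDr mulmxDl mxE.
  suff -> : ((ue e)^T *m (U e *m T e *m (U e)^T) *m ue e) = 0 by rewrite mxE add0r.
  by rewrite -!mulmxA Uu !mulmx0.
- exists W^-1 => X; rewrite /= /w /bordered_weight oppr0 mulrC.
  by [].
Unshelve. all: by end_near. Qed.

End LimitLaws.

Section Finsler.
Context {R : realType} {n q : nat}.

Let F (S : 'M[R]_n) (u : 'rV[R]_n) : R := qform S u^T.
Let G (V : 'M[R]_(n, q)) (u : 'rV[R]_n) : R := sqn (V^T *m u^T).

Let F_continuous S : continuous (F S).
Proof.
have -> : F S = fun u : 'rV[R]_n => \sum_j (\sum_i u ord0 i * S i j) * u ord0 j.
  apply/funext => u; rewrite /F /qform trmxK mxE; apply: eq_bigr => j _.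
  by rewrite mxE [u^T _ _]mxE.
move=> u; apply: (cvg_bigsum (F := nbhs u)) => j _.
apply: cvgM; last exact: coord_continuous.
apply: (cvg_bigsum (F := nbhs u)) => i _.
by apply: cvgM; [exact: coord_continuous|exact: cvg_cst].
Qed.

Let G_continuous V : continuous (G V).
Proof.
have -> : G V = fun u : 'rV[R]_n => \sum_k (\sum_i V i k * u ord0 i) * (\sum_i V i k * u ord0 i).
  apply/funext => u; rewrite /G /sqn; apply: eq_bigr => k _.
  rewrite expr2 mxE.
  by under eq_bigr do rewrite !mxE.
move=> u; apply: (cvg_bigsum (F := nbhs u)) => k _.
by apply: cvgM; apply: (cvg_bigsum (F := nbhs u)) => i _;
  apply: cvgM; [exact: cvg_cst|exact: coord_continuous|exact: cvg_cst|exact: coord_continuous].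
Qed.

Let sphere : set 'rV[R]_n := [set u | nsq u = 1].

Let nsq_continuous : continuous (@nsq R n).
Proof.
move=> z; apply: (cvg_bigsum (F := nbhs z)) => i _.
apply: (continuous_comp (f := fun x : 'rV[R]_n => x ord0 i) (g := fun t : R => t ^+ 2)).
  exact: coord_continuous.
exact: exprn_continuous.
Qed.

Let sphere_compact : compact sphere.
Proof.
apply: bounded_closed_compact.
  exists 1; split => // t t1 u /= u1.
  apply: le_trans (ltW t1); rewrite /Num.norm /= mx_normrE.
  apply: bigmax_le => // -[i j] _ /=; rewrite ord1.
  by apply: le_trans (norm_coord_le u j) _; rewrite /norm2 -/(nsq u) u1 sqrtr1.
have -> : sphere = @nsq R n @^-1` [set 1] by [].
by apply: closed_comp => [u _|]; [exact: nsq_continuous|exact: closed_eq].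
Qed.

(** By compactness of the unit sphere: on the part of it where the form is not
    positive, |V^T u|^2 has a positive minimum, and a large multiple of it
    outweighs the form. *)
Lemma finsler (V : 'M[R]_(n, q)) (S : 'M[R]_n) :
  (forall u : 'cV[R]_n, u != 0 -> V^T *m u = 0 -> 0 < qform S u) ->
  exists C c : R, [/\ 0 <= C, 0 < c &
    forall u, c * sqn u <= C * sqn (V^T *m u) + qform S u].
Proof.
move=> HS.
suff [C [c [C0 c0 H]]] : exists C c : R, [/\ 0 <= C, 0 < c &
    forall u, sphere u -> c <= C * G V u + F S u].
  exists C, c; split => // u.
  have [->|u0] := eqVneq u 0.
    rewrite /sqn /qform !mulmx0 mxE !big1 ?mulr0 ?addr0 // => i _; rewrite mxE expr0n //.
  have uT0 : u^T != 0 by rewrite -trmx0 (inj_eq trmx_inj).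
  have N0 := nsq_gt0 uT0; have n0 := norm2_gt0 uT0.
  pose v := (norm2 u^T)^-1 *: u^T.
  have sv : sphere v.
    by rewrite /sphere /= nsqZ exprVn norm2_sqr mulVf // gt_eqF.
  have := H v sv; rewrite -(ler_pM2r N0).
  have -> : sqn u = nsq u^T by rewrite /sqn /nsq; apply: eq_bigr => i _; rewrite mxE.
  have uE : u = norm2 u^T *: v^T.
    by rewrite /v linearZ /= trmxK scalerA divff ?scale1r // gt_eqF.
  have -> : sqn (V^T *m u) = nsq u^T * G V v.
    rewrite {1}uE -norm2_sqr -scalemxAr /G /sqn mulr_sumr; apply: eq_bigr => i _.
    by rewrite mxE exprMn.
  have -> : qform S u = nsq u^T * F S v.
    rewrite {1}uE -norm2_sqr /F /qform [(_ *: _)^T]linearZ /= -!scalemxAl -scalemxAr !mxE.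
    by rewrite mulrA expr2.
  by move=> H1; apply: le_trans H1 _; rewrite le_eqVlt; apply/orP; left; apply/eqP; ring.
have G0 u : 0 <= G V u by apply: sumr_ge0 => i _; exact: sqr_ge0.
have [u0|s0] := pselect (sphere !=set0); last first.
  by exists 0, 1; split => // u su; case: s0; exists u.
have [um um_in Fm] := EVT_min_rV u0 sphere_compact (continuous_subspaceT (@F_continuous S)).
pose K := sphere `&` [set u | F S u <= 0].
have K_compact : compact K.
  apply: compact_closedI => //.
  have -> : [set u | F S u <= 0] = F S @^-1` [set x | x <= 0] by [].
  by apply: closed_comp => [u _|]; [exact: F_continuous|exact: closed_le].
have s_neq0 u : sphere u -> u^T != 0.
  rewrite -trmx0 (inj_eq trmx_inj) => su; apply: contra_eqN su => /eqP ->.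
  have -> : nsq (0 : 'rV[R]_n) = 0 by apply/eqP; rewrite nsq_eq0.
  by rewrite eq_sym oner_neq0.
have pos : exists2 C : R, 0 <= C & forall u, sphere u -> 0 < C * G V u + F S u.
  have [K0|K0] := pselect (K !=set0); last first.
    exists 0 => // u su; rewrite mul0r add0r ltNge; apply/negP => Fu.
    by case: K0; exists u.
  have [uk uk_in Gm] := EVT_min_rV K0 K_compact (continuous_subspaceT (@G_continuous V)).
  have [suk Fuk] : K uk by rewrite inE in uk_in.
  have Gk : 0 < G V uk.
    rewrite lt_def G0 andbT; apply/eqP => /psumr_eq0P Gk.
    suff : 0 < qform S uk^T by rewrite ltNge; move/negP; apply.
    apply: HS; first exact: s_neq0.
    apply/colP => i; rewrite [RHS]mxE; apply/eqP; rewrite -sqrf_eq0; apply/eqP.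
    by apply: Gk => // j _; exact: sqr_ge0.
  exists ((`|F S um| + 1) / G V uk); first by rewrite divr_ge0 ?addr_ge0 // ltW.
  move=> u su; have [Fu|Fu] := leP (F S u) 0; last first.
    by rewrite ltr_wpDl // mulr_ge0 // divr_ge0 ?addr_ge0 // ltW.
  have Gu : G V uk <= G V u by apply: Gm; rewrite inE.
  have Fu' : F S um <= F S u by apply: Fm; rewrite inE.
  have : `|F S um| + 1 <= (`|F S um| + 1) / G V uk * G V u.
    by rewrite -mulrA ler_peMr ?addr_ge0 // mulrC ler_pdivlMr // mul1r.
  by move=> H; have := ler_norm (- F S um); rewrite normrN; lra.
have [C C0 HC] := pos.
have Hcont : continuous (fun u => C * G V u + F S u).
  move=> u.
  exact: (cvgD (cvgM (@cvg_cst _ C _ _ (nbhs_filter u)) (@G_continuous V u)) (@F_continuous S u)).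
have [uc uc_in Hm] := EVT_min_rV u0 sphere_compact (continuous_subspaceT Hcont).
rewrite inE in uc_in.
by exists C, (C * G V uc + F S uc); split => // [|u su]; [exact: HC|apply: Hm; rewrite inE].
Qed.

End Finsler.

(** * Matrix expansions, and columns of the Vandermonde matrix *)

Section MatrixExpansions.
Context {R : realType}.

(** The relation A e = e^a (A0 + O(e)), entrywise. *)
Definition mx_expand m n (a : nat) (A : R -> 'M[R]_(m, n)) (A0 : 'M[R]_(m, n)) : Prop :=
  forall i j, vanish a.+1 (fun e => A e i j - e ^+ a * A0 i j).

Lemma mx_expand_vanish m n a A (A0 : 'M[R]_(m, n)) i j : mx_expand a A A0 ->
  vanish a (fun e => A e i j).
Proof.
move=> H; have := vanishD (vanishW (leqnSn a) (H i j)) (vanishZ (A0 i j) (vanishX a)).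
by apply: vanish_eq => e _; ring.
Qed.

Lemma mx_expand_cst m n (A : 'M[R]_(m, n)) : mx_expand 0 (fun=> A) A.
Proof. by move=> i j; apply: vanish_eq (vanish0 _) => e _; rewrite expr0 mul1r subrr. Qed.

Lemma mx_expandT m n a A (A0 : 'M[R]_(m, n)) : mx_expand a A A0 ->
  mx_expand a (fun e => (A e)^T) A0^T.
Proof. by move=> H i j; apply: vanish_eq (H j i) => e _; rewrite !mxE. Qed.

Lemma mx_expandM m n p a b A B (A0 : 'M[R]_(m, n)) (B0 : 'M[R]_(n, p)) :
  mx_expand a A A0 -> mx_expand b B B0 ->
  mx_expand (a + b) (fun e => A e *m B e) (A0 *m B0).
Proof.
move=> HA HB i j.
have H : vanish (a + b).+1 (fun e => \sum_k (A e i k * B e k j - e ^+ (a + b) * (A0 i k * B0 k j))).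
  apply: vanish_sum => k _.
  have H1 : vanish (a + b).+1 (fun e => (A e i k - e ^+ a * A0 i k) * B e k j).
    by rewrite -addSn; apply: vanishM; [exact: HA|exact: mx_expand_vanish HB].
  have H2 : vanish (a + b).+1 (fun e => (e ^+ a * A0 i k) * (B e k j - e ^+ b * B0 k j)).
    rewrite -addnS; apply: vanishM; last exact: HB.
    by apply: vanish_eq (vanishZ (A0 i k) (vanishX a)) => e _; rewrite mulrC.
  by apply: vanish_eq (vanishD H1 H2) => e _; rewrite exprD; ring.
by apply: vanish_eq H => e _; rewrite !mxE mulr_sumr -sumrB.
Qed.

Lemma mx_expandB m n a A B (A0 B0 : 'M[R]_(m, n)) :
  mx_expand a A A0 -> mx_expand a B B0 -> mx_expand a (fun e => A e - B e) (A0 - B0).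
Proof.
move=> HA HB i j; apply: vanish_eq (vanishB (HA i j) (HB i j)) => e _.
by rewrite !mxE; ring.
Qed.

Lemma mx_expandW m n a b A (A0 : 'M[R]_(m, n)) : (b < a)%N ->
  mx_expand a A A0 -> mx_expand b A 0.
Proof.
move=> ba H i j; apply: vanish_eq (vanishW ba (mx_expand_vanish i j H)) => e _.
by rewrite mxE mulr0 subr0.
Qed.

Lemma mx_expand_cvg m n a A (A0 : 'M[R]_(m, n)) (c : R) : mx_expand a A A0 ->
  mx_cvg (fun e => (c * e ^- a) *: A e) (c *: A0).
Proof.
move=> H i j; rewrite mxE; under eq_fun do rewrite mxE.
apply: vanish_cvg; apply: (@vanish_divX _ 1 a); rewrite add1n.
apply: vanish_eq (vanishZ c (H i j)) => e e0.
by field; rewrite expf_neq0 // gt_eqF.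
Qed.

Lemma sqn_ge0 m (u : 'cV[R]_m) : 0 <= sqn u.
Proof. by apply: sumr_ge0 => i _; exact: sqr_ge0. Qed.

Lemma qformE m (A : 'M[R]_m) u : qform A u = \sum_i \sum_j u i ord0 * u j ord0 * A i j.
Proof.
rewrite /qform mxE exchange_big; apply: eq_bigr => j _; rewrite mxE mulr_suml.
by apply: eq_bigr => i _; rewrite mxE; ring.
Qed.

Lemma qformD m (A B : 'M[R]_m) u : qform (A + B) u = qform A u + qform B u.
Proof. by rewrite /qform mulmxDr mulmxDl mxE. Qed.

Lemma qformZ m c (A : 'M[R]_m) u : qform (c *: A) u = c * qform A u.
Proof. by rewrite /qform -scalemxAr -scalemxAl mxE. Qed.

Lemma qform_gram m p (B : 'M[R]_(m, p)) u : qform (B *m B^T) u = sqn (B^T *m u).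
Proof.
rewrite /qform mulmxA -mulmxA mxE; apply: eq_bigr => i _.
by rewrite -{1}[B]trmxK -trmx_mul mxE expr2.
Qed.

Lemma qform_vanish m k (A : R -> 'M[R]_m) : (forall i j, vanish k (fun e => A e i j)) ->
  exists C dl : R, [/\ 0 <= C, 0 < dl & forall e, 0 < e -> e < dl -> forall u,
    `|qform (A e) u| <= C * e ^+ k * sqn u].
Proof.
move=> H; have [C [dl [C0 dl0 HC]]] : vanish k (fun e => \sum_i \sum_j `|A e i j|).
  apply: vanish_sum => i _; apply: vanish_sum => j _.
  by apply: vanish_le (H i j); exists 1 => // e _ _; rewrite normr_id.
exists C, dl; split => // e e0 edl u.
apply: le_trans (_ : (\sum_i \sum_j `|A e i j|) * sqn u <= _); last first.
  apply: ler_wpM2r; first exact: sqn_ge0.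
  by apply: le_trans (ler_norm _) _; exact: HC.
rewrite qformE mulr_suml; apply: le_trans (ler_norm_sum _ _ _) _.
apply: ler_sum => i _; rewrite mulr_suml; apply: le_trans (ler_norm_sum _ _ _) _.
apply: ler_sum => j _; rewrite normrM mulrC; apply: ler_wpM2l => //.
have le k' : `|u k' ord0| ^+ 2 <= sqn u.
  rewrite real_normK ?num_real // /sqn (bigD1 k') //= lerDl sumr_ge0 // => k'' _.
  exact: sqr_ge0.
rewrite normrM; have := le i; have := le j.
set a := `|u j ord0|; set b := `|u i ord0| => Ha Hb.
have : 0 <= a ^+ 2 + b ^+ 2 - 2 * (b * a).
  have -> : a ^+ 2 + b ^+ 2 - 2 * (b * a) = (a - b) ^+ 2 by ring.
  exact: sqr_ge0.
lra.
Qed.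

End MatrixExpansions.

Section ColumnIndices.
Context {R : realType} {d : nat}.
Variables (o : mono_order d) (l : nat).

(** The multi-index of a column of V_{<= l-1}, across its blocks. *)
Definition colidx (k : 'I_(\sum_(i < l) dimH i d)) : mindex d :=
  mono o (tagnat.sig2 k).

Lemma colidx_deg k : (mdeg (colidx k) < l)%N.
Proof. by rewrite /colidx mono_deg ltn_ord. Qed.

Lemma colidx_inj : injective colidx.
Proof.
move=> k k' E; apply: tagnat.sig_inj; move: E.
rewrite /colidx /tagnat.sig2 /tagnat.sig1; move: (tagnat.sig k) (tagnat.sig k').
move=> [i s] [i' s'] /= E.
have ii : i = i' by apply: val_inj; rewrite /= -(mono_deg o s) -(mono_deg o s') E.
by subst i'; move/Defs.mono_inj: E => ->.
Qed.

Lemma colidx_surj (a : mindex d) : (mdeg a < l)%N -> exists k, colidx k = a.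
Proof.
move=> al; have [s Es] := mono_surj o (erefl (mdeg a)).
exists (tagnat.rank (Tagged (fun i : 'I_l => 'I_(dimH i d)) (s : 'I_(dimH (Ordinal al) d)))).
by rewrite /colidx /tagnat.sig2 /tagnat.sig1 tagnat.rankK /=.
Qed.

Lemma sum_colidx (a : mindex d) (g : mindex d -> R) :
  \sum_k (a == colidx k)%:R * g (colidx k) = (mdeg a < l)%N%:R * g a.
Proof.
have [/colidx_surj[k <-]|la] := ltnP (mdeg a) l.
  rewrite (bigD1 k) //= eqxx big1 ?addr0 // => k' kk'.
  by rewrite (inj_eq colidx_inj) eq_sym (negPf kk') mul0r.
rewrite mul0r big1 // => k _; case: eqP => [E|_]; last by rewrite mul0r.
by have := colidx_deg k; rewrite -E ltnNge la.
Qed.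

Lemma sum_mono (a : mindex d) (g : mindex d -> R) :
  \sum_s (a == mono o (k:=l) s)%:R * g (mono o (k:=l) s) = (mdeg a == l)%:R * g a.
Proof.
have [E|la] := eqVneq (mdeg a) l.
  have [s <-] := mono_surj o E.
  rewrite (bigD1 s) //= eqxx big1 ?addr0 // => s' ss'.
  by rewrite (inj_eq (@Defs.mono_inj _ o l)) eq_sym (negPf ss') mul0r.
rewrite mul0r big1 // => s _; case: eqP => [E|_]; last by rewrite mul0r.
by move: la; rewrite E mono_deg eqxx.
Qed.

End ColumnIndices.

Section FixedSize.
Context {R : realType}.

(** The sign comes from two elementary block operations, which avoids counting
    the inversions of a permutation. *)
Lemma det_antidiag q : \det (block_mx 0 1%:M 1%:M 0 : 'M[R]_(q + q)) = (-1) ^+ q.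
Proof.
have E : block_mx 1%:M 0 (- 1%:M) 1%:M *m (block_mx 1%:M 1%:M 0 1%:M *m
    block_mx 0 1%:M 1%:M 0) = block_mx 1%:M 1%:M 0 (- 1%:M) :> 'M[R]_(q + q).
  rewrite !mulmx_block !(mul0mx, mulmx0, mul1mx, mulmx1, mulNmx, add0r, addr0).
  by rewrite addNr.
have := congr1 determinant E; rewrite !det_mulmx det_ublock det_lblock det_ublock !det1.
by rewrite !mul1r => ->; rewrite -scaleN1r detZ det1 mulr1.
Qed.

(** Two diagonal zero blocks leave the Gram determinant of the off-diagonal
    block when it is square, and too small a rank otherwise. *)
Lemma det_offdiag m q (B : 'M[R]_(m, q)) :
  (-1) ^+ q * \det (block_mx 0 B B^T 0) = if m == q then \det (B *m B^T) else 0.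
Proof.
case: eqVneq => [mq|mq].
  subst q.
  have -> : block_mx 0 B B^T 0 = block_mx B 0 0 B^T *m block_mx 0 1%:M 1%:M 0.
    by rewrite mulmx_block !(mul0mx, mulmx0, mulmx1, add0r, addr0).
  rewrite !det_mulmx det_antidiag det_lblock.
  have s2 : (-1) ^+ m * (-1) ^+ m = 1 :> R.
    by rewrite -exprD addnn -mul2n exprM sqrrN expr1n expr1n.
  by rewrite [LHS]mulrC -[LHS]mulrA s2 mulr1.
suff -> : \det (block_mx 0 B B^T 0) = 0 by rewrite mulr0.
apply/eqP; rewrite -[_ == 0]negbK -unitfE -unitmxE -row_free_unit /row_free.
rewrite neq_ltn; apply/orP; left.
have -> : block_mx 0 B B^T 0 = col_mx (row_mx 0 B) (row_mx B^T 0) by [].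
apply: leq_ltn_trans (_ : \rank (row_mx 0 B) + \rank (row_mx B^T 0) < _)%N.
  by rewrite -addsmxE; exact: mxrank_adds_leqif.
have -> : \rank (row_mx (0 : 'M[R]_m) B) = \rank B.
  by rewrite -mxrank_tr (tr_row_mx 0 B) trmx0 -addsmxE adds0mx mxrank_tr.
have -> : \rank (row_mx B^T (0 : 'M[R]_q)) = \rank B.
  by rewrite -mxrank_tr (tr_row_mx B^T 0) trmx0 trmxK -addsmxE addsmx0.
have := rank_leq_row B; have := rank_leq_col B; move: mq; clear; lia.
Qed.

Lemma extended_fixed_size n q (V : 'M[R]_(n, q)) (P : subset_law R n) :
  extended_DPP 0 V P -> fixed_size_DPP q (V *m V^T) P.
Proof.
move=> [_ _ _ [c Hc]]; split.
  split=> [|u]; first by rewrite trmx_mul trmxK.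
  rewrite -/(qform (V *m V^T) u) qform_gram; exact: sqn_ge0.
exists c => X; rewrite Hc.
have -> : principal X 0 = 0 :> 'M[R]_#|X| by apply/matrixP => i j; rewrite !mxE.
rewrite det_offdiag; congr (_ * _); case: ifP => // _; congr determinant.
by apply/matrixP => i j; rewrite !mxE; apply: eq_bigr => k _; rewrite !mxE.
Qed.

End FixedSize.

(** * Block decomposition of the kernel matrix *)

Section Decomposition.
Context {R : realType} {d n : nat}.
Variables (kappa : 'rV[R]_d -> 'rV[R]_d -> R) (f : R -> R) (fc : nat -> R) (r : nat).
Hypothesis d_gt0 : (0 < d)%N.
Hypothesis kappa_pd : posdef_kernel kappa.
Hypothesis kappa_stat : stationary kappa f.
Hypothesis f_analytic : analytic_at0 f fc.
Hypothesis f_order : smoothness_order fc r.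
Variables (o : mono_order d) (x : 'I_n -> 'rV[R]_d) (l : nat).
Hypothesis lr : (l <= r)%N.
Variable S : seq (R * (mindex d * mindex d)).
Hypothesis S_deg : forall t, t \in S -> (mdeg t.2.1 + mdeg t.2.2 <= r.*2 - 2)%N.
Hypothesis S_even : forall x y, even_part fc r x y = bipoly_eval S x y.
Hypothesis S_sym : forall g : mindex d -> mindex d -> R,
  \sum_(t <- S) t.1 * g t.2.1 t.2.2 = \sum_(t <- S) t.1 * g t.2.2 t.2.1.

Local Notation q := (\sum_(i < l) dimH i d)%N.
Local Notation idx := (colidx o (l:=l)).
Local Notation V := (vander_lt o x l).
Local Notation Km e := (kernel_mx (scaled_kernel f e) x).

Lemma vander_ltE i k : V i k = mon (idx k) (x i).
Proof. by rewrite !mxE. Qed.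

Definition low_mx : 'M[R]_q := \matrix_(k, k') bcoef S (idx k) (idx k').
Local Notation W := low_mx.

Lemma bcoef_sym a b : bcoef S a b = bcoef S b a.
Proof.
rewrite !bcoefE (S_sym (fun a' b' => (a' == a)%:R * (b' == b)%:R)).
by apply: eq_bigr => t _; rewrite [X in _ * X]mulrC.
Qed.

Lemma low_mx_sym : W^T = W.
Proof. by apply/matrixP => k k'; rewrite !mxE bcoef_sym. Qed.

Lemma low_mx_pos (u : 'cV[R]_q) : u != 0 -> 0 < qform W u.
Proof.
move=> u0; have [k uk] : exists k, u k ord0 != 0.
  apply/existsP; apply: contraNT u0; rewrite negb_exists => /forallP H.
  by apply/eqP/colP => k; rewrite mxE; apply/eqP; have := H k; rewrite negbK.
have deg j : (mdeg (idx j) < r)%N by apply: leq_trans (colidx_deg o j) lr.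
have := @wronskian_form_gt0 _ _ _ _ _ _ d_gt0 kappa_pd kappa_stat f_analytic f_order S _
  idx (fun j => u j ord0) k S_even (colidx_inj (o:=o) (l:=l)) deg uk.
suff -> : qform W u = \sum_j \sum_j' u j ord0 * u j' ord0 * bcoef S (idx j) (idx j') by [].
rewrite /qform mxE exchange_big; apply: eq_bigr => j _.
rewrite mxE mulr_suml; apply: eq_bigr => j' _.
by rewrite !mxE; ring.
Qed.

Lemma low_mx_unit : W \in unitmx.
Proof.
rewrite -row_free_unit -kermx_eq0; apply/rowV0P => u /sub_kermxP uW.
apply/eqP; apply: contraT => u0.
have : u^T != 0 by rewrite -trmx0 (inj_eq trmx_inj).
by move/low_mx_pos; rewrite /qform trmxK uW mul0mx mxE ltxx.
Qed.

Definition scale_mx (e : R) : 'M[R]_q := diag_mx (\row_k e ^+ mdeg (idx k)).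
Local Notation Dl := scale_mx.

(** The part |a| >= l, |b| < l of the even part, with the powers of e attached
    to y left to the diagonal matrix. *)
Definition high_low (e : R) : 'M[R]_(n, q) := \matrix_(i, k)
  \sum_(t <- S) t.1 * ((l <= mdeg t.2.1)%N%:R * (t.2.2 == idx k)%:R * mon t.2.1 (e *: x i)).
Local Notation N := high_low.

Definition high_high (e : R) : 'M[R]_n := \matrix_(i, j)
  \sum_(t <- S) t.1 * ((l <= mdeg t.2.1)%N%:R * (l <= mdeg t.2.2)%N%:R *
                       (mon t.2.1 (e *: x i) * mon t.2.2 (e *: x j))).

Lemma vander_scaleE e i k : (V *m Dl e) i k = mon (idx k) (e *: x i).
Proof. by rewrite mul_mx_diag mxE vander_ltE mxE monZ mulrC. Qed.

(** The monomials are sorted by |a| < l and |b| < l; by symmetry of the list, the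
    two mixed parts are transposes of each other. *)
Lemma even_part_decomp e :
  \matrix_(i, j) even_part fc r (e *: x i) (e *: x j) =
  (V *m Dl e) *m W *m (V *m Dl e)^T + N e *m (V *m Dl e)^T + (V *m Dl e) *m (N e)^T +
  high_high e.
Proof.
have lohi (a : mindex d) : (mdeg a < l)%N%:R + (l <= mdeg a)%N%:R = 1 :> R.
  by rewrite ltnNge; case: leqP; rewrite ?addr0 ?add0r.
apply/matrixP => i j; rewrite [LHS]mxE [RHS]mxE [X in _ = X + _]mxE [X in _ = X + _ + _]mxE.
have -> : ((V *m Dl e) *m W *m (V *m Dl e)^T) i j =
    \sum_(t <- S) t.1 * ((mdeg t.2.1 < l)%N%:R * (mdeg t.2.2 < l)%N%:R *
      (mon t.2.1 (e *: x i) * mon t.2.2 (e *: x j))).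
  rewrite mxE.
  have E k : ((V *m Dl e) *m W) i k = \sum_(t <- S) t.1 * ((t.2.2 == idx k)%:R *
      ((mdeg t.2.1 < l)%N%:R * mon t.2.1 (e *: x i))).
    rewrite mxE; transitivity (\sum_k' \sum_(t <- S) mon (idx k') (e *: x i) *
        (t.1 * ((t.2.1 == idx k')%:R * (t.2.2 == idx k)%:R))).
      by apply: eq_bigr => k' _; rewrite vander_scaleE mxE bcoefE mulr_sumr.
    rewrite exchange_big; apply: eq_bigr => t _ /=.
    rewrite -(sum_colidx o l t.2.1 (fun a => mon a (e *: x i))) !mulr_sumr.
    by apply: eq_bigr => k' _; ring.
  transitivity (\sum_k \sum_(t <- S) t.1 * ((t.2.2 == idx k)%:R *
      ((mdeg t.2.1 < l)%N%:R * mon t.2.1 (e *: x i))) * mon (idx k) (e *: x j)).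
    by apply: eq_bigr => k _; rewrite E [_^T _ _]mxE vander_scaleE mulr_suml.
  rewrite exchange_big; apply: eq_bigr => t _ /=.
  transitivity (t.1 * (mdeg t.2.1 < l)%N%:R * mon t.2.1 (e *: x i) *
     ((mdeg t.2.2 < l)%N%:R * mon t.2.2 (e *: x j))); last by ring.
  rewrite -(sum_colidx o l t.2.2 (fun a => mon a (e *: x j))) mulr_sumr.
  by apply: eq_bigr => k' _; ring.
have HL i' j' : (N e *m (V *m Dl e)^T) i' j' =
    \sum_(t <- S) t.1 * ((l <= mdeg t.2.1)%N%:R * (mdeg t.2.2 < l)%N%:R *
      (mon t.2.1 (e *: x i') * mon t.2.2 (e *: x j'))).
  rewrite mxE; transitivity (\sum_k \sum_(t <- S) t.1 * ((l <= mdeg t.2.1)%N%:R *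
      (t.2.2 == idx k)%:R * mon t.2.1 (e *: x i')) * mon (idx k) (e *: x j')).
    by apply: eq_bigr => k _; rewrite [N e _ _]mxE [_^T _ _]mxE vander_scaleE mulr_suml.
  rewrite exchange_big; apply: eq_bigr => t _ /=.
  transitivity (t.1 * (l <= mdeg t.2.1)%N%:R * mon t.2.1 (e *: x i') *
     ((mdeg t.2.2 < l)%N%:R * mon t.2.2 (e *: x j'))); last by ring.
  rewrite -(sum_colidx o l t.2.2 (fun a => mon a (e *: x j'))) mulr_sumr.
  by apply: eq_bigr => k' _; ring.
have -> : ((V *m Dl e) *m (N e)^T) i j = (N e *m (V *m Dl e)^T) j i.
  transitivity ((N e *m (V *m Dl e)^T)^T i j); last by rewrite [LHS]mxE.
  by rewrite trmx_mul trmxK.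
rewrite !HL (S_sym (fun a b => (l <= mdeg a)%N%:R * (mdeg b < l)%N%:R *
      (mon a (e *: x j) * mon b (e *: x i)))) S_even mxE -!big_split.
apply: eq_bigr => t _ /=; have := lohi t.2.1; have := lohi t.2.2.
set a1 := (mdeg t.2.2 < l)%N%:R; set a2 := (l <= mdeg t.2.2)%N%:R.
set b1 := (mdeg t.2.1 < l)%N%:R; set b2 := (l <= mdeg t.2.1)%N%:R.
move=> Ha Hb; transitivity (t.1 * ((b1 + b2) * (a1 + a2) *
  (mon t.2.1 (e *: x i) * mon t.2.2 (e *: x j)))); last by ring.
by rewrite Ha Hb !mul1r.
Qed.

Definition remainder_mx (e : R) : 'M[R]_n := Km e -
  ((V *m Dl e) *m W *m (V *m Dl e)^T + N e *m (V *m Dl e)^T + (V *m Dl e) *m (N e)^T).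
Local Notation Rm := remainder_mx.

Lemma remainder_expand i j : vanish r.*2 (fun e => Rm e i j -
  (high_high e i j + fc r.*2.-1 * norm2 (x i - x j) ^+ r.*2.-1 * e ^+ r.*2.-1)).
Proof.
apply: vanish_eq (kernel_expand_pair kappa_stat f_analytic f_order (x i) (x j)) => e e0.
have -> : kappa (e *: x i) (e *: x j) = Km e i j.
  by rewrite mxE /scaled_kernel kappa_stat -scalerBr norm2Z gtr0_norm.
have := congr1 (fun M : 'M[R]_n => M i j) (even_part_decomp e).
rewrite [X in X = _]mxE => ->.
have sub (B C : 'M[R]_n) : (B - C) i j = B i j - C i j by rewrite !mxE.
have add (B C : 'M[R]_n) : (B + C) i j = B i j + C i j by rewrite !mxE.
by rewrite /remainder_mx sub !add; ring.
Qed.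

Local Notation Vl := (vander_deg o x l).

Definition top_block : 'M[R]_(dimH l d) :=
  \matrix_(s, s') bcoef S (mono o s) (mono o s').

Definition top_low : 'M[R]_(dimH l d, q) := \matrix_(s, k) bcoef S (mono o s) (idx k).

Lemma vander_degE i s : Vl i s = mon (mono o s) (x i).
Proof. by rewrite mxE. Qed.

Lemma high_low_expand : mx_expand l high_low (Vl *m top_low).
Proof.
move=> i k.
have E : (Vl *m top_low) i k = \sum_(t <- S) t.1 * ((mdeg t.2.1 == l)%N%:R *
    (t.2.2 == idx k)%:R * mon t.2.1 (x i)).
  rewrite mxE; transitivity (\sum_s \sum_(t <- S) mon (mono o s) (x i) *
        (t.1 * ((t.2.1 == mono o (k:=l) s)%:R * (t.2.2 == idx k)%:R))).
    by apply: eq_bigr => s _; rewrite vander_degE mxE bcoefE mulr_sumr.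
  rewrite exchange_big; apply: eq_bigr => t _ /=.
  transitivity (t.1 * (t.2.2 == idx k)%:R * ((mdeg t.2.1 == l)%:R * mon t.2.1 (x i))); last by ring.
  rewrite -(sum_mono o l t.2.1 (fun a => mon a (x i))) mulr_sumr.
  by apply: eq_bigr => s _; ring.
have H : vanish l.+1 (fun e => \sum_(t <- S) t.1 * (t.2.2 == idx k)%:R * mon t.2.1 (x i) *
   ((l <= mdeg t.2.1)%N%:R * e ^+ mdeg t.2.1 - (mdeg t.2.1 == l)%N%:R * e ^+ l)).
  apply: vanish_sum => t _; apply: vanishZ.
  have [lt|gt|eq] := ltngtP (mdeg t.2.1) l.
  - by apply: vanish_eq (vanish0 _) => e _; rewrite !mul0r subrr.
  - by apply: vanish_eq (vanishW gt (vanishX _)) => e _; rewrite mul0r subr0 mul1r.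
  - by apply: vanish_eq (vanish0 _) => e _; rewrite eq subrr.
apply: vanish_eq H => e _; rewrite E mxE mulr_sumr -sumrB; apply: eq_bigr => t _.
by rewrite monZ; ring.
Qed.

Lemma high_high_expand : mx_expand l.*2 high_high (Vl *m top_block *m Vl^T).
Proof.
move=> i j.
have E : (Vl *m top_block *m Vl^T) i j = \sum_(t <- S) t.1 * ((mdeg t.2.1 == l)%N%:R *
    (mdeg t.2.2 == l)%N%:R * (mon t.2.1 (x i) * mon t.2.2 (x j))).
  have E1 s' : (Vl *m top_block) i s' = \sum_(t <- S) t.1 * ((mdeg t.2.1 == l)%N%:R *
    (t.2.2 == mono o (k:=l) s')%:R * mon t.2.1 (x i)).
    rewrite mxE; transitivity (\sum_s \sum_(t <- S) mon (mono o s) (x i) *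
        (t.1 * ((t.2.1 == mono o (k:=l) s)%:R * (t.2.2 == mono o (k:=l) s')%:R))).
      by apply: eq_bigr => s _; rewrite vander_degE mxE bcoefE mulr_sumr.
    rewrite exchange_big; apply: eq_bigr => t _ /=.
    transitivity (t.1 * (t.2.2 == mono o (k:=l) s')%:R * ((mdeg t.2.1 == l)%:R * mon t.2.1 (x i))); last by ring.
    rewrite -(sum_mono o l t.2.1 (fun a => mon a (x i))) mulr_sumr.
    by apply: eq_bigr => s _; ring.
  rewrite mxE; transitivity (\sum_s' \sum_(t <- S) t.1 * ((mdeg t.2.1 == l)%N%:R *
    (t.2.2 == mono o (k:=l) s')%:R * mon t.2.1 (x i)) * mon (mono o s') (x j)).
    by apply: eq_bigr => s' _; rewrite E1 [_^T _ _]mxE vander_degE mulr_suml.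
  rewrite exchange_big; apply: eq_bigr => t _ /=.
  transitivity (t.1 * (mdeg t.2.1 == l)%:R * mon t.2.1 (x i) * ((mdeg t.2.2 == l)%:R * mon t.2.2 (x j))); last by ring.
  rewrite -(sum_mono o l t.2.2 (fun a => mon a (x j))) mulr_sumr.
  by apply: eq_bigr => s _; ring.
have H : vanish l.*2.+1 (fun e => \sum_(t <- S) t.1 * (mon t.2.1 (x i) * mon t.2.2 (x j)) *
   ((l <= mdeg t.2.1)%N%:R * (l <= mdeg t.2.2)%N%:R * e ^+ (mdeg t.2.1 + mdeg t.2.2) -
    (mdeg t.2.1 == l)%N%:R * (mdeg t.2.2 == l)%N%:R * e ^+ l.*2)).
  apply: vanish_sum => t _; apply: vanishZ.
  have [lt1|gt1|eq1] := ltngtP (mdeg t.2.1) l.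
  - by apply: vanish_eq (vanish0 _) => e _; rewrite !mul0r subrr.
  - have [lt2|le2] := ltnP (mdeg t.2.2) l.
      by apply: vanish_eq (vanish0 _) => e _; rewrite !(mulr0, mul0r) subrr.
    apply: (@vanish_eq _ _ _ (fun e : R => e ^+ (mdeg t.2.1 + mdeg t.2.2))).
      by move=> e _; rewrite !mul0r subr0 !mul1r.
    by apply: vanishW (vanishX _); lia.
  have [lt2|gt2|eq2] := ltngtP (mdeg t.2.2) l.
  - by apply: vanish_eq (vanish0 _) => e _; rewrite !(mulr0, mul0r) subrr.
  - apply: (@vanish_eq _ _ _ (fun e : R => e ^+ (mdeg t.2.1 + mdeg t.2.2))).
      by move=> e _; rewrite !(mulr0, mul0r) subr0 !mul1r.
    by apply: vanishW (vanishX _); lia.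
  - by apply: vanish_eq (vanish0 _) => e _; rewrite eq1 eq2 addnn subrr.
apply: vanish_eq H => e _; rewrite E mxE mulr_sumr -sumrB; apply: eq_bigr => t _.
by rewrite !monZ exprD; ring.
Qed.

Lemma high_high_top e : l = r -> high_high e = 0.
Proof.
move=> lrE; apply/matrixP => i j; rewrite !mxE big_seq big1 // => t /S_deg tS.
have r0 := smoothness_gt0 f_order.
case: leqP => [H1|_]; last by rewrite !mul0r mulr0.
case: leqP => [H2|_]; last by rewrite mulr0 mul0r mulr0.
by exfalso; have := leq_trans (leq_add H1 H2) tS; lia.
Qed.

(** Below the smoothness order, only polynomial terms reach order 2 l. *)
Lemma remainder_expand_smooth : (l < r)%N -> mx_expand l.*2 Rm (Vl *m top_block *m Vl^T).
Proof.
move=> lr' i j.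
have H1 : vanish l.*2.+1 (fun e => Rm e i j -
    (high_high e i j + fc r.*2.-1 * norm2 (x i - x j) ^+ r.*2.-1 * e ^+ r.*2.-1)).
  by apply: vanishW (remainder_expand i j); lia.
have H2 : vanish l.*2.+1 (fun e : R => fc r.*2.-1 * norm2 (x i - x j) ^+ r.*2.-1 * e ^+ r.*2.-1).
  by apply: vanishZ; apply: vanishW (vanishX _); lia.
apply: vanish_eq (vanishD (vanishD H1 H2) (high_high_expand i j)) => e _.
by ring.
Qed.

(** At the smoothness order, the first odd term of the profile leads. *)
Lemma remainder_expand_rough : l = r -> mx_expand r.*2.-1 Rm (fc r.*2.-1 *: dist_mx x r.*2.-1).
Proof.
move=> lrE i j; have r0 := smoothness_gt0 f_order.
have -> : (r.*2.-1.+1 = r.*2)%N by lia.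
apply: vanish_eq (remainder_expand i j) => e _.
by rewrite high_high_top // !mxE add0r [X in _ - X]mulrC.
Qed.

Lemma remainder_vanish i j : vanish l.*2.-1 (fun e => Rm e i j).
Proof.
have [lr'|] := ltnP l r.
  by apply: vanishW (mx_expand_vanish i j (remainder_expand_smooth lr')); lia.
move=> rl; have lrE : l = r by lia.
by apply: vanishW (mx_expand_vanish i j (remainder_expand_rough lrE)); rewrite lrE.
Qed.

(** * The flat limit *)

Let W_unit : W \in unitmx.
Proof. exact: low_mx_unit. Qed.

Let W_sym : W^T = W.
Proof. exact: low_mx_sym. Qed.

Let Ni (e : R) : 'M[R]_q := diag_mx (\row_k e ^- mdeg (idx k)).

Let DlNi e : 0 < e -> Dl e *m Ni e = 1%:M.
Proof.
move=> e0; rewrite /scale_mx /Ni mulmx_diag -diag_const_mx; congr diag_mx.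
by apply/rowP => k; rewrite !mxE divff // expf_neq0 // gt_eqF.
Qed.

Let N_expand : mx_expand l N (Vl *m top_low).
Proof. exact: high_low_expand. Qed.

(** What is left of the kernel matrix once the square in the low degrees is
    completed. *)
Definition schur_rem (e : R) : 'M[R]_n := Rm e - N e *m invmx W *m (N e)^T.

Lemma schur_rem_low : mx_expand l.*2 (fun e => N e *m invmx W *m (N e)^T)
  (Vl *m top_low *m invmx W *m (Vl *m top_low)^T).
Proof.
rewrite -addnn -{1}[l]addn0; apply: mx_expandM; last exact: mx_expandT.
by apply: mx_expandM; [exact: N_expand|exact: mx_expand_cst].
Qed.

(** Completing the square turns the kernel matrix into U (D W D) U^T plus the
    Schur complement, with U = V + N W^-1 D^-1.  The columns of U tend to those of
    V because N is O(e^l) while the entries of D^-1 are e^-|a| with |a| < l; the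
    inverse of the scaled middle factor has entries of order e^(p - |a| - |b|),
    and |a| + |b| <= 2l - 2 < p. *)
Lemma flat_limit_extended (p : nat) (alpha : R) (M : 'M[R]_n) (P : R -> subset_law R n) :
  (forall e, 0 < e -> DPP ((alpha * e ^- p) *: Km e) (P e)) ->
  0 < alpha -> (l.*2 <= p.+1)%N -> \rank V = q -> M^T = M ->
  mx_expand p schur_rem M ->
  exists Xs : subset_law R n,
    (forall X, P e X @[e --> 0^'+] --> Xs X) /\ extended_DPP (alpha *: M) V Xs.
Proof.
move=> P_dpp a0 lp rV MT HM.
have iWT : (invmx W)^T = invmx W by rewrite trmx_inv W_sym.
have DT e : (Dl e)^T = Dl e by rewrite tr_diag_mx.
have NT e : (Ni e)^T = Ni e by rewrite tr_diag_mx.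
have NiDl e : 0 < e -> Ni e *m Dl e = 1%:M by move=> e0; apply: mulmx1C; exact: DlNi.
apply: (dpp_limit_extended P_dpp
  (U := fun e => V + N e *m invmx W *m Ni e)
  (T := fun e => (alpha * e ^- p) *: (Dl e *m W *m Dl e))
  (Y := fun e => (alpha^-1 * e ^+ p) *: (Ni e *m invmx W *m Ni e))
  (S := fun e => (alpha * e ^- p) *: schur_rem e)) => //.
- move=> e e0; rewrite -scalemxAr -scalemxAl -scalerDr; congr (_ *: _).
  set U := V + _; pose Z := V *m Dl e + N e *m invmx W.
  have UZ : U *m Dl e = Z.
    by rewrite /U /Z mulmxDl -(mulmxA (N e *m invmx W)) NiDl // mulmx1.
  have -> : U *m (Dl e *m W *m Dl e) *m U^T = Z *m W *m Z^T.
    by rewrite -UZ trmx_mul DT !mulmxA.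
  have -> : Z *m W *m Z^T = (V *m Dl e) *m W *m (V *m Dl e)^T + N e *m (V *m Dl e)^T +
      (V *m Dl e) *m (N e)^T + N e *m invmx W *m (N e)^T.
    have ZW : Z *m W = V *m Dl e *m W + N e.
      by rewrite /Z mulmxDl -(mulmxA (N e)) mulVmx // mulmx1.
    have ZT : Z^T = (V *m Dl e)^T + invmx W *m (N e)^T.
      by rewrite /Z linearD /= (trmx_mul (N e)) iWT.
    rewrite ZW ZT mulmxDr !mulmxDl (mulmxA (V *m Dl e *m W)) -(mulmxA (V *m Dl e) W (invmx W)).
    by rewrite mulmxV // mulmx1 (mulmxA (N e)) !addrA.
  rewrite /schur_rem /remainder_mx.
  set B := _ + N e *m _ + _ *m (N e)^T; set C := N e *m invmx W *m _.
  by rewrite -[Km e - B - C]addrA -opprD [RHS]addrC subrK.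
- move=> e e0; rewrite -scalemxAl -scalemxAr scalerA.
  have -> : alpha * e ^- p * (alpha^-1 * e ^+ p) = 1.
    by field; rewrite expf_neq0 ?gt_eqF.
  rewrite scale1r !mulmxA -[_ *m Dl e *m Ni e]mulmxA DlNi // mulmx1.
  by rewrite -[_ *m W *m invmx W]mulmxA mulmxV // mulmx1 DlNi.
- have H : mx_expand l (fun e => N e *m invmx W) (Vl *m top_low *m invmx W).
    by have := mx_expandM N_expand (mx_expand_cst (invmx W)); rewrite addn0.
  move=> i k; apply: vanish_cvg; apply: (@vanish_divX _ 1 (mdeg (idx k))).
  have lk : (1 + mdeg (idx k) <= l)%N by rewrite add1n; exact: colidx_deg.
  apply: vanish_eq (vanishW lk (mx_expand_vanish i k H)) => e e0.
  rewrite mxE addrAC subrr add0r mul_mx_diag mxE [(\row_k _) _ _]mxE mulrCA divff ?mulr1 //.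
  by rewrite expf_neq0 // gt_eqF.
- exact: mx_expand_cvg.
- move=> k k'; apply: vanish_cvg; apply: (@vanish_divX _ 1 (mdeg (idx k) + mdeg (idx k'))).
  have H : vanish (1 + (mdeg (idx k) + mdeg (idx k'))) (fun e : R => alpha^-1 * invmx W k k' * e ^+ p).
    apply: vanishZ; apply: vanishW (vanishX _).
    have := colidx_deg o k; have := colidx_deg o k'; move: lp (mdeg _) (mdeg _); clear; lia.
  apply: vanish_eq H => e e0.
  rewrite [X in _ * (_ - X)]mxE subr0 mxE mul_mx_diag mxE mul_diag_mx mxE !mxE exprD.
  by field; rewrite !expf_neq0 ?gt_eqF.
- by rewrite linearZ /= MT.
Qed.

(** Half of the positive form c |(V D)^T u|^2 absorbs the mixed terms by Young's
    inequality, at the cost of a multiple of |N^T u|^2 = O(e^(2l)) |u|^2. *)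
Lemma kernel_lower_bound : exists c C dl : R, [/\ 0 < c, 0 <= C, 0 < dl &
  forall e, 0 < e -> e < dl -> forall u,
    c * e ^+ (l.-1).*2 * sqn (V^T *m u) + qform (Rm e) u - C * e ^+ l.*2 * sqn u <=
    qform (Km e) u].
Proof.
have [C0 [c [_ c0 Hc]]] : exists C c : R, [/\ 0 <= C, 0 < c & forall u : 'cV[R]_q,
    c * sqn u <= C * sqn ((0 : 'M[R]_(q, 0))^T *m u) + qform W u].
  apply: finsler => u u0 _.
  exact: (low_mx_pos u0).
have {}Hc (u : 'cV[R]_q) : c * sqn u <= qform W u.
  by apply: le_trans (Hc u) _; rewrite {1}/sqn big_ord0 mulr0 add0r.
have [Cn [dl [Cn0 dl0 HN]]] : exists C dl : R, [/\ 0 <= C, 0 < dl &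
    forall e, 0 < e -> e < dl -> forall u, `|qform (N e *m (N e)^T) u| <= C * e ^+ l.*2 * sqn u].
  apply: qform_vanish => i j; rewrite -addnn.
  exact: (mx_expand_vanish i j (mx_expandM N_expand (mx_expandT N_expand))).
exists (c / 2), (2 / c * Cn), (Num.min dl 1); split.
- by rewrite divr_gt0.
- by rewrite mulr_ge0 // divr_ge0 // ltW.
- by rewrite lt_min dl0 ltr01.
move=> e e0; rewrite lt_min => /andP[edl e1] u.
pose y := (V *m Dl e)^T *m u; pose z := (N e)^T *m u.
pose b := \sum_k y k ord0 * z k ord0.
have KE : qform (Km e) u = qform W y + b + b + qform (Rm e) u.
  have {1}-> : Km e = (V *m Dl e) *m W *m (V *m Dl e)^T + N e *m (V *m Dl e)^T +
      (V *m Dl e) *m (N e)^T + Rm e by rewrite /remainder_mx addrC subrK.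
  rewrite !qformD; congr (_ + _ + _ + _).
  - by rewrite /qform /y (trmx_mul (V *m Dl e)^T u) trmxK !mulmxA.
  - rewrite /qform /b !mulmxA -mulmxA mxE; apply: eq_bigr => k _.
    by rewrite -{1}[N e]trmxK -trmx_mul mxE mulrC.
  - rewrite /qform /b [u^T *m (_ *m (N e)^T)]mulmxA -[u^T *m _ *m (N e)^T *m u]mulmxA mxE.
    by apply: eq_bigr => k _; rewrite -{1}[V *m Dl e]trmxK -trmx_mul mxE.
have yz : - (c / 2 * sqn y) - 2 / c * sqn z <= b + b.
  rewrite -subr_ge0 /b /sqn.
  have -> : \sum_k y k ord0 * z k ord0 + \sum_k y k ord0 * z k ord0 -
     (- (c / 2 * \sum_i y i ord0 ^+ 2) - 2 / c * \sum_i z i ord0 ^+ 2) =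
     \sum_k c / 2 * (y k ord0 + 2 / c * z k ord0) ^+ 2.
    rewrite opprD !opprK !mulr_sumr -!big_split; apply: eq_bigr => k _ /=.
    by field; exact: lt0r_neq0.
  by apply: sumr_ge0 => k _; apply: mulr_ge0; [apply: divr_ge0 => //; exact: ltW|exact: sqr_ge0].
have zN : sqn z <= Cn * e ^+ l.*2 * sqn u.
  by rewrite /z -qform_gram; apply: le_trans (ler_norm _) (HN e e0 edl u).
have yV : e ^+ (l.-1).*2 * sqn (V^T *m u) <= sqn y.
  rewrite /sqn mulr_sumr; apply: ler_sum => k _.
  have -> : y k ord0 = e ^+ mdeg (idx k) * (V^T *m u) k ord0.
    rewrite /y trmx_mul -mulmxA tr_diag_mx mul_diag_mx mxE [(\row_k _) _ _]mxE.
    by [].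
  rewrite exprMn -exprM; apply: ler_wpM2r; first exact: sqr_ge0.
  apply: ler_wiXn2l; [exact: ltW|exact: ltW|].
  by have := colidx_deg o k; move: (mdeg _) => m; clear; lia.
rewrite KE; have := Hc y.
have zN' : 2 / c * sqn z <= 2 / c * Cn * e ^+ l.*2 * sqn u.
  rewrite -!mulrA (mulrA 2) ?(mulrA Cn).
  by rewrite mulrA; apply: ler_wpM2l => //; apply: divr_ge0 => //; exact: ltW.
have yV' : c / 2 * e ^+ (l.-1).*2 * sqn (V^T *m u) <= c / 2 * sqn y.
  by rewrite -!mulrA [in leRHS]mulrA [in leLHS]mulrA; apply: ler_wpM2l => //; rewrite divr_ge0 // ltW.
move=> Hy; have : c * sqn y = c / 2 * sqn y + c / 2 * sqn y by field.
lra.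
Qed.

(** The scaling e^-p turns a lower bound of order m < p into one that blows up. *)
Lemma full_limit_of_lower_bound (p m : nat) (alpha c : R) (P : R -> subset_law R n) :
  (forall e, 0 < e -> DPP ((alpha * e ^- p) *: Km e) (P e)) ->
  0 < alpha -> (m < p)%N -> 0 < c ->
  (exists2 dl, 0 < dl & forall e, 0 < e -> e < dl -> forall u,
    c * e ^+ m * sqn u <= qform (Km e) u) ->
  exists Xs : subset_law R n,
    (forall X, P e X @[e --> 0^'+] --> Xs X) /\ Xs [set: 'I_n]%SET = 1.
Proof.
move=> P_dpp a0 mp c0 [dl dl0 H].
apply: (dpp_limit_full P_dpp (h := fun e => (alpha * c)^-1 * e ^+ (p - m))).
  by apply: vanishZ; apply: vanishW (vanishX _); rewrite subn_gt0.
exists dl => // e e0 edl u.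
have k0 : 0 < (alpha * c)^-1 * e ^+ (p - m) * (alpha * e ^- p).
  by rewrite !mulr_gt0 ?invr_gt0 ?mulr_gt0 ?exprn_gt0.
rewrite qformZ mulrA; apply: le_trans (ler_wpM2l (ltW k0) (H e e0 edl u)).
have pE : e ^+ p = e ^+ (p - m) * e ^+ m by rewrite -exprD subnK // ltnW.
rewrite le_eqVlt; apply/orP; left; apply/eqP; rewrite pE.
by field; rewrite !expf_neq0 ?gt_eqF.
Qed.

(** With independent rows V^T is injective, and the terms of low degree alone
    bound the kernel matrix below by a multiple of e^(2l-2). *)
Lemma flat_limit_full_rank (p : nat) (alpha : R) (P : R -> subset_law R n) :
  (forall e, 0 < e -> DPP ((alpha * e ^- p) *: Km e) (P e)) ->
  0 < alpha -> (0 < l)%N -> (l.*2 <= p.+1)%N -> \rank V = n ->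
  exists Xs : subset_law R n,
    (forall X, P e X @[e --> 0^'+] --> Xs X) /\ Xs [set: 'I_n]%SET = 1.
Proof.
move=> P_dpp a0 l0 lp rV.
have [c [C [dl [c0 C0 dl0 H]]]] := kernel_lower_bound.
have [C1 [c1 [C10 c10 H1]]] : exists C c : R, [/\ 0 <= C, 0 < c & forall u : 'cV[R]_n,
    c * sqn u <= C * sqn (V^T *m u) + qform 0 u].
  apply: finsler => u u0 Vu; have fV : row_free V by rewrite /row_free rV.
  have uV : u^T *m V = 0 by rewrite -[V]trmxK -trmx_mul Vu trmx0.
  have : u^T = 0 by apply/eqP; rewrite -(mulmx_free_eq0 _ fV) uV.
  by move=> /(congr1 trmx); rewrite trmxK trmx0 => uE; rewrite uE eqxx in u0.
have [C2 [dl2 [C20 dl20 H2]]] := qform_vanish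
  remainder_vanish.
have C11 : 0 < C1 + 1 by rewrite ltr_wpDl.
pose c2 := c * (c1 / (C1 + 1)).
have c20 : 0 < c2 by rewrite mulr_gt0 // divr_gt0.
apply: (full_limit_of_lower_bound (m := (l.-1).*2) (c := c2 / 2) P_dpp) => //.
- by move: l0 lp; clear; lia.
- by rewrite divr_gt0.
pose K := C + C2 + 1; have K0 : 0 < K by rewrite ltr_wpDl // addr_ge0.
exists (Num.min (Num.min dl dl2) (Num.min 1 (c2 / 2 / K))).
  by rewrite !lt_min dl0 dl20 ltr01 divr_gt0 // divr_gt0.
move=> e e0; rewrite !lt_min => /andP[/andP[e1 e2] /andP[e3 e4]].
move=> u.
apply: le_trans (H e e0 e1 u).
have := H2 e e0 e2 u; rewrite ler_norml => /andP[HR _].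
have Hq : c1 * sqn u <= (C1 + 1) * sqn (V^T *m u).
  apply: le_trans (H1 u) _; rewrite /qform mulmx0 mul0mx mxE addr0.
  by apply: ler_wpM2r; [exact: sqn_ge0|rewrite lerDl].
have Hq2 : c2 * e ^+ (l.-1).*2 * sqn u <= c * e ^+ (l.-1).*2 * sqn (V^T *m u).
  have -> : c2 * e ^+ (l.-1).*2 * sqn u =
    c * e ^+ (l.-1).*2 * ((C1 + 1)^-1 * (c1 * sqn u)).
    by rewrite /c2; field; exact: lt0r_neq0.
  apply: ler_wpM2l; first by rewrite mulr_ge0 ?exprn_ge0 // ltW.
  by rewrite ler_pdivrMl.
have eE : e ^+ l.*2.-1 = e * e ^+ (l.-1).*2 by rewrite -exprS; congr (_ ^+ _); move: l0; clear; lia.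
have eE2 : e ^+ l.*2 = e ^+ 2 * e ^+ (l.-1).*2 by rewrite -exprD; congr (_ ^+ _); move: l0; clear; lia.
rewrite eE in HR; rewrite eE2; set t := e ^+ (l.-1).*2 * sqn u.
have t0 : 0 <= t by rewrite mulr_ge0 ?sqn_ge0 // exprn_ge0 // ltW.
have HR' : - (C2 * e * t) <= qform (Rm e) u.
  by apply: le_trans HR; rewrite lerN2 /t le_eqVlt; apply/orP; left; apply/eqP; ring.
have HC' : C * (e ^+ 2 * e ^+ (l.-1).*2) * sqn u <= C * e * t.
  have -> : C * (e ^+ 2 * e ^+ (l.-1).*2) * sqn u = C * e * t * e by rewrite /t; ring.
  by apply: ler_piMr; [apply: mulr_ge0 => //; apply: mulr_ge0 => //; exact: ltW|exact: ltW].
have Hq3 : c2 * t <= c * e ^+ (l.-1).*2 * sqn (V^T *m u) by rewrite /t mulrA.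
have He : K * e * t <= c2 / 2 * t.
  by apply: ler_wpM2r => //; rewrite mulrC -ler_pdivlMr // ltW.
have Ke : K * e * t = C * e * t + C2 * e * t + e * t by rewrite /K; ring.
have et : 0 <= e * t by rewrite mulr_ge0 // ltW.
have -> : c2 / 2 * e ^+ (l.-1).*2 * sqn u = c2 / 2 * t by rewrite /t mulrA.
have E2 : c2 * t = c2 / 2 * t + c2 / 2 * t by field.
lra.
Qed.

Lemma annihilates_vander (u : 'cV[R]_n) : V^T *m u = 0 -> annihilates x (fun i => u i ord0) l.
Proof.
move=> Vu a /(colidx_surj o)[k <-].
have := congr1 (fun M : 'cV[R]_q => M k ord0) Vu; rewrite mxE [RHS]mxE => Vk; rewrite -[RHS]Vk.
by apply: eq_bigr => i _; rewrite [_^T _ _]mxE vander_ltE mulrC.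
Qed.

(** Where V^T u is small, the distance matrix takes over at the order e^(2r-1).
    Finsler's lemma balances the two regimes, so that no assumption on the rank
    of V is involved. *)
Lemma flat_limit_rough (p : nat) (alpha : R) (P : R -> subset_law R n) :
  (forall e, 0 < e -> DPP ((alpha * e ^- p) *: Km e) (P e)) ->
  0 < alpha -> injective x -> l = r -> (r.*2 < p.+1)%N ->
  exists Xs : subset_law R n,
    (forall X, P e X @[e --> 0^'+] --> Xs X) /\ Xs [set: 'I_n]%SET = 1.
Proof.
move=> P_dpp a0 x_inj lrE rp; have r0 := smoothness_gt0 f_order.
have [c [C [dl [c0 C0 dl0 H]]]] := kernel_lower_bound.
pose D := fc r.*2.-1 *: dist_mx x r.*2.-1.
have [C1 [c1 [C10 c10 H1]]] : exists C c : R, [/\ 0 <= C, 0 < c & forall u : 'cV[R]_n,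
    c * sqn u <= C * sqn (V^T *m u) + qform D u].
  apply: finsler => u u0 Vu.
  have [t0 ut0] : exists t, u t ord0 != 0.
    apply/existsP; apply: contraNT u0; rewrite negb_exists => /forallP U.
    by apply/eqP/colP => k; rewrite mxE; apply/eqP; have := U k; rewrite negbK.
  have ann : annihilates x (fun i => u i ord0) r by rewrite -lrE; exact: annihilates_vander.
  have := distance_form_gt0 d_gt0 kappa_pd kappa_stat f_analytic f_order x_inj ann ut0.
  suff -> : qform D u = fc r.*2.-1 *
    \sum_s \sum_t u s ord0 * u t ord0 * norm2 (x s - x t) ^+ r.*2.-1 by [].
  rewrite qformE mulr_sumr; apply: eq_bigr => i _; rewrite mulr_sumr; apply: eq_bigr => j _.
  by rewrite !mxE; ring.
have [C2 [dl2 [C20 dl20 H2]]] : exists C dl : R, [/\ 0 <= C, 0 < dl &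
    forall e, 0 < e -> e < dl -> forall u,
      `|qform (Rm e - e ^+ r.*2.-1 *: D) u| <= C * e ^+ r.*2 * sqn u].
  apply: qform_vanish => i j.
  have rE : r.*2 = r.*2.-1.+1 by move: r0; clear; lia.
  rewrite rE; have := remainder_expand_rough lrE i j.
  by apply: vanish_eq => e _; rewrite !mxE.
have C11 : 0 < C1 + 1 by rewrite ltr_wpDl.
apply: (full_limit_of_lower_bound (m := r.*2.-1) (c := c1 / 2) P_dpp) => //.
- by move: r0 rp; clear; lia.
- by rewrite divr_gt0.
pose K := C + C2 + 1; have K0 : 0 < K by rewrite ltr_wpDl // addr_ge0.
exists (Num.min (Num.min dl dl2) (Num.min (c / (C1 + 1)) (c1 / 2 / K))).
  by rewrite !lt_min dl0 dl20 !divr_gt0.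
move=> e e0; rewrite !lt_min => /andP[/andP[e1 e2] /andP[e3 e4]] u.
apply: le_trans (H e e0 e1 u).
have := H2 e e0 e2 u; rewrite ler_norml => /andP[HR _].
have RE : qform (Rm e) u = qform (Rm e - e ^+ r.*2.-1 *: D) u + e ^+ r.*2.-1 * qform D u.
  by rewrite -qformZ -qformD subrK.
have eE : e ^+ r.*2 = e * e ^+ r.*2.-1.
  by rewrite -exprS; congr (_ ^+ _); move: r0; clear; lia.
have eE2 : e ^+ r.*2.-1 = e * e ^+ (l.-1).*2.
  by rewrite -exprS lrE; congr (_ ^+ _); move: r0; clear; lia.
have eE3 : e ^+ l.*2 = e * e ^+ r.*2.-1 by rewrite lrE.
rewrite eE in HR; rewrite eE3 RE.
set E := e ^+ r.*2.-1 in HR *; have E0 : 0 < E by exact: exprn_gt0.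
set G := sqn (V^T *m u); have G0 : 0 <= G by exact: sqn_ge0.
set t := E * sqn u; have t0 : 0 <= t by rewrite mulr_ge0 ?sqn_ge0 // ltW.
have -> : c1 / 2 * E * sqn u = c1 / 2 * t by rewrite /t mulrA.
have -> : C * (e * E) * sqn u = C * e * t by rewrite /t; ring.
have HR' : - (C2 * e * t) <= qform (Rm e - E *: D) u.
  by apply: le_trans HR; rewrite lerN2 /t le_eqVlt; apply/orP; left; apply/eqP; ring.
have HG : C1 * (E * G) <= c * e ^+ (l.-1).*2 * G.
  rewrite {1}/E eE2.
  have -> : C1 * (e * e ^+ (l.-1).*2 * G) = e * C1 * (e ^+ (l.-1).*2 * G) by ring.
  rewrite -[leRHS]mulrA; apply: ler_wpM2r; first by rewrite mulr_ge0 // exprn_ge0 // ltW.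
  apply: le_trans (_ : e * (C1 + 1) <= _).
    by apply: ler_wpM2l; [exact: ltW|rewrite lerDl].
  by rewrite -ler_pdivlMr // ltW.
have HF : c1 * t <= C1 * (E * G) + E * qform D u.
  have := ler_wpM2l (ltW E0) (H1 u).
  have -> : E * (c1 * sqn u) = c1 * t by rewrite /t; ring.
  by rewrite mulrDr -/G [E * (C1 * G)]mulrCA.
have He : K * e * t <= c1 / 2 * t.
  by apply: ler_wpM2r => //; rewrite mulrC -ler_pdivlMr // ltW.
have Ke : K * e * t = C * e * t + C2 * e * t + e * t by rewrite /K; ring.
have et : 0 <= e * t by rewrite mulr_ge0 // ltW.
have E2 : c1 * t = c1 / 2 * t + c1 / 2 * t by field.
lra.
Qed.

(** The Schur complement in the Wronskian matrix, written with the coefficients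
    of the even part. *)
Definition top_schur : 'M[R]_(dimH l d) :=
  top_block - top_low *m invmx low_mx *m top_low^T.

Lemma top_schur_sym : top_schur^T = top_schur.
Proof.
rewrite /top_schur linearB /= !trmx_mul trmxK trmx_inv low_mx_sym mulmxA.
by congr (_ - _); apply/matrixP => s s'; rewrite !mxE bcoef_sym.
Qed.

Lemma schur_rem_smooth : (l < r)%N ->
  mx_expand l.*2 schur_rem (Vl *m top_schur *m Vl^T).
Proof.
move=> lr'; have := mx_expandB (remainder_expand_smooth lr') schur_rem_low.
suff -> : Vl *m top_schur *m Vl^T = Vl *m top_block *m Vl^T -
  Vl *m top_low *m invmx low_mx *m (Vl *m top_low)^T by [].
by rewrite /top_schur mulmxBr mulmxBl trmx_mul !mulmxA.
Qed.

(** For l = r the correction N W^-1 N^T is O(e^(2r)), below the leading term. *)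
Lemma schur_rem_rough : l = r ->
  mx_expand r.*2.-1 schur_rem (fc r.*2.-1 *: dist_mx x r.*2.-1).
Proof.
move=> lrE; have r0 := smoothness_gt0 f_order.
have rl : (r.*2.-1 < l.*2)%N by rewrite lrE; move: r0; clear; lia.
have := mx_expandB (remainder_expand_rough lrE) (mx_expandW rl schur_rem_low).
by rewrite subr0.
Qed.

Lemma wronskian_schur_top : (l < r)%N -> wronskian_schur o kappa l = top_schur.
Proof.
move=> lr'.
have key (a b : mindex d) : (mdeg a <= l)%N -> (mdeg b <= l)%N ->
    kernel_deriv kappa a b 0 0 / ((mfact a)%:R * (mfact b)%:R) = bcoef S a b.
  move=> al bl; rewrite (kernel_deriv_coef kappa_stat f_analytic f_order S_even).
    rewrite mulrC mulKf // -natrM pnatr_eq0 -lt0n muln_gt0.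
    by rewrite !prodn_gt0 // => i; rewrite fact_gt0.
  by move: lr' al bl; move: (mdeg a) (mdeg b); clear; lia.
have il (i : 'I_l) : (i <= l)%N by exact: ltnW.
have E1 : wronskian_block o kappa l l = top_block.
  by apply/matrixP => s t; rewrite !mxE key ?mono_deg.
have E2 : wronskian_ll o kappa l = top_low.
  by apply/matrixP => s t; rewrite !mxE key ?mono_deg.
have E3 : wronskian_lt o kappa l = low_mx.
  by apply/matrixP => s t; rewrite !mxE key ?mono_deg.
have E4 : wronskian_ur o kappa l = top_low^T.
  by apply/matrixP => s t; rewrite !mxE key ?mono_deg // bcoef_sym.
by rewrite /wronskian_schur /top_schur E1 E2 E3 E4.
Qed.

End Decomposition.

(** * The theorem *)

Theorem theorem6p4 (R : realType) (d n p l r : nat) (alpha : R)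
    (x : 'I_n -> 'rV[R]_d) (kappa : 'rV[R]_d -> 'rV[R]_d -> R)
    (f : R -> R) (fc : nat -> R) (o : mono_order d)
    (Xe : R -> subset_law R n)
    (d_gt0 : (0 < d)%N)
    (alpha_gt0 : 0 < alpha)
    (x_inj : injective x)
    (kappa_pd : posdef_kernel kappa)
    (kappa_stat : stationary kappa f)
    (f_analytic : analytic_at0 f fc)
    (f_order : smoothness_order fc r)
    (l_def : l.*2 = p \/ l.*2 = p.+1)
    (V_rank : (p.+1 <= r.*2)%N -> \rank (vander_lt o x l) = minn n (dimP l d))
    (Xe_dpp : forall e : R, 0 < e ->
       DPP ((alpha * e ^- p) *: kernel_mx (scaled_kernel f e) x) (Xe e)) :
  exists Xs : subset_law R n,
    [/\ forall X : {set 'I_n}, Xe e X @[e --> 0^'+] --> Xs X,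
        (n <= dimP l d)%N -> Xs [set: 'I_n]%SET = 1 &
        (dimP l d < n)%N ->
        [/\ (r.*2 < p.+1)%N -> Xs [set: 'I_n]%SET = 1,
            (p.+1 < r.*2)%N ->
              (odd p ->
                 fixed_size_DPP (dimP l d)
                   (vander_lt o x l *m (vander_lt o x l)^T) Xs) /\
              (~~ odd p ->
                 extended_DPP
                   (alpha *: (vander_deg o x l *m wronskian_schur o kappa l *m
                              (vander_deg o x l)^T))
                   (vander_lt o x l) Xs) &
            r.*2 = p.+1 ->
              extended_DPP (alpha *: (fc r.*2.-1 *: dist_mx x r.*2.-1))
                (vander_lt o x r) Xs]].
Proof.
have [S [S_deg S_even S_sym]] :=
  bipoly_symmetric (even_part_sym (d := d) fc r) (even_part_bipoly (d := d) fc r).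
have r0 := smoothness_gt0 f_order.
(* the scaling outgrows the first odd term *)
have [rp|pr] := ltnP r.*2 p.+1.
  have [Xs [Xs_lim Xs1]] := flat_limit_rough d_gt0 kappa_pd kappa_stat f_analytic f_order
    o (leqnn r) S_deg S_even S_sym Xe_dpp alpha_gt0 x_inj erefl rp.
  exists Xs; split=> // _; split=> // [pr|rE].
    by have := ltn_trans rp pr; rewrite ltnn.
  by rewrite rE ltnn in rp.
have lr : (l <= r)%N by move: l_def pr; clear; lia.
have lp : (l.*2 <= p.+1)%N by move: l_def; clear; lia.
have {}V_rank := V_rank pr.
have [nl|ln] := leqP n (dimP l d).
  rewrite (minn_idPl nl) in V_rank.
  case: (posnP l) => [l0|l0].
    have n0 : n = 0%N by apply/eqP; move: nl; rewrite l0 leqn0.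
    (* V has no column, so there is no point either: one subset only *)
    have XT (X : {set 'I_n}) : X = [set: 'I_n]%SET.
      by apply/setP => -[i ni]; exfalso; move: ni; rewrite n0.
    have P1 (P : subset_law R n) X : P X = 1.
      rewrite -[RHS](prob_sum1 P) (bigD1 X) //= big1 ?addr0 // => Y.
      by rewrite (XT X) (XT Y) eqxx.
    exists (Xe 1); split=> [X|_|//]; last exact: P1.
    by apply: cvg_near_cst; apply: nearW => e; rewrite !P1.
  have [Xs [Xs_lim Xs1]] := flat_limit_full_rank d_gt0 kappa_pd kappa_stat f_analytic f_order
    lr S_deg S_even S_sym Xe_dpp alpha_gt0 l0 lp V_rank.
  by exists Xs; split.
have dimE := sum_dimH l d_gt0.
rewrite (minn_idPr (ltnW ln)) -dimE in V_rank.
pose flat M := flat_limit_extended d_gt0 kappa_pd kappa_stat f_analytic f_order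
    lr S_even S_sym Xe_dpp alpha_gt0 lp V_rank (M := M).
have [rE|rE] := eqVneq r.*2 p.+1.
  have lE : l = r by move: l_def rE; clear; lia.
  have pE : p = r.*2.-1 by rewrite rE.
  have [] := flat (fc r.*2.-1 *: dist_mx x r.*2.-1).
  - rewrite linearZ /=; congr (_ *: _); apply/matrixP => i j; rewrite !mxE.
    by rewrite -norm2N opprB.
  - by rewrite pE; exact: schur_rem_rough.
  move=> Xs [Xs_lim Xs_law]; exists Xs; split=> // _.
  split=> [//|rp|_]; first by move: rp; rewrite rE ltnn.
  suff H k : l = k -> extended_DPP (alpha *: (fc r.*2.-1 *: dist_mx x r.*2.-1))
      (vander_lt o x k) Xs by exact: H.
  by move=> <-.
have {rE}pr : (p.+1 < r.*2)%N by rewrite ltn_neqAle eq_sym rE.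
have lr' : (l < r)%N by move: l_def pr; clear; lia.
have sm := schur_rem_smooth d_gt0 kappa_stat f_analytic f_order o x lr S_even S_sym lr'.
case: (boolP (odd p)) => odd_p.
  have lpE : l.*2 = p.+1.
    by case: l_def => // lpE; move: odd_p; rewrite -lpE odd_double.
  have [] := flat 0; first exact: trmx0.
    by apply: mx_expandW sm; rewrite lpE.
  move=> Xs [Xs_lim]; rewrite scaler0 => /extended_fixed_size Xs_law.
  exists Xs; split=> // _.
  split=> [//|_|rE]; first by split=> // _; rewrite -dimE.
  by move: pr; rewrite rE ltnn.
have lpE : l.*2 = p.
  by case: l_def => // lpE; move: (odd_double l); rewrite lpE /= => /negbFE /(negP odd_p).
have [] := flat (vander_deg o x l *m top_schur o l S *m (vander_deg o x l)^T).
- by rewrite !trmx_mul trmxK (top_schur_sym o l S_sym) mulmxA.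
- by rewrite -{1}lpE.
rewrite -(wronskian_schur_top kappa_stat f_analytic f_order o S_even S_sym lr').
move=> Xs [Xs_lim Xs_law]; exists Xs; split; [exact: Xs_lim|by []|move=> _].
split; [by []|by []|move=> rE].
by move: pr; rewrite rE ltnn.
Qed.
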